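(* Let $\Omega\subset\mathbb{R}^n$ be a bounded $C^{4,\alpha}$-smooth domain, let $$Lu = \sum_{i,j=1}^n a_{ij}\,\partial_i\partial_j u + \sum_{i=1}^n b_i\,\partial_i u + c\,u$$ be an elliptic operator with coefficients $a_{ij}, b_i, c \in C^{2,\alpha}(\overline{\Omega})$, and let $$D(L) = \{u \in C^{2,\alpha}(\overline{\Omega}) \mid u = Lu = 0 \text{ on } \partial\Omega\}.$$ Then there exists a linear bounded operator $E: D(L)\to C_c^{2,\alpha}(\mathbb{R}^n)$ such that for all $u\in D(L)$ one has $Eu|_{\Omega}=u$ and $$\sup_{y\in\mathbb{R}^n}|Eu(y)| = \sup_{y\in\Omega}|u(y)|.$$
   Context: Here $n \in \mathbb{N}$ and $0<\alpha<1$ is fixed. $C^{k,\alpha}(\overline{\Omega})$ is the usual Hölder space of $k$ times Hölder continuously differentiable functions whose derivatives extend (Hölder) continuously to the boundary; $Lu$ on $\partial\Omega$ is defined using these continuous extensions of the derivatives and coefficients. $C_c^{2,\alpha}(\mathbb{R}^n)$ is the space of twice Hölder continuously differentiable functions (exponent $\alpha$) with compact support in $\mathbb{R}^n$. Boundedness of $E$ is with respect to the $C^{2,\alpha}$ norms on $D(L)\subset C^{2,\alpha}(\overline{\Omega})$ and on $C^{2,\alpha}_c(\mathbb{R}^n)$. Standing assumptions on $L$: the coefficients are bounded by a constant $0<C<\infty$, and the matrix $A=(a_{ij})_{i,j}$ is symmetric and uniformly elliptic with ellipticity constant $\lambda>0$ (i.e. $\langle A(x)\xi,\xi\rangle \ge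 \lambda|\xi|^2$ for all $x \in \overline{\Omega}$, $\xi\in\mathbb{R}^n$). A domain $\Omega\subset\mathbb{R}^n$ is called $C^{k,\alpha}$-smooth if for each $x_0\in\partial\Omega$ there exist a neighborhood $V$ of $x_0$, a neighborhood $U$ of $0$ and a $C^{k,\alpha}$-smooth diffeomorphism $\psi:U\to V$ with $\psi(U\cap\{x_n=0\})=\partial\Omega\cap V$ and $\psi(U\cap\{x_n>0\})=\Omega\cap V$. *)

(* Defs.v *)
From HB Require Import structures.
From mathcomp Require Import all_boot all_order all_algebra.
From mathcomp Require Import all_classical all_reals all_analysis.
Set Implicit Arguments.
Unset Strict Implicit.
Unset Printing Implicit Defensive.
Import Order.TTheory GRing.Theory Num.Theory.
Import numFieldNormedType.Exports.
Local Open Scope classical_set_scope.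
Local Open Scope ring_scope.

Section HoelderSpaces.
Context {R : realType} {n : nat}.
(* R^(n+1), so that every dimension >= 1 is covered; the library's norm on this
   type is the sup norm, which induces the usual topology. *)
Local Notation V := 'rV[R]_n.+1.
Implicit Types (f g : V -> R) (Omega U W : set V) (s : seq 'I_n.+1).

Definition enorm (x : V) : R := Num.sqrt (\sum_(i < n.+1) x 0 i ^+ 2).

Definition boundary Omega : set V := closure Omega `\` interior Omega.

Definition domain Omega : Prop :=
  [/\ Omega !=set0, open Omega & connected Omega].

(* [:: i; j] stands for d_i d_j, i.e. the j-th derivative is taken first. *)
Definition partial s f : V -> R :=
  foldr (fun i g x => 'D_(delta_mx 0 i) g x) f s.

Definition Ck (k : nat) U f : Prop :=
  forall s,
    ((size s <= k)%N -> forall x, U x -> {for x, continuous (partial s f)}) /\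
    ((size s < k)%N -> forall i x, U x ->
        derivable (partial s f) x (delta_mx 0 i)).

Definition hoelder_on (alpha : R) (A : set V) f : Prop :=
  exists M : R, forall x y, A x -> A y ->
    `|f x - f y| <= M * enorm (x - y) `^ alpha.

(* C^{k,alpha}(U) for an open set U, with local Hoelder constants. *)
Definition Ckalpha_open (k : nat) (alpha : R) U f : Prop :=
  Ck k U f /\
  forall s, size s = k -> forall x, U x ->
    exists2 W, nbhs x W & hoelder_on alpha (U `&` W) (partial s f).

(* The continuous extension to the closure of Omega of a function on Omega. *)
Definition cext Omega f : V -> R := fun x => lim (f @ within Omega (nbhs x)).

(* C^{k,alpha}(closure Omega) for an open set Omega. A function on the closure
   of Omega is represented by a function on the whole space whose values off
   the closure are irrelevant.
   Whenever cext Omega g is continuous within the closure of Omega and g is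
   continuous on the open set Omega, cext Omega g is a genuine extension of g,
   even though lim is total. *)
Definition Ckalpha (k : nat) (alpha : R) Omega f : Prop :=
  [/\ Ck k Omega f,
      {within closure Omega, continuous f},
      forall s, (size s <= k)%N ->
        {within closure Omega, continuous (cext Omega (partial s f))} &
      forall s, size s = k ->
        hoelder_on alpha (closure Omega) (cext Omega (partial s f))].

(* sum_(j <= k) max_(|beta| = j) sup |d^beta f|
     + max_(|beta| = k) [d^beta f]_alpha. *)
Definition Ckalpha_norm (k : nat) (alpha : R) Omega f : \bar R :=
  (\sum_(j < k.+1)
      ereal_sup [set z | exists s x,
        [/\ size s = j, Omega x & z = (`|partial s f x|)%:E]]
   + ereal_sup [set z | exists s x y,
        [/\ size s = k, Omega x, Omega y, x != y &
            z = (`|partial s f x - partial s f y|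
                 / enorm (x - y) `^ alpha)%:E]])%E.

(* C_c^{k,alpha}(R^(n+1)) *)
Definition Ckalpha_c (k : nat) (alpha : R) f : Prop :=
  Ckalpha k alpha setT f /\ compact (closure [set x | f x != 0]).

Definition Ckalpha_diffeo (k : nat) (alpha : R) U W (psi : V -> V) : Prop :=
  [/\ set_bij U W psi,
      forall i, Ckalpha_open k alpha U (fun x => psi x 0 i) &
      exists phi : V -> V,
        (forall x, U x -> phi (psi x) = x) /\
        (forall i, Ckalpha_open k alpha W (fun y => phi y 0 i))].

Definition Ckalpha_smooth (k : nat) (alpha : R) Omega : Prop :=
  forall x0, boundary Omega x0 ->
    exists (W U : set V) (psi : V -> V),
      [/\ open_nbhs x0 W, open_nbhs (0 : V) U, Ckalpha_diffeo k alpha U W psi,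
          psi @` (U `&` [set x | x 0 ord_max = 0]) = boundary Omega `&` W &
          psi @` (U `&` [set x | 0 < x 0 ord_max]) = Omega `&` W].

(* The value of Lu at points of the closure of Omega. *)
Definition Lop Omega (A : V -> 'M[R]_n.+1) (b : V -> V) (c : V -> R)
    (u : V -> R) : V -> R := fun x =>
  \sum_(i < n.+1) \sum_(j < n.+1) A x i j * cext Omega (partial [:: i; j] u) x
  + \sum_(i < n.+1) b x 0 i * cext Omega (partial [:: i] u) x
  + c x * u x.

Definition uniformly_elliptic Omega (lambda : R) (A : V -> 'M[R]_n.+1) : Prop :=
  forall x (xi : V), closure Omega x ->
    lambda * enorm xi ^+ 2
      <= \sum_(i < n.+1) \sum_(j < n.+1) A x i j * xi 0 j * xi 0 i.

Definition DL (alpha : R) Omega A b c : set (V -> R) :=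
  [set u | Ckalpha 2 alpha Omega u /\
           forall x, boundary Omega x -> u x = 0 /\ Lop Omega A b c u x = 0].

End HoelderSpaces.

(* Main.v *)
(* Flatten the boundary by a chart. There u vanishes on {z_n = 0}, so all tangential
   derivatives vanish, and Lu = 0 relates the mixed and pure normal second derivatives of
   u to its normal derivative. Extend u below the hyperplane by - u (rho z), where
   rho z = z + z_n m + z_n^2 f e_n; when m_n = -2, m and f can be chosen from the
   coefficients of L so that this relation says exactly that the 2-jets of u and
   - u \o rho agree on the hyperplane. Values of the extension are values of u up to sign,
   so the sup norm does not grow. Interior and boundary extensions are then glued one
   after the other, E' = (1 - eta) E + eta * (local extension), and such convex
   combinations again preserve the bound by sup |u|.

   C^{2,alpha} regularity is handled through pointwise expansions of order 2 with remainder
   K |y - x|^(2 + alpha): this condition is stable under composition, products and gluing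
   along a hyperplane, and on the whole space it implies classical C^{2,alpha} bounds. *)
Require Import Defs.
From HB Require Import structures.
From mathcomp Require Import all_boot all_order all_algebra.
From mathcomp Require Import all_classical all_reals all_analysis.
From mathcomp Require Import ring lra.
Set Implicit Arguments.
Unset Strict Implicit.
Unset Printing Implicit Defensive.
Import Order.TTheory GRing.Theory Num.Theory.
Import numFieldNormedType.Exports.
Local Open Scope classical_set_scope.
Local Open Scope ring_scope.

(** * Pointwise expansions of order two and their algebra *)

Section Jets.
Context {R : realType} {n : nat} (alpha : R).
Context (alpha_gt0 : 0 < alpha) (alpha_lt1 : alpha < 1).
Local Notation V := 'rV[R]_n.+1.
Local Notation N := (n.+1%:R : R).
Implicit Types (f : V -> R) (S : set V) (x y h : V) (K L t : R).
Implicit Types (g : 'I_n.+1 -> R) (H : 'I_n.+1 -> 'I_n.+1 -> R).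

(** Equality of the sup norms rules out the usual higher-order reflections: they combine several
    values of [u] with coefficients whose absolute values sum to more than 1. A single signed value
    is allowed. The odd reflection -u(z', -z_n) already has the right values, gradient and mixed
    second derivatives on the hyperplane; only its second normal derivative has the wrong sign. The
    equation Lu = 0 is one scalar relation between the second normal derivative, the mixed ones and
    the normal derivative: tilting the reflection by [m] accounts for the mixed terms, bending it by
    [f] for the first-order term. [m] involves the leading coefficients and the first derivatives of
    the chart, [f] also its second derivatives, and the reflection must itself be C^{2,alpha} for
    the composition to be so: hence coefficients in C^{2,alpha} and a boundary of class C^{4,alpha}.
    Boundedness of the operator forces every constant attached to [u] to be linear in one bound [K],
    with a factor depending only on the domain and on L; the constants of the fixed data only need
    to be finite. *)

Definition omega t : R := t ^+ 2 * t `^ alpha.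

Definition lin g h : R := \sum_i g i * h 0 i.
Definition quad H h : R := \sum_i \sum_j H i j * h 0 i * h 0 j.

(* [H] is half of the Hessian. *)
Definition jet S K f x g H := [/\ `|f x| <= K, forall i, `|g i| <= K,
  forall i j, `|H i j| <= K & forall y, S y -> `|y - x| <= 1 ->
    `|f y - f x - lin g (y - x) - quad H (y - x)| <= K * omega `|y - x| ].

(** Jets at different points need not be compatible: on the whole space, Hoelder continuity of their
    coefficients is a consequence ([grad_expansion], [hess_hoelder]). *)
Definition C2a S K f := forall x, S x -> exists g H, jet S K f x g H.

(** The summands count the terms of [lin], the terms of [quad], and the remainder. *)
Definition cN : R := N + N ^+ 2 + 1.

Lemma cN_ge3 : 3 <= cN.
Proof.
have h : 1 <= N by rewrite ler1n.
rewrite /cN; nra.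
Qed.

Lemma ler_norm_sum_ord m (F : 'I_m -> R) B : (forall i, `|F i| <= B) ->
  `|\sum_i F i| <= m%:R * B.
Proof.
move=> FB; apply: (le_trans (ler_norm_sum _ _ _)).
apply: (@le_trans _ _ (\sum_(i < m) B)); first exact: ler_sum.
by rewrite sumr_const card_ord mulr_natl.
Qed.

Lemma coord_le_norm h i : `|h 0 i| <= `|h|.
Proof. by rewrite [leRHS]/Num.Def.normr/= mx_normrE; apply: (le_bigmax _ _ (0, i)). Qed.

Lemma norm_le_coord h B : 0 <= B -> (forall i, `|h 0 i| <= B) -> `|h| <= B.
Proof.
move=> B0 hB; rewrite /Num.Def.normr/= mx_normrE; apply: bigmax_le => // -[i j] _ /=.
by rewrite ord1.
Qed.

Lemma omega_ge0 t : 0 <= omega t.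
Proof. by rewrite mulr_ge0 ?sqr_ge0 ?powR_ge0. Qed.

Lemma omega_le t : 0 <= t <= 1 -> omega t <= t ^+ 2.
Proof.
move=> /andP[t0 t1]; rewrite -[leRHS]mulr1 ler_wpM2l ?sqr_ge0//.
apply: (@le_trans _ _ (1 `^ alpha)); last by rewrite powR1.
by apply: (ge0_ler_powR (ltW alpha_gt0)) => //; rewrite nnegrE.
Qed.

(** This is where [alpha < 1] enters: every cubic error term produced by products and compositions
    is absorbed by the remainder. *)
Lemma cube_le_omega t : 0 <= t <= 1 -> t ^+ 3 <= omega t.
Proof.
move=> /andP[t0 t1]; rewrite exprSr ler_wpM2l ?sqr_ge0//.
move: t0; rewrite le_eqVlt => /orP[/eqP<-|t0]; first by rewrite powR_ge0.
by rewrite ger1_powR ?t0 // ltW.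
Qed.

Lemma le_omega s t : 0 <= s <= t -> omega s <= omega t.
Proof.
move=> /andP[s0 st]; rewrite ler_pM ?sqr_ge0 ?powR_ge0//.
  by rewrite ler_pXn2r ?nnegrE// (le_trans s0).
by apply: (ge0_ler_powR (ltW alpha_gt0)) => //; rewrite nnegrE// (le_trans s0).
Qed.

(** The exponent [2 + alpha] is rounded up to 3, so that constants stay polynomial in the scaling
    factor. *)
Lemma omegaM_le s t : 1 <= s -> 0 <= t -> omega (s * t) <= s ^+ 3 * omega t.
Proof.
move=> s1 t0; have s0 : 0 <= s by apply: le_trans s1.
rewrite /omega powRM// exprMn exprSr.
rewrite [leRHS](_ : _ = (s ^+ 2 * t ^+ 2) * (s * t `^ alpha)); last by ring.
rewrite ler_wpM2l ?mulr_ge0 ?sqr_ge0// ler_wpM2r ?powR_ge0//.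
by rewrite ler1_powR// ltW.
Qed.

Lemma lin_le g h K : (forall i, `|g i| <= K) -> `|lin g h| <= N * K * `|h|.
Proof.
move=> gK; rewrite -mulrA; apply: ler_norm_sum_ord => i.
by rewrite normrM ler_pM// coord_le_norm.
Qed.

Lemma quad_le H h K : (forall i j, `|H i j| <= K) ->
  `|quad H h| <= N ^+ 2 * K * `|h| ^+ 2.
Proof.
move=> gK; rewrite expr2 -!mulrA; apply: ler_norm_sum_ord => i.
apply: ler_norm_sum_ord => j.
by rewrite !normrM -mulrA expr2 ler_pM// ?mulr_ge0// ler_pM// coord_le_norm.
Qed.

Lemma jet_ge0 S K f x g H : jet S K f x g H -> 0 <= K.
Proof. by case=> h _ _ _; apply: le_trans h. Qed.

Lemma jet_o1 S K f x g H y : jet S K f x g H -> S y -> `|y - x| <= 1 ->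
  `|f y - f x - lin g (y - x)| <= cN * K * `|y - x| ^+ 2.
Proof.
move=> J Sy yx1; have K0 := jet_ge0 J; case: J => _ _ HK /(_ _ Sy yx1) e.
have q := quad_le (y - x) HK.
set t := `|y - x| in yx1 e q *; have t0 : 0 <= t := normr_ge0 _.
have : `|f y - f x - lin g (y - x)| <= K * omega t + N ^+ 2 * K * t ^+ 2.
  apply: le_trans (lerD e q).
  by apply: le_trans (ler_normD _ _); rewrite subrK.
move/le_trans; apply.
have := @omega_le t; rewrite t0 yx1 => /(_ isT) w.
have N1 : 1 <= N by rewrite ler1n.
rewrite /cN mulrDl mulrDl addrC mul1r.
apply: lerD; last by rewrite ler_wpM2l.
by rewrite ler_wpM2r ?sqr_ge0// ler_wpM2r// lerDr.
Qed.

Lemma jet_lip S K f x g H y : jet S K f x g H -> S y -> `|y - x| <= 1 ->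
  `|f y - f x| <= 2 * cN * K * `|y - x|.
Proof.
move=> J Sy yx1; have K0 := jet_ge0 J.
have o := jet_o1 J Sy yx1; case: J => _ gK _ _.
have l := lin_le (y - x) gK.
set t := `|y - x| in yx1 o l *; have t0 : 0 <= t := normr_ge0 _.
have : `|f y - f x| <= cN * K * t ^+ 2 + N * K * t.
  apply: le_trans (lerD o l).
  by apply: le_trans (ler_normD _ _); rewrite subrK.
move/le_trans; apply.
have c3 := cN_ge3.
have N1 : 1 <= N by rewrite ler1n.
rewrite (_ : 2 * cN * K * t = cN * K * t + cN * K * t); last by ring.
apply: lerD.
  by rewrite ler_wpM2l ?mulr_ge0 ?(le_trans _ c3)// expr2 ler_piMl.
by rewrite ler_wpM2r// ler_wpM2r// /cN -addrA lerDl addr_ge0 ?sqr_ge0.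
Qed.

Lemma jetW S S' K K' f x g H : S' `<=` S -> K <= K' -> jet S K f x g H ->
  jet S' K' f x g H.
Proof.
move=> SS KK [fK gK HK e]; split => [|i|i j|y Sy yx].
- exact: le_trans KK.
- exact: le_trans KK.
- exact: le_trans KK.
- by apply: (le_trans (e _ (SS _ Sy) yx)); rewrite ler_wpM2r// omega_ge0.
Qed.

Lemma C2aW S S' K K' f : S' `<=` S -> K <= K' -> C2a S K f -> C2a S' K' f.
Proof.
move=> SS KK fK x /SS/fK [g [H J]]; exists g, H; exact: jetW J.
Qed.

Lemma eq_jet S K f f' x g H : S x -> {in S, f =1 f'} -> jet S K f x g H ->
  jet S K f' x g H.
Proof.
move=> Sx ff [fK gK HK e]; split => // [|y Sy yx]; first by rewrite -ff// inE.
by rewrite -!ff ?inE//; apply: e.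
Qed.

Lemma eq_C2a S K f f' : {in S, f =1 f'} -> C2a S K f -> C2a S K f'.
Proof.
move=> ff fK x Sx; have [g [H J]] := fK _ Sx; exists g, H; exact: eq_jet J.
Qed.

Lemma linD g g' h : lin (fun i => g i + g' i) h = lin g h + lin g' h.
Proof. by rewrite -big_split; apply: eq_bigr => i _; rewrite mulrDl. Qed.

Lemma linZ a g h : lin (fun i => a * g i) h = a * lin g h.
Proof. by rewrite /lin mulr_sumr; apply: eq_bigr => i _; rewrite mulrA. Qed.

Lemma quadD H H' h : quad (fun i j => H i j + H' i j) h = quad H h + quad H' h.
Proof.
rewrite -big_split; apply: eq_bigr => i _ /=.
by rewrite -big_split; apply: eq_bigr => j _; rewrite !mulrDl.
Qed.

Lemma quadZ a H h : quad (fun i j => a * H i j) h = a * quad H h.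
Proof.
rewrite /quad mulr_sumr; apply: eq_bigr => i _ /=.
by rewrite mulr_sumr; apply: eq_bigr => j _; rewrite !mulrA.
Qed.

Lemma linMlin g g' h : quad (fun i j => g i * g' j) h = lin g h * lin g' h.
Proof.
rewrite /quad /lin mulr_suml; apply: eq_bigr => i _ /=.
rewrite mulr_sumr; apply: eq_bigr => j _; ring.
Qed.

Lemma jetD S K K' f f' x g g' H H' : jet S K f x g H -> jet S K' f' x g' H' ->
  jet S (K + K') (fun y => f y + f' y) x (fun i => g i + g' i)
    (fun i j => H i j + H' i j).
Proof.
move=> [fK gK HK e] [fK' gK' HK' e']; split => [|i|i j|y Sy yx].
- by apply: (le_trans (ler_normD _ _)); apply: lerD.
- by apply: (le_trans (ler_normD _ _)); apply: lerD.
- by apply: (le_trans (ler_normD _ _)); apply: lerD.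
- rewrite linD quadD mulrDl; apply: le_trans (lerD (e y Sy yx) (e' y Sy yx)).
  apply: le_trans (ler_normD _ _).
  by rewrite le_eqVlt; apply/orP; left; apply/eqP; congr `|_|; ring.
Qed.

Lemma C2aD S K K' f f' : C2a S K f -> C2a S K' f' ->
  C2a S (K + K') (fun y => f y + f' y).
Proof.
move=> fK fK' x Sx; have [g [H J]] := fK _ Sx; have [g' [H' J']] := fK' _ Sx.
by eexists; eexists; apply: jetD J J'.
Qed.

Lemma jetZ S K f x g H a : jet S K f x g H ->
  jet S (`|a| * K) (fun y => a * f y) x (fun i => a * g i)
    (fun i j => a * H i j).
Proof.
move=> [fK gK HK e]; split => [|i|i j|y Sy yx].
- by rewrite normrM ler_wpM2l.
- by rewrite normrM ler_wpM2l.
- by rewrite normrM ler_wpM2l.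
- by rewrite linZ quadZ -!mulrBr normrM -mulrA ler_wpM2l// e.
Qed.

Lemma C2aZ S K f a : C2a S K f -> C2a S (`|a| * K) (fun y => a * f y).
Proof.
move=> fK x Sx; have [g [H J]] := fK _ Sx.
by eexists; eexists; apply: jetZ J.
Qed.

Lemma lin0 h : lin (fun=> 0) h = 0.
Proof. by rewrite /lin big1// => i _; rewrite mul0r. Qed.

Lemma quad0 h : quad (fun _ _ => 0) h = 0.
Proof. by rewrite /quad big1// => i _; rewrite big1// => j _; rewrite !mul0r. Qed.

Lemma C2a_cst S (a : R) : C2a S `|a| (fun=> a).
Proof.
move=> x Sx; exists (fun=> 0), (fun _ _ => 0); split => //= [i|i j|y Sy yx].
- by rewrite normr0.
- by rewrite normr0.
- by rewrite lin0 quad0 !subr0 subrr normr0 mulr_ge0 ?omega_ge0.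
Qed.

Lemma jet_coord S K x i : `|x| <= K -> 1 <= K ->
  jet S K (fun y => y 0 i) x (fun j => (i == j)%:R) (fun _ _ => 0).
Proof.
move=> xK K1; split => [|j|j k|y Sy yx].
- by rewrite (le_trans (coord_le_norm _ _)).
- by case: eqP; rewrite ?normr1 ?normr0// (le_trans _ K1).
- by rewrite normr0 (le_trans _ K1).
- rewrite quad0 subr0 /lin (bigD1 i)//= eqxx mul1r big1 ?addr0; last first.
    by move=> j ji; rewrite eq_sym (negbTE ji) mul0r.
  by rewrite !mxE subrr normr0 mulr_ge0 ?omega_ge0 ?(le_trans _ K1).
Qed.

(** The cross term [g i * g' j] is left unsymmetrised: [quad] only sees the symmetric part of [H],
    and second derivatives are later read off as [H i j + H j i]. *)
Lemma jetM S K K' f f' x g g' H H' : jet S K f x g H -> jet S K' f' x g' H' ->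
  jet S (8 * cN ^+ 2 * (K * K')) (fun y => f y * f' y) x
    (fun i => f x * g' i + f' x * g i)
    (fun i j => f x * H' i j + f' x * H i j + g i * g' j).
Proof.
move=> J J'; have K0 := jet_ge0 J; have K0' := jet_ge0 J'.
have c3 := cN_ge3; have N1 : 1 <= N by rewrite ler1n.
have KK : 0 <= K * K' by rewrite mulr_ge0.
have cc : 9 <= cN ^+ 2 by rewrite expr2 (_ : 9 = 3 * 3) ?ler_pM//; ring.
have Nc : N <= cN by rewrite /cN -addrA lerDl addr_ge0 ?sqr_ge0.
have [fK gK HK e] := J; have [fK' gK' HK' e'] := J'.
split => [|i|i j|y Sy yx].
- have : `|f x * f' x| <= K * K' by rewrite normrM ler_pM.
  nra.
- have : `|f x * g' i| <= K * K' by rewrite normrM ler_pM.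
  have : `|f' x * g i| <= K * K' by rewrite normrM mulrC ler_pM.
  have := ler_normD (f x * g' i) (f' x * g i).
  nra.
- have : `|f x * H' i j| <= K * K' by rewrite normrM ler_pM.
  have : `|f' x * H i j| <= K * K' by rewrite normrM mulrC ler_pM.
  have : `|g i * g' j| <= K * K' by rewrite normrM ler_pM.
  have := ler_normD (f x * H' i j) (f' x * H i j).
  have := ler_normD (f x * H' i j + f' x * H i j) (g i * g' j).
  nra.
- have o := jet_o1 J Sy yx; have o' := jet_o1 J' Sy yx.
  have l' := jet_lip J' Sy yx; have l := lin_le (y - x) gK.
  move: (e y Sy yx) (e' y Sy yx) => {}e {}e'.
  rewrite linD !linZ !quadD !quadZ linMlin.
  set t := `|y - x| in yx e e' o o' l l' *.
  have t01 : 0 <= t <= 1 by rewrite yx (normr_ge0 (y - x)).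
  have w3 := cube_le_omega t01.
  set lf := lin g _ in e o l *; set lf' := lin g' _ in e' o' *.
  set qf := quad H _ in e *; set qf' := quad H' _ in e' *.
  set E := f y - f x - lf - qf in e; set E' := f' y - f' x - lf' - qf' in e'.
  set D := f y - f x - lf in o; set D' := f' y - f' x - lf' in o'.
  (* The product of the two increments minus [lf * lf'] is written with one first-order defect in
     each term, [D] or [D']; both terms are then cubic in [t]. *)
  rewrite (_ : _ - _ = f x * E' + f' x * E + D * (f' y - f' x) + lf * D');
    last by rewrite /E /E' /D /D'; ring.
  have b1 : `|f x * E'| <= K * K' * omega t.
    by rewrite normrM -mulrA ler_pM.
  have b2 : `|f' x * E| <= K * K' * omega t.
    by rewrite normrM (mulrC K) -mulrA ler_pM.
  have b3 : `|D * (f' y - f' x)| <= 2 * cN ^+ 2 * (K * K') * omega t.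
    rewrite normrM; apply: (le_trans (ler_pM _ _ o l')) => //.
    rewrite [leLHS](_ : _ = 2 * cN ^+ 2 * (K * K') * t ^+ 3); last by ring.
    by rewrite ler_wpM2l//; apply: mulr_ge0 => //; rewrite mulr_ge0 ?sqr_ge0.
  have b4 : `|lf * D'| <= cN ^+ 2 * (K * K') * omega t.
    rewrite normrM; apply: (le_trans (ler_pM _ _ l o')) => //.
    rewrite [leLHS](_ : _ = N * cN * (K * K') * t ^+ 3); last by ring.
    have c0 : 0 <= cN by rewrite (le_trans _ c3).
    rewrite ler_pM ?exprn_ge0 ?mulr_ge0// ?normr_ge0//.
    by rewrite ler_wpM2r// expr2 ler_wpM2r.
  have w0 := omega_ge0 t.
  have := ler_normD (f x * E') (f' x * E).
  have := ler_normD (f x * E' + f' x * E) (D * (f' y - f' x)).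
  have := ler_normD (f x * E' + f' x * E + D * (f' y - f' x)) (lf * D').
  move: b1 b2 b3 b4; rewrite -!mulrA.
  have : 0 <= K * (K' * omega t) by rewrite mulr_ge0// mulr_ge0.
  set X := K * (K' * omega t).
  have : X <= cN ^+ 2 * X -> X <= cN ^+ 2 * X by [].
  move=> _ X0 ? ? ? ? ? ? ?.
  have : X <= cN ^+ 2 * X by rewrite ler_peMl// (le_trans _ cc)// ler1n.
  lra.
Qed.

Lemma C2aM S K K' f f' : C2a S K f -> C2a S K' f' ->
  C2a S (8 * cN ^+ 2 * (K * K')) (fun y => f y * f' y).
Proof.
move=> fK fK' x Sx; have [g [H J]] := fK _ Sx; have [g' [H' J']] := fK' _ Sx.
by eexists; eexists; apply: jetM J J'.
Qed.

End Jets.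

(** * Composition of expansions *)

Section JetComposition.
Context {R : realType} {n : nat} (alpha : R).
Context (alpha_gt0 : 0 < alpha) (alpha_lt1 : alpha < 1).
Local Notation V := 'rV[R]_n.+1.
Local Notation N := (n.+1%:R : R).
Local Notation cN := (@cN R n).
Local Notation omega := (@omega R alpha).
Local Notation jet := (@jet R n alpha).
Local Notation C2a := (@C2a R n alpha).
Implicit Types (f : V -> R) (S : set V) (x y h : V) (K L t : R).
Implicit Types (g : 'I_n.+1 -> R) (H : 'I_n.+1 -> 'I_n.+1 -> R).

Lemma N_le_cN : N <= cN.
Proof. by rewrite /cN -addrA lerDl addr_ge0 ?sqr_ge0. Qed.

Lemma sqrN_le_cN : N ^+ 2 <= cN.
Proof. by rewrite /cN addrAC lerDr addr_ge0. Qed.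

Lemma cN_ge1 : 1 <= cN.
Proof. by rewrite (le_trans _ (@cN_ge3 R n))// ler1n. Qed.

Lemma lin_sum m (F : 'I_m -> 'I_n.+1 -> R) h :
  lin (fun k => \sum_i F i k) h = \sum_i lin (F i) h.
Proof.
rewrite /lin exchange_big; apply: eq_bigr => k _ /=.
by rewrite mulr_suml.
Qed.

Lemma quad_sum m (F : 'I_m -> 'I_n.+1 -> 'I_n.+1 -> R) h :
  quad (fun k l => \sum_i F i k l) h = \sum_i quad (F i) h.
Proof.
rewrite /quad [RHS]exchange_big; apply: eq_bigr => k _ /=.
rewrite [RHS]exchange_big; apply: eq_bigr => l _ /=.
by rewrite !mulr_suml.
Qed.

Definition compgrad g (J : 'I_n.+1 -> 'I_n.+1 -> R) (k : 'I_n.+1) : R :=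
  \sum_i g i * J i k.

(** The second-order chain rule. [H] and [B] are both half Hessians, so no factor 1/2 appears. *)
Definition comphess g H (J : 'I_n.+1 -> 'I_n.+1 -> R)
    (B : 'I_n.+1 -> 'I_n.+1 -> 'I_n.+1 -> R) (k l : 'I_n.+1) : R :=
  \sum_i g i * B i k l + \sum_i \sum_j H i j * (J i k * J j l).

(** 12 = 8 + 1 + 3: the remainder of the outer function at an increment of size [2 * cN * L * t],
    the remainders of the inner components, and the error in replacing the increment by its linear
    part inside the quadratic form. *)
Definition compC L : R := 12 * cN ^+ 3 * L ^+ 3.

Lemma jet_comp S S' K L f (psi : V -> V) x g H J B :
  1 <= L -> (forall y, S y -> S' (psi y)) ->
  (forall y, S y -> `|y - x| <= 1 -> `|psi y - psi x| <= 1) ->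
  (forall i, jet S L (fun y => psi y 0 i) x (J i) (B i)) ->
  jet S' K f (psi x) g H ->
  jet S (compC L * K) (fun y => f (psi y)) x (compgrad g J) (comphess g H J B).
Proof.
move=> L1 SS' psi1 Jpsi Jf; have K0 := jet_ge0 Jf.
have c1 := cN_ge1; have N1 : 1 <= N by rewrite ler1n.
have c0 : 0 <= cN by rewrite (le_trans _ c1).
have L0 : 0 <= L by rewrite (le_trans _ L1).
have Nc := N_le_cN; have NNc := sqrN_le_cN.
have a1 : N * L <= cN ^+ 3 * L ^+ 3.
  by rewrite ler_pM// ?(le_trans Nc)// ler_eXnr.
have a2 : N ^+ 2 * (cN ^+ 2 * L ^+ 2) <= cN ^+ 3 * L ^+ 3.
  rewrite mulrA (exprS cN 2) ler_pM ?mulr_ge0 ?sqr_ge0//; first by rewrite ler_wpM2r// sqr_ge0.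
  by rewrite ler_weXn2l.
have a3 : 1 <= cN ^+ 3 * L ^+ 3.
  by rewrite -[leLHS]mulr1 ler_pM// exprn_ege1.
have a4 : N ^+ 2 * L ^+ 2 <= cN ^+ 3 * L ^+ 3.
  rewrite ler_pM ?sqr_ge0//; first by rewrite (le_trans NNc)// ler_eXnr.
  by rewrite ler_weXn2l.
rewrite /compC; set a := cN ^+ 3 * L ^+ 3 in a1 a2 a3 a4 *.
rewrite -(mulrA 12) -/a.
have [fK gK HK e] := Jf.
split=> [|k|k l|y Sy yx].
- nra.
- have : `|compgrad g J k| <= N * (K * L).
    apply: ler_norm_sum_ord => i; rewrite normrM ler_pM//.
    by case: (Jpsi i).
  nra.
- have b1 : `|\sum_i g i * B i k l| <= N * (K * L).
    apply: ler_norm_sum_ord => i; rewrite normrM ler_pM//.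
    by case: (Jpsi i).
  have b2 : `|\sum_i \sum_j H i j * (J i k * J j l)| <= N * (N * (K * (L * L))).
    apply: ler_norm_sum_ord => i; apply: ler_norm_sum_ord => j.
    rewrite !normrM ler_pM// ?mulr_ge0// ler_pM//.
      by case: (Jpsi i).
    by case: (Jpsi j).
  have := ler_normD (\sum_i g i * B i k l)
    (\sum_i \sum_j H i j * (J i k * J j l)).
  rewrite -/(comphess g H J B k l) => b3.
  have : N * (N * (K * (L * L))) <= K * a.
    by rewrite (_ : _ * _ = K * (N ^+ 2 * L ^+ 2)) ?ler_wpM2l//; ring.
  have : N * (K * L) <= K * a by rewrite mulrCA ler_wpM2l.
  nra.
- set t := `|y - x| in yx *; have t0 : 0 <= t := normr_ge0 _.
  have t01 : 0 <= t <= 1 by rewrite yx t0.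
  have w3 := cube_le_omega alpha_lt1 t01.
  have w0 := omega_ge0 alpha t.
  set eta := psi y - psi x.
  have etaE i : eta 0 i = psi y 0 i - psi x 0 i by rewrite !mxE.
  have eta1 i : `|eta 0 i - lin (J i) (y - x)| <= cN * L * t ^+ 2.
    by rewrite etaE; exact: (jet_o1 alpha_gt0 (Jpsi i) Sy yx).
  have eta2 i : `|eta 0 i| <= 2 * cN * L * t.
    by rewrite etaE; exact: (jet_lip alpha_gt0 (Jpsi i) Sy yx).
  have eta3 i : `|eta 0 i - lin (J i) (y - x) - quad (B i) (y - x)| <= L * omega t.
    by rewrite etaE; case: (Jpsi i) => _ _ _; exact.
  have linJ i : `|lin (J i) (y - x)| <= cN * L * t.
    case: (Jpsi i) => _ JL _ _; apply: (le_trans (lin_le _ JL)).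
    by rewrite !ler_wpM2r// ltW.
  have etan : `|eta| <= 2 * cN * L * t.
    by apply: norm_le_coord => //; rewrite !mulr_ge0.
  have b1 : `|f (psi y) - f (psi x) - lin g eta - quad H eta| <=
      K * (8 * a * omega t).
    apply: (le_trans (e _ (SS' _ Sy) (psi1 _ Sy yx))).
    rewrite ler_wpM2l//.
    apply: (le_trans (le_omega alpha_gt0 _)); first by apply/andP; split; [|exact: etan].
    apply: (le_trans (omegaM_le alpha_lt1 _ t0)).
      have : 1 <= cN * L by rewrite -[leLHS]mulr1 ler_pM.
      lra.
    by rewrite le_eqVlt; apply/orP; left; apply/eqP; rewrite /a; ring.
  have b2 : `|\sum_i g i * (eta 0 i - lin (J i) (y - x) - quad (B i) (y - x))|
      <= N * (K * (L * omega t)).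
    by apply: ler_norm_sum_ord => i; rewrite normrM ler_pM.
  have b3 : `|\sum_i \sum_j H i j *
      (eta 0 i * eta 0 j - lin (J i) (y - x) * lin (J j) (y - x))| <=
      N * (N * (K * (3 * (cN ^+ 2 * L ^+ 2 * omega t)))).
    apply: ler_norm_sum_ord => i; apply: ler_norm_sum_ord => j.
    rewrite normrM ler_pM//.
    rewrite (_ : _ - _ = (eta 0 i - lin (J i) (y - x)) * eta 0 j +
      lin (J i) (y - x) * (eta 0 j - lin (J j) (y - x))); last by ring.
    apply: (le_trans (ler_normD _ _)); rewrite !normrM.
    apply: (@le_trans _ _ (cN * L * t ^+ 2 * (2 * cN * L * t) +
      cN * L * t * (cN * L * t ^+ 2))).
      by apply: lerD; apply: ler_pM.
    rewrite (_ : _ + _ = 3 * (cN ^+ 2 * L ^+ 2 * t ^+ 3)); last by ring.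
    by rewrite ler_wpM2l// ler_wpM2l// mulr_ge0 ?sqr_ge0.
  have -> : lin (compgrad g J) (y - x) = \sum_i g i * lin (J i) (y - x).
    by rewrite lin_sum; apply: eq_bigr => i _; rewrite linZ.
  have -> : quad (comphess g H J B) (y - x) = \sum_i g i * quad (B i) (y - x) +
      \sum_i \sum_j H i j * (lin (J i) (y - x) * lin (J j) (y - x)).
    rewrite quadD !quad_sum; congr (_ + _); apply: eq_bigr => i _.
      by rewrite quadZ.
    by rewrite quad_sum; apply: eq_bigr => j _; rewrite quadZ linMlin.
  rewrite (_ : _ - _ = (f (psi y) - f (psi x) - lin g eta - quad H eta) +
    \sum_i g i * (eta 0 i - lin (J i) (y - x) - quad (B i) (y - x)) +
    \sum_i \sum_j H i j *
      (eta 0 i * eta 0 j - lin (J i) (y - x) * lin (J j) (y - x))); last first.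
    have -> : \sum_i g i * (eta 0 i - lin (J i) (y - x) - quad (B i) (y - x)) =
        lin g eta - \sum_i g i * lin (J i) (y - x)
        - \sum_i g i * quad (B i) (y - x).
      by rewrite /lin -!sumrB; apply: eq_bigr => i _; ring.
    have -> : \sum_i \sum_j H i j *
        (eta 0 i * eta 0 j - lin (J i) (y - x) * lin (J j) (y - x)) =
        quad H eta - \sum_i \sum_j H i j *
          (lin (J i) (y - x) * lin (J j) (y - x)).
      rewrite /quad -sumrB; apply: eq_bigr => i _ /=.
      by rewrite -sumrB; apply: eq_bigr => j _; ring.
    ring.
  apply: (le_trans (ler_normD _ _)).
  apply: (le_trans (lerD (ler_normD _ _) b3)).
  apply: (le_trans (lerD (lerD b1 b2) (lexx _))).
  have X0 : 0 <= K * omega t by rewrite mulr_ge0.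
  have := ler_wpM2r X0 a1; have := ler_wpM2r X0 a2.
  rewrite (_ : K * (8 * a * omega t) = 8 * (a * (K * omega t))); last by ring.
  rewrite (_ : N * (K * (L * omega t)) = N * L * (K * omega t)); last by ring.
  rewrite (_ : N * (N * _) =
    3 * (N ^+ 2 * (cN ^+ 2 * L ^+ 2) * (K * omega t))); last by ring.
  rewrite (_ : 12 * a * K * omega t = 12 * (a * (K * omega t))); last by ring.
  lra.
Qed.

Lemma C2a_comp S S' K L f (psi : V -> V) :
  1 <= L -> (forall y, S y -> S' (psi y)) ->
  (forall x y, S x -> S y -> `|y - x| <= 1 -> `|psi y - psi x| <= 1) ->
  (forall i, C2a S L (fun y => psi y 0 i)) -> C2a S' K f ->
  C2a S (compC L * K) (fun y => f (psi y)).
Proof.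
move=> L1 SS' psi1 psiL fK x Sx.
have [g [H Jf]] := fK _ (SS' _ Sx).
have /choice[J JP] : forall i, exists g, exists H, jet S L (fun y => psi y 0 i) x g H.
  by move=> i; have [g' [H' ?]] := psiL i _ Sx; exists g', H'.
have [B BP] := choice JP.
by eexists; eexists; apply: (jet_comp L1 SS' _ BP Jf) => y Sy; exact: psi1.
Qed.

(** The function [theta2] is half of the second derivative. A cubic remainder only asks that
    derivative to be Lipschitz, which covers both the inverse away from 0 and the truncated cubic
    [pos3]. *)
Lemma C2a_comp_scalar S (D : set R) K L f (theta theta1 theta2 : R -> R) :
  1 <= K -> (forall y, S y -> D (f y)) ->
  (forall s, D s -> [/\ `|theta s| <= L, `|theta1 s| <= L & `|theta2 s| <= L]) ->
  (forall s t, D s -> D t -> `|theta t - theta s - theta1 s * (t - s)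
     - theta2 s * (t - s) ^+ 2| <= L * `|t - s| ^+ 3) ->
  C2a S K f -> C2a S (compC K * L) (fun y => theta (f y)).
Proof.
move=> K1 SD thL thE fK x Sx; have [g [H Jf]] := fK _ Sx.
have [t0L t1L t2L] := thL _ (SD _ Sx).
have L0 : 0 <= L by apply: le_trans t0L.
have c1 := cN_ge1; have N1 : 1 <= N by rewrite ler1n.
have c0 : 0 <= cN by rewrite (le_trans _ c1).
have K0 : 0 <= K by rewrite (le_trans _ K1).
have Nc := N_le_cN.
rewrite /compC; set a := cN ^+ 3 * K ^+ 3.
have a1 : 1 <= a by rewrite -[leLHS]mulr1 ler_pM// exprn_ege1.
have a2 : K <= a by rewrite -[leLHS]mul1r ler_pM// ?exprn_ege1// ler_eXnr.
have a3 : cN ^+ 2 * K ^+ 2 <= a by rewrite ler_pM ?sqr_ge0// ler_weXn2l.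
have a4 : K * K <= a.
  by rewrite -[leLHS]mul1r ler_pM ?mulr_ge0// ?exprn_ege1// -expr2 ler_weXn2l.
rewrite -(mulrA 12) -/a.
have [xK gK HK e] := Jf.
exists (fun i => theta1 (f x) * g i),
  (fun i j => theta1 (f x) * H i j + theta2 (f x) * (g i * g j)).
split=> [|i|i j|y Sy yx].
- nra.
- have : `|theta1 (f x) * g i| <= L * K by rewrite normrM ler_pM.
  nra.
- have : `|theta1 (f x) * H i j| <= L * K by rewrite normrM ler_pM.
  have : `|theta2 (f x) * (g i * g j)| <= L * (K * K).
    by rewrite !normrM ler_pM// ?mulr_ge0// ler_pM.
  have := ler_normD (theta1 (f x) * H i j) (theta2 (f x) * (g i * g j)).
  nra.
- have o1 := jet_o1 alpha_gt0 Jf Sy yx.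
  have lp := jet_lip alpha_gt0 Jf Sy yx.
  move: (e y Sy yx) (lin_le (y - x) gK) => {}e l.
  set t := `|y - x| in yx o1 lp e l *; have t0 : 0 <= t := normr_ge0 _.
  have t01 : 0 <= t <= 1 by rewrite yx t0.
  have w3 := cube_le_omega alpha_lt1 t01.
  have w0 := omega_ge0 alpha t.
  rewrite quadD !quadZ linMlin linZ.
  set lf := lin g _ in o1 e l *; set q := quad H _ in e *.
  set d := f y - f x in o1 lp e *.
  have b1 : `|theta (f y) - theta (f x) - theta1 (f x) * d -
      theta2 (f x) * d ^+ 2| <= L * (8 * a * omega t).
    apply: (le_trans (thE _ _ (SD _ Sx) (SD _ Sy))); rewrite -/d ler_wpM2l//.
    apply: (@le_trans _ _ ((2 * cN * K * t) ^+ 3)).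
      by rewrite ler_pXn2r ?nnegrE ?normr_ge0// !mulr_ge0.
    rewrite (_ : _ ^+ _ = 8 * a * t ^+ 3); last by rewrite /a; ring.
    by rewrite ler_wpM2l// mulr_ge0// (le_trans _ a1).
  have b2 : `|theta1 (f x) * (d - lf - q)| <= L * (K * omega t).
    by rewrite normrM ler_pM.
  have b3 : `|theta2 (f x) * (d ^+ 2 - lf * lf)| <= L * (3 * a * omega t).
    rewrite normrM ler_pM//.
    rewrite (_ : _ - _ = (d - lf) * d + lf * (d - lf)); last by ring.
    apply: (le_trans (ler_normD _ _)); rewrite !normrM.
    apply: (@le_trans _ _ (cN * K * t ^+ 2 * (2 * cN * K * t) +
      cN * K * t * (cN * K * t ^+ 2))).
      apply: lerD; apply: ler_pM => //.
      by rewrite (le_trans l)// !ler_wpM2r.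
    rewrite (_ : _ + _ = 3 * (cN ^+ 2 * K ^+ 2) * t ^+ 3); last by ring.
    rewrite ler_pM//; last by rewrite ler_wpM2l.
      by rewrite !mulr_ge0 ?sqr_ge0.
    by rewrite exprn_ge0.
  rewrite (_ : _ - _ = (theta (f y) - theta (f x) - theta1 (f x) * d -
      theta2 (f x) * d ^+ 2) + theta1 (f x) * (d - lf - q) +
      theta2 (f x) * (d ^+ 2 - lf * lf)); last by ring.
  apply: (le_trans (ler_normD _ _)).
  apply: (le_trans (lerD (ler_normD _ _) b3)).
  apply: (le_trans (lerD (lerD b1 b2) (lexx _))).
  have X0 : 0 <= L * omega t by rewrite mulr_ge0.
  have := ler_wpM2r X0 a2.
  rewrite (_ : L * (8 * a * omega t) = 8 * (a * (L * omega t))); last by ring.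
  rewrite (_ : L * (K * omega t) = K * (L * omega t)); last by ring.
  rewrite (_ : L * (3 * a * omega t) = 3 * (a * (L * omega t))); last by ring.
  rewrite (_ : 12 * a * L * omega t = 12 * (a * (L * omega t))); last by ring.
  lra.
Qed.

End JetComposition.

(** * From expansions to classical derivatives *)

Section JetRegularity.
Context {R : realType} {n : nat} (alpha : R).
Context (alpha_gt0 : 0 < alpha) (alpha_lt1 : alpha < 1).
Local Notation V := 'rV[R]_n.+1.
Local Notation cN := (@cN R n).
Local Notation omega := (@omega R alpha).
Local Notation jet := (@jet R n alpha).
Local Notation ei i := (delta_mx 0 i : V).
Implicit Types (f : V -> R) (S : set V) (x y h u v : V) (K L t : R).
Implicit Types (g : 'I_n.+1 -> R) (H : 'I_n.+1 -> 'I_n.+1 -> R).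

Lemma norm_delta i : `|ei i| = 1.
Proof.
apply/eqP; rewrite eq_le; apply/andP; split.
  apply: norm_le_coord => // j; rewrite mxE eqxx /=.
  by case: eqP; rewrite ?normr1 ?normr0.
by have := coord_le_norm (ei i) i; rewrite mxE !eqxx normr1.
Qed.

Lemma norm_scale_delta t i : `|t *: ei i| = `|t|.
Proof. by rewrite normrZ norm_delta mulr1. Qed.

Lemma lin_delta g t i : lin g (t *: ei i) = t * g i.
Proof.
rewrite /lin (bigD1 i)//= !mxE !eqxx big1 ?addr0 => [|j ji]; first by rewrite mulr1 mulrC.
by rewrite !mxE eqxx (negbTE ji) !mulr0.
Qed.

Lemma linDr g u v : lin g (u + v) = lin g u + lin g v.
Proof. by rewrite /lin -big_split; apply: eq_bigr => i _; rewrite mxE mulrDr. Qed.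

Lemma linNr g u : lin g (- u) = - lin g u.
Proof. by rewrite /lin -sumrN; apply: eq_bigr => i _; rewrite mxE mulrN. Qed.

(** The polar form of [quad H] without the factor 1/2; on basis vectors it gives the entries of the
    full Hessian. *)
Definition bil H u v : R := \sum_i \sum_j (H i j + H j i) * u 0 i * v 0 j.

Lemma quadDr H u v : quad H (u + v) = quad H u + quad H v + bil H u v.
Proof.
have -> : bil H u v = \sum_i \sum_j H i j * u 0 i * v 0 j +
    \sum_i \sum_j H i j * v 0 i * u 0 j.
  rewrite [X in _ = _ + X]exchange_big -big_split; apply: eq_bigr => i _ /=.
  by rewrite -big_split; apply: eq_bigr => j _ /=; ring.
rewrite /quad -!big_split; apply: eq_bigr => i _ /=.
rewrite -!big_split; apply: eq_bigr => j _ /=.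
by rewrite !mxE; ring.
Qed.

Lemma quadZr H t u : quad H (t *: u) = t ^+ 2 * quad H u.
Proof.
rewrite /quad mulr_sumr; apply: eq_bigr => i _.
by rewrite mulr_sumr; apply: eq_bigr => j _; rewrite !mxE; ring.
Qed.

Lemma linZr g t u : lin g (t *: u) = t * lin g u.
Proof. by rewrite /lin mulr_sumr; apply: eq_bigr => i _; rewrite mxE; ring. Qed.

Lemma bilZr H u t v : bil H u (t *: v) = t * bil H u v.
Proof.
rewrite /bil mulr_sumr; apply: eq_bigr => i _.
by rewrite mulr_sumr; apply: eq_bigr => j _; rewrite !mxE; ring.
Qed.

Lemma bilC H u v : bil H u v = bil H v u.
Proof.
rewrite /bil exchange_big; apply: eq_bigr => i _; apply: eq_bigr => j _ /=; ring.
Qed.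

Lemma bil_delta H u j : bil H u (ei j) = \sum_i (H i j + H j i) * u 0 i.
Proof.
apply: eq_bigr => i _; rewrite (bigD1 j)//= !mxE !eqxx mulr1 big1 ?addr0// => k kj.
by rewrite !mxE eqxx (negbTE kj) mulr0.
Qed.

Lemma bil_delta2 H i j : bil H (ei i) (ei j) = H i j + H j i.
Proof.
rewrite bil_delta (bigD1 i)//= !mxE !eqxx mulr1 big1 ?addr0// => k kj.
by rewrite !mxE eqxx (negbTE kj) mulr0.
Qed.

Lemma powR_small (e : R) : 0 < e -> exists2 del : R, 0 < del &
  forall t, 0 <= t <= del -> t `^ alpha <= e.
Proof.
move=> e0; exists (e `^ alpha^-1); first exact: powR_gt0.
move=> t /andP[t0 td]; apply: (@le_trans _ _ ((e `^ alpha^-1) `^ alpha)).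
  by apply: (ge0_ler_powR (ltW alpha_gt0)) => //; rewrite nnegrE powR_ge0.
by rewrite -powRrM mulVf ?gt_eqF// powRr1// ltW.
Qed.

Lemma hoelder_cvg f x (C r : R) : 0 < r ->
  (forall y, `|y - x| <= r -> `|f y - f x| <= C * `|y - x| `^ alpha) ->
  {for x, continuous f}.
Proof.
move=> r0 fC; suff : f @ x --> f x by [].
apply/(@cvgrPdist_le _ _ _ (nbhs x)) => /= e e0.
have C0 : 0 < `|C| + 1 by rewrite ltr_wpDl.
have [del del0 Hdel] := @powR_small (e / (`|C| + 1)) (divr_gt0 e0 C0).
near=> y.
have yr : `|y - x| <= r.
  by near: y; rewrite -nbhs_nbhs_norm; exists r => //= z /=; rewrite distrC => /ltW.
have yd : `|y - x| <= del.
  by near: y; rewrite -nbhs_nbhs_norm; exists del => //= z /=; rewrite distrC => /ltW.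
rewrite distrC (le_trans (fC _ yr))//.
have := Hdel `|y - x|; rewrite yd normr_ge0 => /(_ isT).
rewrite ler_pdivlMr// mulrC; apply: le_trans.
by rewrite ler_wpM2r ?powR_ge0// (le_trans (ler_norm _))// lerDl.
Unshelve. all: by end_near. Qed.

Lemma bilDl H u v w : bil H (u + v) w = bil H u w + bil H v w.
Proof.
rewrite /bil -big_split; apply: eq_bigr => k _ /=; rewrite -big_split.
by apply: eq_bigr => l _ /=; rewrite mxE; ring.
Qed.

Lemma bilDr H u v w : bil H u (v + w) = bil H u v + bil H u w.
Proof. by rewrite !(bilC H u) bilDl. Qed.

Lemma lin_at0 g : lin g 0 = 0.
Proof. by rewrite /lin big1// => i _; rewrite mxE mulr0. Qed.

Lemma quad_at0 H : quad H 0 = 0.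
Proof. by rewrite /quad big1// => i _; rewrite big1// => j _; rewrite !mxE mulr0. Qed.

Lemma bil_at0 H u : bil H u 0 = 0.
Proof. by rewrite /bil big1// => i _; rewrite big1// => j _; rewrite mxE mulr0. Qed.

Lemma is_derive_eps {W : normedModType R} (f : W -> R) (x v : W) (d : R) :
  (forall e, 0 < e -> exists2 r, 0 < r & forall t : R, `|t| <= r ->
    `|f (x + t *: v) - f x - t * d| <= e * `|t|) -> is_derive x v f d.
Proof.
move=> fd.
have lim : (fun t : R => t^-1 *: ((f \o shift x) (t *: v) - f x)) @ 0^' --> d.
  apply/cvgrPdist_le => /= e e0; have [r r0 Hr] := fd _ e0.
  near=> t.
  have t0 : t != 0 by near: t; exact: nbhs_dnbhs_neq.
  rewrite [t *: v + x]addrC.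
  rewrite (_ : d - _ = - (t^-1 * (f (x + t *: v) - f x - t * d))); last first.
    by rewrite /GRing.scale/=; field.
  rewrite normrN normrM normfV ler_pdivrMl ?normr_gt0// [leRHS]mulrC.
  by apply: Hr; near: t; exact: dnbhs0_le.
apply: DeriveDef; first by apply/cvg_ex; exists d.
by rewrite /derive; apply: cvg_lim.
Unshelve. all: by end_near. Qed.

Lemma is_derive_expansion f x v (d C r : R) : 0 < r ->
  (forall t, `|t| <= r ->
    `|f (x + t *: v) - f x - t * d| <= C * (`|t| * `|t| `^ alpha)) ->
  is_derive x v f d.
Proof.
move=> r0 fd; apply: is_derive_eps => e e0.
have C0 : 0 < `|C| + 1 by rewrite ltr_wpDl.
have [del del0 Hdel] := @powR_small (e / (`|C| + 1)) (divr_gt0 e0 C0).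
exists (Num.min r del); first by rewrite lt_min r0.
move=> t; rewrite le_min => /andP[tr td].
apply: (le_trans (fd _ tr)); rewrite mulrCA [leRHS]mulrC ler_wpM2l//.
have := Hdel `|t|; rewrite td normr_ge0 => /(_ isT).
rewrite ler_pdivlMr// mulrC; apply: le_trans.
by rewrite ler_wpM2r ?powR_ge0// (le_trans (ler_norm _))// lerDl.
Qed.

Lemma jet_derive S K f x g H i : nbhs x S -> jet S K f x g H ->
  is_derive x (ei i) f (g i).
Proof.
rewrite -nbhs_nbhs_norm => -[r /= r0 rS] J.
have m0 : 0 < Num.min (r / 2) 1 by rewrite lt_min divr_gt0//=.
apply: (is_derive_expansion (C := cN * K) m0) => t tr.
have [tr1 tr2] : `|t| <= r / 2 /\ `|t| <= 1 by split; apply: (le_trans tr); rewrite ge_min lexx ?orbT.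
have Sy : S (x + t *: ei i).
  apply: rS; rewrite /= opprD addNKr normrN norm_scale_delta.
  by rewrite (le_lt_trans tr1)// gtr_pMr// invf_lt1// ltr1n.
have e : x + t *: ei i - x = t *: ei i by rewrite addrAC subrr add0r.
have := jet_o1 alpha_gt0 J Sy; rewrite e norm_scale_delta lin_delta => /(_ tr2).
move/le_trans; apply; rewrite ler_wpM2l ?mulr_ge0 ?(jet_ge0 J)//.
  by rewrite (le_trans _ (@cN_ge1 R n)).
rewrite expr2 ler_wpM2l//; have [->|t0] := eqVneq t 0; first by rewrite normr0 powR_ge0.
by rewrite ger1_powR ?normr_gt0 ?t0// ltW.
Qed.

Section GlobalJets.
Context (K : R) (f : V -> R) (g : V -> 'I_n.+1 -> R)
  (H : V -> 'I_n.+1 -> 'I_n.+1 -> R).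
Context (fJ : forall x, jet setT K f x (g x) (H x)).

(* The Taylor polynomials at x and y both approximate f on the ball of radius 2|y - x|
   around y, so their difference, and hence each of its coefficients, is small. *)
Let P x z := f x + lin (g x) (z - x) + quad (H x) (z - x).

Let D x y z := P x z - P y z.

Let K0 : 0 <= K. Proof. exact: jet_ge0 (fJ 0). Qed.

(** The point [y + v] is within [3 * |y - x|] of both centres, and 54 = 2 * 3 ^ 3. The bound 1/4
    keeps that distance below 1, where the expansions are valid. *)
Let D_le x y v : `|y - x| <= 1/4 -> `|v| <= 2 * `|y - x| ->
  `|D x y (y + v)| <= 54 * K * omega `|y - x|.
Proof.
set s := `|y - x| => s1 vs; have s0 : 0 <= s := normr_ge0 _.
have h1 : `|y + v - x| <= 3 * s.
  rewrite addrAC (le_trans (ler_normD _ _))// -/s.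
  by move: (`|v|) vs => w vs; lra.
have h2 : `|y + v - y| <= 3 * s.
  rewrite addrAC subrr add0r (le_trans vs)//; lra.
have o3 : omega (3 * s) <= 27 * omega s.
  by apply: (le_trans (omegaM_le alpha_lt1 _ s0)); [lra|rewrite -natrX].
have hx z w : `|z - w| <= 3 * s -> `|f z - P w z| <= K * (27 * omega s).
  move=> zw; rewrite /P !opprD !addrA; case: (fJ w) => _ _ _ /(_ z I).
  have zw1 : `|z - w| <= 1 by rewrite (le_trans zw)//; lra.
  move/(_ zw1)/le_trans; apply; rewrite ler_wpM2l//.
  by rewrite (le_trans _ o3)// le_omega// normr_ge0.
have a1 := hx _ _ h1; have a2 := hx _ _ h2.
rewrite /D (_ : _ - _ = (f (y + v) - P y (y + v)) - (f (y + v) - P x (y + v))); last by ring.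
rewrite (le_trans (ler_normB _ _))//; lra.
Qed.

Let D_expand x y v : D x y (y + v) = D x y y + lin (g x) v - lin (g y) v +
  quad (H x) v - quad (H y) v + bil (H x) (y - x) v.
Proof.
rewrite /D /P (_ : y + v - x = (y - x) + v); last by rewrite addrAC.
rewrite (_ : y + v - y = v); last by rewrite addrAC subrr add0r.
by rewrite subrr lin_at0 quad_at0 linDr [quad (H x) (y - x + v)]quadDr; ring.
Qed.

Lemma grad_expansion x y i : `|y - x| <= 1/4 ->
  `|g y i - g x i - \sum_j (H x i j + H x j i) * (y - x) 0 j| <=
  54 * K * (`|y - x| * `|y - x| `^ alpha).
Proof.
have [->|yx s1] := eqVneq y x.
  rewrite !subrr normr0 => _; rewrite mul0r mulr0 big1 ?subrr ?normr0//.
  by move=> j _; rewrite mxE mulr0.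
have s0 : 0 < `|y - x| by rewrite normr_gt0 subr_eq0.
set s := `|y - x| in s0 s1 *.
have b1 : `|D x y (y + s *: ei i)| <= 54 * K * omega s.
  by apply: D_le => //; rewrite norm_scale_delta gtr0_norm// -/s; lra.
have b2 : `|D x y (y + (- s) *: ei i)| <= 54 * K * omega s.
  by apply: D_le => //; rewrite norm_scale_delta normrN gtr0_norm// -/s; lra.
rewrite -(ler_pM2l s0) -{1}(gtr0_norm s0) -normrM.
rewrite (_ : s * (54 * K * _) = 54 * K * omega s); last by rewrite /omega; ring.
(* A symmetric difference of the quadratic polynomial [v |-> D x y (y + v)] cancels its even part
   and isolates the linear coefficient. *)
have -> : s * (g y i - g x i - \sum_j (H x i j + H x j i) * (y - x) 0 j) =
    (D x y (y + (- s) *: ei i) - D x y (y + s *: ei i)) / 2.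
  rewrite !D_expand !lin_delta !bilZr !quadZr bil_delta.
  rewrite (eq_bigr (fun j => (H x j i + H x i j) * (y - x) 0 j)) => [|j _]; last first.
    by rewrite (addrC (H x j i)).
  by field.
rewrite normrM (@ger0_norm _ 2^-1)// ler_pdivrMr//.
by rewrite (le_trans (ler_normB _ _))//; lra.
Qed.

Lemma hess_hoelder x y i j : `|y - x| <= 1/4 ->
  `|(H y i j + H y j i) - (H x i j + H x j i)| <=
  216 * K * `|y - x| `^ alpha.
Proof.
have [->|yx s1] := eqVneq y x.
  by move=> _; rewrite !subrr normr0 !mulr_ge0// powR_ge0.
have s0 : 0 < `|y - x| by rewrite normr_gt0 subr_eq0.
set s := `|y - x| in s0 s1 *.
have b v : `|v| <= 2 * s -> `|D x y (y + v)| <= 54 * K * omega s by apply: D_le.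
have b1 := b 0; rewrite normr0 in b1.
have b2 := b (s *: ei i); rewrite norm_scale_delta (gtr0_norm s0) in b2.
have b3 := b (s *: ei j); rewrite norm_scale_delta (gtr0_norm s0) in b3.
have b4 := b (s *: ei i + s *: ei j).
have : `|s *: ei i + s *: ei j| <= 2 * s.
  by rewrite (le_trans (ler_normD _ _))// !norm_scale_delta (gtr0_norm s0); lra.
move/b4 => {}b4.
have : 0 <= 2 * s by lra. move/b1 => {}b1.
have s2 : s <= 2 * s by lra.
move/b2 : (s2) => {}b2; move/b3: (s2) => {b} b3.
have ss : 0 < s ^+ 2 by rewrite exprn_gt0.
rewrite -(ler_pM2l ss) -{1}(gtr0_norm ss) -normrM.
rewrite (_ : s ^+ 2 * (216 * K * _) = 216 * K * omega s); last by rewrite /omega; ring.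
(* The mixed second difference removes the constant and linear parts and leaves the polar form; four
   values of [D] give 216 = 4 * 54. *)
have -> : s ^+ 2 * (H y i j + H y j i - (H x i j + H x j i)) =
    D x y (y + s *: ei i) + D x y (y + s *: ei j) - D x y (y + 0)
    - D x y (y + (s *: ei i + s *: ei j)).
  rewrite !D_expand !linDr !quadDr !lin_delta !quadZr !bilZr.
  rewrite !(bilC _ (s *: _)) !bilZr !(bilC _ (ei j)) !bil_delta2.
  rewrite bilDr !bilZr bil_at0 !lin_at0 !quad_at0.
  ring.
rewrite (le_trans (ler_normB _ _))// (_ : 216 * K * omega s =
  54 * K * omega s + 54 * K * omega s + 54 * K * omega s + 54 * K * omega s); last by ring.
rewrite lerD// (le_trans (ler_normB _ _))// lerD//.
by rewrite (le_trans (ler_normD _ _))// lerD.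
Qed.

Lemma partial1_jet i : partial [:: i] f = fun x => g x i.
Proof.
apply/funext => x /=.
by have [_ ->] := @jet_derive _ _ _ _ _ _ i filterT (fJ x).
Qed.

Lemma is_derive_grad i j x :
  is_derive x (ei i) (fun y => g y j) (H x i j + H x j i).
Proof.
have r0 : (0 : R) < 1/4 by lra.
apply: (is_derive_expansion (C := 54 * K) r0) => t tr.
have e : x + t *: ei i - x = t *: ei i by rewrite addrAC subrr add0r.
have := @grad_expansion x (x + t *: ei i) j; rewrite e norm_scale_delta => /(_ tr).
apply: le_trans; rewrite le_eqVlt; apply/orP; left; apply/eqP; congr `| _ - _ |.
rewrite (bigD1 i)//= !mxE !eqxx mulr1 big1 ?addr0; first ring.
by move=> k ki; rewrite !mxE eqxx (negbTE ki) !mulr0.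
Qed.

Lemma partial2_jet i j : partial [:: i; j] f = fun x => H x i j + H x j i.
Proof.
rewrite -[LHS]/(partial [:: i] (partial [:: j] f)) partial1_jet; apply/funext => x /=.
by have [_ ->] := is_derive_grad i j x.
Qed.

End GlobalJets.

End JetRegularity.

(** * Cut-offs, extension by zero, and gluing along a hyperplane *)

Section JetConstructions.
Context {R : realType} {n : nat} (alpha : R).
Context (alpha_gt0 : 0 < alpha) (alpha_lt1 : alpha < 1).
Local Notation V := 'rV[R]_n.+1.
Local Notation N := (n.+1%:R : R).
Local Notation cN := (@cN R n).
Local Notation omega := (@omega R alpha).
Local Notation jet := (@jet R n alpha).
Local Notation C2a := (@C2a R n alpha).
Local Notation ei i := (delta_mx 0 i : V).
Implicit Types (f : V -> R) (S : set V) (x y h u v : V) (K L t : R).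
Implicit Types (g : 'I_n.+1 -> R) (H : 'I_n.+1 -> 'I_n.+1 -> R).

(** For coefficients, charts and cut-offs the size of the constant is irrelevant; for [u] the
    explicit [C2a] is kept throughout. *)
Definition C2ex S f := exists K, C2a S K f.

Lemma C2exP S f : C2ex S f -> exists2 K, 1 <= K & C2a S K f.
Proof.
move=> [K fK]; exists (Num.max K 1); first by rewrite le_max lexx orbT.
by apply: C2aW fK => //; rewrite le_max lexx.
Qed.

Lemma C2exS S S' f : S' `<=` S -> C2ex S f -> C2ex S' f.
Proof. by move=> SS [K fK]; exists K; exact: C2aW fK. Qed.

Lemma eq_C2ex S f f' : {in S, f =1 f'} -> C2ex S f -> C2ex S f'.
Proof. by move=> ff [K fK]; exists K; exact: eq_C2a fK. Qed.

Lemma C2ex_cst S (a : R) : C2ex S (fun=> a).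
Proof. by exists `|a|; exact: C2a_cst. Qed.

Lemma C2exD S f f' : C2ex S f -> C2ex S f' -> C2ex S (fun x => f x + f' x).
Proof. by move=> [K fK] [K' fK']; exists (K + K'); exact: C2aD. Qed.

Lemma C2exZ S f a : C2ex S f -> C2ex S (fun x => a * f x).
Proof. by move=> [K fK]; exists (`|a| * K); exact: C2aZ. Qed.

Lemma C2exB S f f' : C2ex S f -> C2ex S f' -> C2ex S (fun x => f x - f' x).
Proof.
move=> fK /(@C2exZ _ _ (-1)) fK'; apply: eq_C2ex (C2exD fK fK') => x _ /=.
by rewrite mulN1r.
Qed.

Lemma C2exM S f f' : C2ex S f -> C2ex S f' -> C2ex S (fun x => f x * f' x).
Proof. by move=> [K fK] [K' fK']; eexists; apply: C2aM fK fK'. Qed.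

Lemma C2ex_sum S m (F : 'I_m -> V -> R) : (forall i, C2ex S (F i)) ->
  C2ex S (fun x => \sum_i F i x).
Proof.
move=> FK.
suff H (s : seq 'I_m) : C2ex S (fun x => \sum_(i <- s) F i x) by exact: H.
elim: s => [|i s IH].
  by apply: eq_C2ex (C2ex_cst S 0) => x _; rewrite big_nil.
by apply: eq_C2ex (C2exD (FK i) IH) => x _; rewrite big_cons.
Qed.

Lemma C2ex_coord S i B : (forall x, S x -> `|x| <= B) -> C2ex S (fun x => x 0 i).
Proof.
move=> SB; exists (Num.max B 1) => x Sx; eexists; eexists.
by apply: jet_coord; rewrite le_max ?SB// lexx orbT.
Qed.

Lemma C2ex_inv S f del : 0 < del -> (forall x, S x -> del <= f x) -> C2ex S f ->
  C2ex S (fun x => (f x)^-1).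
Proof.
move=> d0 fd /C2exP[K K1 fK].
pose I := Num.max del^-1 1.
have I1 : 1 <= I by rewrite le_max lexx orbT.
have dI : del^-1 <= I by rewrite le_max lexx.
have inv s : del <= s -> 0 < s /\ s^-1 <= I.
  move=> ds; have s0 : 0 < s by apply: lt_le_trans ds.
  by split => //; rewrite (le_trans _ dI)// lef_pV2.
eexists; apply: (@C2a_comp_scalar _ _ _ alpha_gt0 alpha_lt1 S
  [set s | del <= s] K (I ^+ 4) f GRing.inv (fun s => - s^-1 ^+ 2) (fun s => s^-1 ^+ 3)) => //.
- move=> s /= /inv[s0 sI]; have s0' : 0 <= s^-1 by rewrite invr_ge0 ltW.
  have Ik k : (k <= 4)%N -> s^-1 ^+ k <= I ^+ 4.
    move=> k4; apply: (@le_trans _ _ (I ^+ k)); last by rewrite ler_weXn2l.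
    by rewrite lerXn2r// nnegrE// (le_trans s0').
  split; rewrite ?normrN ger0_norm ?exprn_ge0 ?Ik//.
  by have := Ik 1%N; rewrite expr1; apply.
- move=> s t /= /inv[s0 sI] /inv[t0 tI].
  rewrite (_ : _ - _ = - ((t - s) ^+ 3 * (t^-1 * s^-1 ^+ 3))); last first.
    by field; rewrite !gt_eqF.
  rewrite normrN normrM normrX mulrC ler_wpM2r ?exprn_ge0//.
  have [s0' t0'] : 0 <= s^-1 /\ 0 <= t^-1 by rewrite !invr_ge0 !ltW.
  rewrite ger0_norm ?mulr_ge0 ?exprn_ge0// [leRHS]exprS ler_pM ?exprn_ge0//.
  by rewrite lerXn2r ?nnegrE// (le_trans s0').
Qed.

(** The cubic truncated at 0 has a Lipschitz second derivative, which is all that a C^{2,alpha}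
    cut-off requires. *)
Definition pos3 (t : R) : R := if 0 <= t then t ^+ 3 else 0.

Lemma pos3_ge0 t : 0 <= pos3 t.
Proof. by rewrite /pos3; case: ifP => // t0; rewrite exprn_ge0. Qed.

Lemma C2ex_pos3 S f : C2ex S f -> C2ex S (fun x => pos3 (f x)).
Proof.
move=> /C2exP[K K1 fK].
have K0 : 0 <= K by rewrite (le_trans _ K1).
pose p1 t : R := if 0 <= t then 3 * t ^+ 2 else 0.
pose p2 t : R := if 0 <= t then 3 * t else 0.
eexists; apply: (@C2a_comp_scalar _ _ _ alpha_gt0 alpha_lt1 S
  [set s | `|s| <= K] K (3 * K ^+ 3) f pos3 p1 p2) => //.
- by move=> y Sy; have [g [H []]] := fK _ Sy.
- move=> s /= sK; rewrite /pos3 /p1 /p2; case: ifPn => s0; last first.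
    by rewrite normr0 mulr_ge0 ?exprn_ge0.
  have Kk k : (k <= 3)%N -> s ^+ k <= K ^+ 3.
    move=> k3; apply: (@le_trans _ _ (K ^+ k)); last by rewrite ler_weXn2l.
    by rewrite lerXn2r ?nnegrE// -(ger0_norm s0).
  have := Kk 3%N isT; have := Kk 2%N isT; have := Kk 1%N isT.
  rewrite expr1 => h1 h2 h3; have K3 := exprn_ge0 3 K0; have s2 := sqr_ge0 s.
  by split; rewrite ger0_norm ?exprn_ge0 ?mulr_ge0//; lra.
- move=> s t _ _ /=.
  have K3 : 1 <= 3 * K ^+ 3.
    by have := exprn_ege1 3 K1; lra.
  apply: (@le_trans _ _ (`|t - s| ^+ 3)); last by rewrite ler_peMl// exprn_ge0.
  rewrite -normrX /pos3 /p1 /p2.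
  case: ifPn => t0; case: ifPn => s0.
  + by rewrite le_eqVlt; apply/orP; left; apply/eqP; congr `|_|; ring.
  + rewrite !mul0r !subr0 !normrX lerXn2r ?nnegrE//.
    by move: s0; rewrite -ltNge => s0; rewrite !ger0_norm; lra.
  (* With [t < 0 <= s] the polynomial branch is extrapolated to [t]; the error lies between
     [- (s - t) ^+ 3] and 0. *)
  + rewrite (_ : 0 - _ - _ - _ = (- t) ^+ 3 - (s - t) ^+ 3); last by ring.
    rewrite -ltNge in t0.
    have h : (- t) ^+ 3 <= (s - t) ^+ 3 by rewrite lerXn2r ?nnegrE; lra.
    have h2 : 0 <= (- t) ^+ 3 by rewrite exprn_ge0; lra.
    rewrite distrC ger0_norm ?subr_ge0//.
    rewrite (_ : (t - s) ^+ 3 = - (s - t) ^+ 3); last by ring.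
    rewrite normrN ger0_norm; lra.
  + by rewrite !mul0r !subr0 normr0.
Qed.

(** The inner truncation makes it 0 for [t <= 0], the outer one makes it 1 as soon as [pos3 t]
    reaches 1. *)
Definition smoothstep (t : R) : R := 1 - pos3 (1 - pos3 t).

Lemma smoothstep01 t : 0 <= smoothstep t <= 1.
Proof.
rewrite /smoothstep subr_ge0 gerBl pos3_ge0 andbT.
rewrite {1}/pos3; case: ifPn => // h; have h0 := pos3_ge0 t.
by rewrite exprn_ile1//; lra.
Qed.

Lemma smoothstep0 t : t <= 0 -> smoothstep t = 0.
Proof.
move=> t0; have p0 : pos3 t = 0.
  rewrite /pos3; case: ifP => // t0'; have -> : t = 0 by lra.
  by rewrite expr0n.
by rewrite /smoothstep p0 subr0 /pos3 ler01 expr1n subrr.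
Qed.

Lemma smoothstep1 t : 1 <= t -> smoothstep t = 1.
Proof.
move=> t1; have t0 : 0 <= t by lra.
have h : 1 <= t ^+ 3 by rewrite exprn_ege1.
rewrite /smoothstep /pos3 t0; case: ifPn => h'; last by rewrite subr0.
by rewrite (_ : 1 - t ^+ 3 = 0); [rewrite expr0n subr0|lra].
Qed.

Lemma norm_le_enorm h : `|h| <= enorm h.
Proof.
apply: norm_le_coord => [|i]; first exact: sqrtr_ge0.
rewrite -sqrtr_sqr ler_wsqrtr// (bigD1 i)//= lerDl sumr_ge0// => j _.
exact: sqr_ge0.
Qed.

Lemma enorm_le_norm h : enorm h <= N * `|h|.
Proof.
rewrite -[leRHS]ger0_norm ?mulr_ge0// -sqrtr_sqr ler_wsqrtr//.
apply: (@le_trans _ _ (\sum_(i < n.+1) `|h| ^+ 2)).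
  by apply: ler_sum => i _; rewrite -[leLHS]ger0_norm ?sqr_ge0// normrX lerXn2r ?nnegrE ?coord_le_norm.
rewrite sumr_const card_ord -[leLHS]mulr_natl exprMn ler_wpM2r ?sqr_ge0//.
by rewrite ler_eXnr// ler1n.
Qed.

Lemma bump_ex (a : V) (r : R) : 0 < r -> exists eta : V -> R,
  [/\ forall x, 0 <= eta x <= 1, C2ex [set x | `|x - a| <= r] eta,
      exists2 rho, 0 < rho & forall x, `|x - a| <= rho -> eta x = 1 &
      forall x, r / 2 <= `|x - a| -> eta x = 0].
Proof.
(* The sup norm is not differentiable, so the cut-off is built on the squared Euclidean distance.
   [q] is at least 1 where that distance is at most [r / 4], and at most -2 where it is at least
   [r / 2]. *)
move=> r0; pose q x : R := 2 - (r / 4) ^- 2 * \sum_i (x 0 i - a 0 i) ^+ 2.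
have r4 : 0 < (r / 4) ^+ 2 by rewrite exprn_gt0 ?divr_gt0.
have qe x : q x = 2 - (enorm (x - a) / (r / 4)) ^+ 2.
  rewrite /q; move: (r / 4) r4 => c c0; rewrite [X in _ = _ - X]exprMn exprVn mulrC.
  congr (_ - _ * _); rewrite /enorm sqr_sqrtr ?sumr_ge0// => [|i _]; last exact: sqr_ge0.
  by apply: eq_bigr => i _; rewrite !mxE.
have e0 x : 0 <= enorm (x - a) by apply: sqrtr_ge0.
exists (fun x => smoothstep (q x)); split.
- by move=> x; exact: smoothstep01.
- apply: C2exB; first exact: C2ex_cst.
  apply: C2ex_pos3; apply: C2exB; first exact: C2ex_cst.
  apply: C2ex_pos3; apply: C2exB; first exact: C2ex_cst.
  apply: C2exZ; apply: C2ex_sum => i.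
  have c : C2ex [set x : V | `|x - a| <= r] (fun x => x 0 i - a 0 i).
    apply: C2exB; last exact: C2ex_cst.
    apply: (@C2ex_coord _ _ (`|a| + r)) => x /= xa.
    rewrite -(subrK a x) addrC (le_trans (ler_normD _ _))// lerD2l.
    exact: xa.
  exact: C2exM.
- exists (r / 4 / N); first by rewrite !divr_gt0.
  move=> x xr; apply: smoothstep1; rewrite qe.
  have h : enorm (x - a) <= r / 4.
    rewrite (le_trans (enorm_le_norm _))// mulrC -ler_pdivlMr//.
  have : (enorm (x - a) / (r / 4)) ^+ 2 <= 1.
    have r40 : 0 < r / 4 by rewrite divr_gt0.
    apply: exprn_ile1; first by rewrite divr_ge0// ltW.
    by rewrite ler_pdivrMr// mul1r.
  lra.
- move=> x xr; apply: smoothstep0; rewrite qe.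
  have h : r / 2 <= enorm (x - a) by rewrite (le_trans xr)// norm_le_enorm.
  have h2 : 2 <= enorm (x - a) / (r / 4) by rewrite ler_pdivlMr ?divr_gt0//; lra.
  have : 2 ^+ 2 <= (enorm (x - a) / (r / 4)) ^+ 2.
    by rewrite lerXn2r ?nnegrE ?divr_ge0// ltW// divr_gt0.
  rewrite expr2; lra.
Qed.

(** At distance at least [r / 4] the remainder [omega] is bounded below, so for such pairs of points
    the expansion only costs a constant. Closer pairs lie both in the ball, where [f] has its jets,
    or both in the region where the extended function vanishes. *)
Lemma C2a_localize (a : V) (r K : R) f : 0 < r ->
  C2a [set x | `|x - a| <= r] K f ->
  (forall x, `|x - a| <= r -> r / 2 <= `|x - a| -> f x = 0) ->
  C2a setT ((cN * (4 / r) ^+ 3 + 1) * K) (fun x => if `|x - a| <= r then f x else 0).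
Proof.
move=> r0 fK f0.
have K0 : 0 <= K.
  have [|g [H J]] := fK a; last exact: jet_ge0 J.
  by rewrite /= subrr normr0 ltW.
have c1 := @cN_ge1 R n.
have C0 : 0 <= cN * (4 / r) ^+ 3.
  by rewrite mulr_ge0 ?exprn_ge0 ?divr_ge0 ?(le_trans _ c1) ?ltW.
have far (t : R) : r / 4 <= t <= 1 -> 1 <= (4 / r) ^+ 3 * omega t.
  move=> /andP[rt t1]; have t0 : 0 <= t by rewrite (le_trans _ rt)// divr_ge0// ltW.
  apply: (@le_trans _ _ ((4 / r) ^+ 3 * t ^+ 3)).
    by rewrite -exprMn exprn_ege1// mulrC mulrA ler_pdivlMr// mul1r; lra.
  by rewrite ler_wpM2l ?cube_le_omega ?t0// exprn_ge0// divr_ge0// ltW.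
have KC : K <= (cN * (4 / r) ^+ 3 + 1) * K by rewrite ler_peMl// lerDr.
have cK t : r / 4 <= t <= 1 -> cN * K <= (cN * (4 / r) ^+ 3 + 1) * K * omega t.
  move=> /far ft; have A : cN * K <= cN * K * ((4 / r) ^+ 3 * omega t).
    by rewrite ler_peMr// mulr_ge0// (le_trans _ c1).
  rewrite [leRHS](_ : _ = cN * K * ((4 / r) ^+ 3 * omega t) + K * omega t); last by ring.
  by rewrite (le_trans A)// lerDl mulr_ge0// omega_ge0.
(* Below [3 / 4 * r] the jet of [f] is kept, and a [y] outside the ball is far from [x]. Beyond it
   the zero jet is used, and any [y] with a nonzero value is far from [x]. *)
move=> x _; have [xr|xr] := ltP `|x - a| (3 / 4 * r).
  have xB : `|x - a| <= r by rewrite (le_trans (ltW xr))//; lra.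
  have [g [H J]] := fK _ xB; exists g, H; have [xK gK HK e] := J.
  split=> [|i|i j|y _ yx].
  - by rewrite xB (le_trans xK).
  - exact: le_trans KC.
  - exact: le_trans KC.
  - rewrite xB; case: ifPn => yB.
      apply: (le_trans (e _ yB yx)); rewrite ler_wpM2r ?omega_ge0//.
    have far_yx : r / 4 <= `|y - x| <= 1.
      rewrite yx andbT; have := ler_normD (y - x) (x - a).
      rewrite addrA subrK; move: yB; rewrite -ltNge.
      by move: (`|y - a|) (`|x - a|) (`|y - x|) xr => ? ? ? ? ? ?; lra.
    apply: le_trans (cK _ far_yx).
    have := lin_le (y - x) gK; have := quad_le (y - x) HK => q l.
    have y2 : `|y - x| ^+ 2 <= 1 by rewrite exprn_ile1.
    have q' : `|quad H (y - x)| <= N ^+ 2 * K.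
      by rewrite (le_trans q)// ler_piMr// mulr_ge0// sqr_ge0.
    have l' : `|lin g (y - x)| <= N * K.
      by rewrite (le_trans l)// ler_piMr// mulr_ge0.
    have := ler_normB (0 - f x - lin g (y - x)) (quad H (y - x)).
    have := ler_normB (0 - f x) (lin g (y - x)).
    rewrite {2}sub0r normrN /cN !mulrDl mul1r.
    move: (`|_ - quad _ _|) (`|_ - lin _ _|) => ? ? ? ?; lra.
exists (fun=> 0), (fun _ _ => 0).
have x0 : (if `|x - a| <= r then f x else 0) = 0.
  by case: ifPn => // xB; rewrite f0// (le_trans _ xr)//; lra.
have CK0 : 0 <= (cN * (4 / r) ^+ 3 + 1) * K by rewrite (le_trans K0).
split=> [|i|i j|y _ yx]; rewrite ?x0 ?normr0//.
rewrite lin0 quad0 !subr0; case: ifPn => yB; last first.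
  by rewrite normr0 mulr_ge0// omega_ge0.
have [yr|/(f0 _ yB)->] := ltP `|y - a| (r / 2); last first.
  by rewrite normr0 mulr_ge0// omega_ge0.
have far_yx : r / 4 <= `|y - x| <= 1.
  rewrite yx andbT; have := ler_normD (x - y) (y - a).
  rewrite addrA subrK (distrC x y).
  by move: (`|y - a|) (`|x - a|) (`|y - x|) xr yr => ? ? ? ? ? ?; lra.
apply: le_trans (cK _ far_yx).
have [g [H [yK _ _ _]]] := fK _ yB.
by rewrite (le_trans yK)// ler_peMl.
Qed.

Section Glue.
Context (p : V) (r K : R).
Local Notation half s := [set z : V | `|z - p| <= r /\ 0 <= s * z 0 ord_max].

(* The two expansions are compared at the point where the segment from x to y meets the
   hyperplane; f1 is only known on the side of x, f2 on that of y. *)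
Lemma glue_core (s : R) f1 f2 x y g H : 0 < r -> r <= 1 -> s ^+ 2 = 1 ->
  (forall z, `|z - p| <= r -> z 0 ord_max = 0 -> f1 z = f2 z) ->
  (forall z, `|z - p| <= r -> z 0 ord_max = 0 -> exists g0 H0,
    jet (half s) K f1 z g0 H0 /\ jet (half (- s)) K f2 z g0 H0) ->
  jet (half s) K f1 x g H ->
  `|x - p| <= r / 10 -> `|y - p| <= r / 10 ->
  0 <= s * x 0 ord_max -> s * y 0 ord_max <= 0 ->
  `|f2 y - f1 x - lin g (y - x) - quad H (y - x)| <= 379 * K * omega `|y - x|.
Proof.
move=> r0 r1 s2 f12z common Jx xp yp sx sy.
have s1 : `|s| = 1.
  by apply/eqP; rewrite -(@eqrXn2 _ 2)// expr1n -normrX s2 normr1.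
have K0 := jet_ge0 Jx.
set l := `|y - x|; have l0 : 0 <= l := normr_ge0 _.
have lr : l <= r / 5.
  rewrite /l -(subrKA p) (le_trans (ler_normD _ _))// (distrC p).
  by move: (`|y - p|) (`|x - p|) xp yp => ? ? ? ?; lra.
pose xn := x 0 ord_max; pose yn := y 0 ord_max.
(* The default 0 serves segments parallel to the hyperplane: by the sign conditions such a segment
   lies inside it. *)
pose t := if xn - yn == 0 then 0 else xn / (xn - yn).
have t01 : 0 <= t <= 1.
  rewrite /t; case: ifPn => [_|h]; first by rewrite lexx ler01.
  have -> : xn / (xn - yn) = (s * xn) / (s * xn - s * yn).
    rewrite -mulrBr invfM mulrACA divff ?mul1r// -normr_gt0 s1//.
  have : s * xn - s * yn != 0.
    by rewrite -mulrBr mulf_neq0// -normr_gt0 s1.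
  rewrite neq_lt => h'; have {h'}h' : 0 < s * xn - s * yn.
    by move: h' sx sy; rewrite -/xn -/yn => /orP[]; lra.
  apply/andP; split; first by rewrite divr_ge0// ltW.
  by rewrite ler_pdivrMr// mul1r; move: sy; rewrite -/yn; lra.
pose z := x + t *: (y - x).
have zn : z 0 ord_max = 0.
  rewrite /z !mxE -/xn -/yn /t; case: ifPn => [/eqP h|h]; last by field.
  rewrite mul0r addr0; apply/eqP; rewrite -normr_eq0 -[`|_|]mul1r -s1 -normrM.
  have e : xn = yn by apply/eqP; rewrite -subr_eq0 h.
  move: sx sy; rewrite -/xn -/yn -e => a b; have -> : s * xn = 0 by lra.
  by rewrite normr0.
have /andP[t0 t1] := t01.
have zx : `|z - x| <= l.
  by rewrite /z addrAC subrr add0r normrZ ger0_norm// ler_piMl.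
have yz : `|y - z| <= l.
  rewrite (_ : y - z = (1 - t) *: (y - x)); last first.
    by rewrite /z scalerBl scale1r opprD addrA.
  by rewrite normrZ ger0_norm ?subr_ge0// ler_piMl// gerBl.
have zp : `|z - p| <= 3/10 * r.
  rewrite -(subrKA x) (le_trans (ler_normD _ _))//.
  by move: (`|z - x|) (`|x - p|) xp zx => ? ? ? ?; lra.
clearbody z.
have [|g0 [H0 [J1 J2]]] := common z _ zn; first by rewrite (le_trans zp)//; lra.
pose P v := f1 x + lin g (v - x) + quad H (v - x).
pose P0 v := f1 z + lin g0 (v - z) + quad H0 (v - z).
have [d0 s0e] : `|s *: ei ord_max| = 1 /\ s * (s *: ei ord_max : V) 0 ord_max = 1.
  by rewrite norm_scale_delta s1 !mxE !eqxx mulr1 -expr2 s2.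
(* The two polynomials can only be compared where [f1] is known, on the side of [x]. [v0] lies at
   height [l] on that side and [|d| <= l], so [v0 + e *: d] stays there for [|e| <= 1]; the value at
   [y = v0 + 2 *: d] is then extrapolated. *)
pose v0 := z + l *: (s *: ei ord_max).
pose d := 2^-1 *: (y - v0).
have v0z : `|v0 - z| <= l by rewrite /v0 addrAC subrr add0r normrZ d0 mulr1 ger0_norm.
have dl : `|d| <= l.
  rewrite /d normrZ ger0_norm ?invr_ge0// -(subrKA z).
  have := ler_normD (y - z) (z - v0); rewrite (distrC z).
  by move: (`|y - z|) (`|v0 - z|) (`|_ + _|) yz v0z => ? ? ? ? ? ?; lra.
have yE : y = v0 + 2 *: d by rewrite /d scalerA divff// scale1r addrC subrK.
have diff_le e : `|e| <= 1 -> `|P0 (v0 + e *: d) - P (v0 + e *: d)| <= 54 * K * omega l.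
  move=> e1; set v := v0 + e *: d.
  have ed : `|e *: d| <= l by rewrite normrZ (le_trans _ dl)// ler_piMl.
  have vz : `|v - z| <= 2 * l.
    rewrite /v addrAC; have := ler_normD (v0 - z) (e *: d).
    by move: (`|v0 - z|) (`|e *: d|) (`|_ + _|) v0z ed => ? ? ? ? ? ?; lra.
  have vx : `|v - x| <= 3 * l.
    rewrite -(subrKA z); have := ler_normD (v - z) (z - x).
    by move: (`|v - z|) (`|z - x|) (`|_ + _|) vz zx => ? ? ? ? ? ?; lra.
  have vS : half s v.
    split.
      rewrite -(subrKA z); have := ler_normD (v - z) (z - p).
      by move: (`|v - z|) (`|z - p|) (`|_ + _|) vz zp => ? ? ? ? ? ?; lra.
    have -> : v 0 ord_max = l * (s *: ei ord_max : V) 0 ord_max + (e *: d) 0 ord_max.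
      rewrite /v mxE; congr (_ + _).
      by rewrite /v0 [LHS]mxE zn add0r [LHS]mxE.
    rewrite mulrDr mulrCA s0e mulr1.
    have : `|s * (e *: d) 0 ord_max| <= l.
      by rewrite normrM s1 mul1r (le_trans (coord_le_norm _ _)).
    by rewrite ler_norml => /andP[]; lra.
  have o3 : omega (3 * l) <= 27 * omega l.
    by apply: (le_trans (omegaM_le alpha_lt1 _ l0)); [lra|rewrite -natrX].
  have : `|f1 v - P v| <= K * (27 * omega l).
    rewrite /P !opprD !addrA; case: Jx => _ _ _ /(_ v vS) Jx.
    apply: (le_trans (Jx _)); first by rewrite (le_trans vx)//; lra.
    by rewrite ler_wpM2l// (le_trans _ o3)// le_omega// normr_ge0.
  have : `|f1 v - P0 v| <= K * (27 * omega l).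
    rewrite /P0 !opprD !addrA; case: J1 => _ _ _ /(_ v vS) J1.
    apply: (le_trans (J1 _)); first by rewrite (le_trans vz)//; lra.
    by rewrite ler_wpM2l// (le_trans _ o3)// le_omega// normr_ge0 (le_trans vz)//; lra.
  rewrite (_ : P0 v - P v = (f1 v - P v) - (f1 v - P0 v)); last by ring.
  have := ler_normB (f1 v - P v) (f1 v - P0 v); lra.
clearbody d v0.
have f12 : f1 z = f2 z by rewrite f12z// (le_trans zp)//; lra.
(* A quadratic polynomial q satisfies q 2 = 3 * q 1 + q (-1) - 3 * q 0. *)
have quadratic : P0 y - P y = 3 * (P0 (v0 + 1 *: d) - P (v0 + 1 *: d))
    + (P0 (v0 + (-1) *: d) - P (v0 + (-1) *: d))
    - 3 * (P0 (v0 + 0 *: d) - P (v0 + 0 *: d)).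
  have E e : P (v0 + e *: d) = f1 x + lin g (v0 - x) + quad H (v0 - x)
      + e * lin g d + e ^+ 2 * quad H d + e * bil H (v0 - x) d.
    rewrite /P (_ : v0 + e *: d - x = (v0 - x) + e *: d); last by rewrite addrAC.
    by rewrite linDr quadDr linZr quadZr bilZr; ring.
  have E0 e : P0 (v0 + e *: d) = f1 z + lin g0 (v0 - z) + quad H0 (v0 - z)
      + e * lin g0 d + e ^+ 2 * quad H0 d + e * bil H0 (v0 - z) d.
    rewrite /P0 (_ : v0 + e *: d - z = (v0 - z) + e *: d); last by rewrite addrAC.
    by rewrite linDr quadDr linZr quadZr bilZr; ring.
  by rewrite yE !E !E0; ring.
have f2y : `|f2 y - P0 y| <= K * omega l.
  rewrite /P0 f12 !opprD !addrA; case: J2 => _ _ _ J2.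
  apply: (le_trans (J2 _ _ _)); last by rewrite ler_wpM2l// le_omega// normr_ge0.
    by split; [rewrite (le_trans yp)//; lra|rewrite mulNr oppr_ge0].
  by rewrite (le_trans yz)//; lra.
(* 378 = (3 + 1 + 3) * 54; the expansion of [f2] at [z] adds 1 to give 379. *)
have Py : `|P0 y - P y| <= 378 * K * omega l.
  rewrite quadratic; have [h1 h2 h3] : [/\ `|1 : R| <= 1, `|-1 : R| <= 1 & `|0 : R| <= 1].
    by rewrite normrN normr0 normr1 lexx ler01.
  have := diff_le _ h1; have := diff_le _ h2; have := diff_le _ h3.
  move: (P0 _ - _) (P0 _ - _) (P0 _ - _) => q1 q2 q3.
  by rewrite !ler_norml => /andP[? ?] /andP[? ?] /andP[? ?]; apply/andP; split; lra.
rewrite (_ : _ - _ = (f2 y - P0 y) + (P0 y - P y)); last by rewrite /P; ring.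
by rewrite (le_trans (ler_normD _ _))//; lra.
Qed.

(** Shrinking to [r / 10] leaves room for the auxiliary points of [glue_core]: the crossing point is
    within [3/10 * r] of [p], and the comparison points within [7/10 * r]. *)
Lemma C2a_glue f1 f2 : 0 < r -> r <= 1 ->
  C2a (half 1) K f1 -> C2a (half (-1)) K f2 ->
  (forall z, `|z - p| <= r -> z 0 ord_max = 0 -> f1 z = f2 z /\
    exists g0 H0, jet (half 1) K f1 z g0 H0 /\ jet (half (-1)) K f2 z g0 H0) ->
  C2a [set z | `|z - p| <= r / 10] (379 * K)
    (fun z => if 0 <= z 0 ord_max then f1 z else f2 z).
Proof.
move=> r0 r1 f1K f2K common x /= xp.
have r10 : r / 10 <= r by lra.
have fz z : `|z - p| <= r -> z 0 ord_max = 0 -> f1 z = f2 z by move=> a /(common _ a)[].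
have cm z : `|z - p| <= r -> z 0 ord_max = 0 -> exists g0 H0,
  jet (half 1) K f1 z g0 H0 /\ jet (half (-1)) K f2 z g0 H0.
  by move=> a /(common _ a)[].
have xr := le_trans xp r10.
have big K' g H : 0 <= K' -> K' <= 379 * K' by move=> ? ; lra.
have [x0|x0] := leP 0 (x 0 ord_max).
  have [|g [H J]] := f1K x; first by rewrite /= mul1r.
  have K0 := jet_ge0 J; exists g, H; have [xK gK HK e] := J; split => [|i|i j|y /= yp yx].
  - rewrite x0; lra.
  - have := gK i; lra.
  - have := HK i j; lra.
  - rewrite x0; case: ifPn => [y0|].
      apply: (le_trans (e y _ yx)); first by split; [exact: le_trans r10|rewrite mul1r].
      by rewrite ler_wpM2r ?omega_ge0//; lra.
    rewrite -ltNge => y0.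
    apply: (@glue_core 1 f1 f2 x y g H) => //; rewrite ?expr1n ?mul1r//; exact: ltW.
have [|g [H J]] := f2K x; first by split => //; rewrite mulN1r oppr_ge0 ltW.
have K0 := jet_ge0 J; exists g, H; have [xK gK HK e] := J.
have x0' : (0 <= x 0 ord_max) = false by apply/negbTE; rewrite -ltNge.
split => [|i|i j|y /= yp yx].
- rewrite x0'; lra.
- have := gK i; lra.
- have := HK i j; lra.
- rewrite x0'; case: ifPn => [y0|]; last first.
    rewrite -ltNge => y0; apply: (le_trans (e y _ yx)).
      by split; [exact: le_trans r10|rewrite mulN1r oppr_ge0 ltW].
    by rewrite ler_wpM2r ?omega_ge0//; lra.
  apply: (@glue_core (-1) f2 f1 x y g H) => //.
  - by rewrite sqrrN expr1n.
  - by move=> z /fz{}fz /fz.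
  - move=> z zr /(cm _ zr)[g0 [H0 [J1 J2]]]; exists g0, H0.
    by rewrite opprK.
  - by rewrite mulN1r oppr_ge0 ltW.
  - by rewrite mulN1r oppr_le0.
Qed.

End Glue.

End JetConstructions.

(** * Total derivatives, mean values and Taylor's formula *)

Section Frechet.
Context {R : realType} {n : nat} (alpha : R).
Context (alpha_gt0 : 0 < alpha) (alpha_lt1 : alpha < 1).
Local Notation V := 'rV[R]_n.+1.
Local Notation N := (n.+1%:R : R).
Local Notation omega := (@omega R alpha).
Local Notation ei i := (delta_mx 0 i : V).
Implicit Types (f : V -> R) (S : set V) (x y h u v : V) (K L t : R).
Implicit Types (g : 'I_n.+1 -> R) (H : 'I_n.+1 -> 'I_n.+1 -> R).

(** Existence of partial derivatives gives no chain rule; compositions with charts are therefore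
    differentiated through total derivatives. *)
Definition frechet f x g := forall e, 0 < e -> exists2 d, 0 < d &
  forall h, `|h| <= d -> `|f (x + h) - f x - lin g h| <= e * `|h|.

Lemma frechet_line f w v t g : frechet f (w + t *: v) g ->
  is_derive t 1 (fun s : R => f (w + s *: v)) (lin g v).
Proof.
move=> fd; apply: is_derive_eps => e e0.
have v1 : 0 < `|v| + 1 by rewrite ltr_wpDl.
have [d d0 Hd] := fd (e / (`|v| + 1)) (divr_gt0 e0 v1).
exists (d / (`|v| + 1)); first exact: divr_gt0.
move=> s; rewrite ler_pdivlMr// => sd.
have -> : w + (t + s *: 1) *: v = w + t *: v + s *: v.
  by rewrite -addrA -scalerDl; congr (_ + _ *: _); rewrite /GRing.scale/= mulr1.
have sv : `|s *: v| <= d.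
  by rewrite normrZ (le_trans _ sd)// ler_wpM2l// lerDl.
rewrite -linZr; apply: (le_trans (Hd _ sv)); rewrite normrZ.
rewrite [leLHS](_ : _ = e * `|s| * (`|v| / (`|v| + 1))); last by ring.
rewrite ler_piMr ?mulr_ge0 ?(ltW e0)//.
by rewrite ler_pdivrMr// mul1r lerDl.
Qed.

Lemma frechet_partial f x g i : frechet f x g -> is_derive x (ei i) f (g i).
Proof.
move=> fd; apply: is_derive_eps => e e0; have [d d0 Hd] := fd e e0.
exists d => // t td; rewrite -lin_delta -(norm_scale_delta t i).
by apply: Hd; rewrite norm_scale_delta.
Qed.

Lemma frechetB f f' x g g' : frechet f x g -> frechet f' x g' ->
  frechet (fun y => f y - f' y) x (fun i => g i - g' i).
Proof.
move=> fd fd' e e0; have e2 : 0 < e / 2 by rewrite divr_gt0.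
have [d d0 Hd] := fd _ e2; have [d' d0' Hd'] := fd' _ e2.
exists (Num.min d d'); first by rewrite lt_min d0.
move=> h; rewrite le_min => /andP[/Hd hd /Hd' hd'].
have -> : lin (fun i => g i - g' i) h = lin g h - lin g' h.
  by rewrite /lin -sumrB; apply: eq_bigr => i _; rewrite mulrBl.
rewrite (_ : _ - _ = (f (x + h) - f x - lin g h) - (f' (x + h) - f' x - lin g' h)); last by ring.
by rewrite (le_trans (ler_normB _ _))//; lra.
Qed.

Lemma frechet_quad g H a x :
  frechet (fun y => lin g (y - a) + quad H (y - a)) x
    (fun i => g i + \sum_j (H i j + H j i) * (x - a) 0 j).
Proof.
move=> e e0; pose B := \sum_i \sum_j `|H i j|.
have B0 : 0 <= B by rewrite sumr_ge0// => i _; rewrite sumr_ge0.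
have HB i j : `|H i j| <= B.
  rewrite /B (bigD1 i)//= (bigD1 j)//= -addrA lerDl addr_ge0 ?sumr_ge0// => k _.
  by rewrite sumr_ge0.
have B1 : 0 < N ^+ 2 * B + 1 by rewrite ltr_wpDl// mulr_ge0// sqr_ge0.
exists (e / (N ^+ 2 * B + 1)); first exact: divr_gt0.
move=> h hd.
have -> : lin (fun i => g i + \sum_j (H i j + H j i) * (x - a) 0 j) h =
    lin g h + bil H (x - a) h.
  rewrite linD bilC; congr (_ + _); rewrite /bil; apply: eq_bigr => i _.
  by rewrite mulr_suml; apply: eq_bigr => j _; ring.
have -> : x + h - a = (x - a) + h by rewrite addrAC.
rewrite linDr quadDr (_ : _ - _ = quad H h); last by ring.
apply: (le_trans (quad_le h HB)); rewrite expr2 mulrA ler_wpM2r//.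
move: hd; rewrite ler_pdivlMr// mulrC; apply: le_trans.
by rewrite ler_wpM2r// lerDl.
Qed.

Lemma frechet_lip f x g : frechet f x g -> exists2 d, 0 < d &
  forall h, `|h| <= d -> `|f (x + h) - f x| <= (N * (\sum_i `|g i|) + 1) * `|h|.
Proof.
move=> fd; have [d d0 Hd] := fd 1 ltr01; exists d => // h /Hd hd.
have gB i : `|g i| <= \sum_i `|g i| by rewrite (bigD1 i)//= lerDl sumr_ge0.
have := lin_le h gB; rewrite mulrDl mul1r => l.
have := lerD l hd; rewrite mul1r addrC => /(le_trans _); apply.
by apply: le_trans (ler_normD _ _); rewrite addrC subrK.
Qed.

Lemma common_radius m (P : 'I_m -> V -> Prop) :
  (forall i, exists2 d : R, 0 < d & forall h, `|h| <= d -> P i h) ->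
  exists2 d : R, 0 < d & forall h, `|h| <= d -> forall i, P i h.
Proof.
move=> H.
have /choice[d Hd] : forall i, exists d : R, 0 < d /\ forall h, `|h| <= d -> P i h.
  by move=> i; have [d ? ?] := H i; exists d.
exists (\big[Num.min/1]_i d i).
  by apply/bigmin_gtP; split => // i _; case: (Hd i).
move=> h hd i; have [_] := Hd i; apply; rewrite (le_trans hd)//.
exact: bigmin_le.
Qed.

Lemma lin_compgrad g J h : lin (compgrad g J) h = \sum_i g i * lin (J i) h.
Proof. by rewrite lin_sum; apply: eq_bigr => i _; rewrite linZ. Qed.

Lemma frechet_comp f (psi : V -> V) x g J :
  (forall i, frechet (fun y => psi y 0 i) x (J i)) -> frechet f (psi x) g ->
  frechet (fun y => f (psi y)) x (compgrad g J).
Proof.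
move=> psid fd e e0.
pose LL := \sum_i (N * (\sum_k `|J i k|) + 1).
have L1 i : N * (\sum_k `|J i k|) + 1 <= LL.
  rewrite /LL [leRHS](bigD1 i)//= lerDl sumr_ge0// => k _.
  by rewrite addr_ge0// mulr_ge0// sumr_ge0.
have LL0 : 0 <= LL.
  by apply: le_trans (L1 ord0); rewrite addr_ge0// mulr_ge0// sumr_ge0.
have LL1 : 0 < LL + 1 by rewrite ltr_wpDl.
pose G := \sum_i `|g i|.
have G0 : 0 <= G by rewrite sumr_ge0.
have GB i : `|g i| <= G by rewrite /G (bigD1 i)//= lerDl sumr_ge0.
have NG : 0 < N * (G + 1) by rewrite mulr_gt0// ltr_wpDl.
have ee0 : 0 < e / 2 / (N * (G + 1)) by rewrite !divr_gt0.
have [df df0 Hf] := fd (e / 2 / (LL + 1)) (divr_gt0 (divr_gt0 e0 (ltr0Sn _ 1)) LL1).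
have [|d d0 Hd] := @common_radius n.+1 (fun i h =>
    `|psi (x + h) 0 i - psi x 0 i| <= (N * (\sum_k `|J i k|) + 1) * `|h| /\
    `|psi (x + h) 0 i - psi x 0 i - lin (J i) h| <= e / 2 / (N * (G + 1)) * `|h|).
  move=> i; have [d1 d10 H1] := frechet_lip (psid i).
  have [d2 d20 H2] := psid i _ ee0.
  exists (Num.min d1 d2); first by rewrite lt_min d10.
  by move=> h; rewrite le_min => /andP[/H1 ? /H2 ?].
exists (Num.min d (df / (LL + 1))); first by rewrite lt_min d0 divr_gt0.
move=> h; rewrite le_min ler_pdivlMr// => /andP[/Hd hd hdf].
set eta := psi (x + h) - psi x.
have etaE i : eta 0 i = psi (x + h) 0 i - psi x 0 i by rewrite !mxE.
have eta_le : `|eta| <= LL * `|h|.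
  apply: norm_le_coord => [|i]; first by rewrite mulr_ge0.
  by rewrite etaE; have [+ _] := hd i; move/le_trans; apply; rewrite ler_wpM2r.
have eta_df : `|eta| <= df.
  by rewrite (le_trans eta_le)// (le_trans _ hdf)// mulrC ler_wpM2l// lerDl.
have b1 := Hf _ eta_df; rewrite (_ : psi x + eta = psi (x + h)) in b1; last by rewrite /eta addrCA subrr addr0.
have {}b1 : `|f (psi (x + h)) - f (psi x) - lin g eta| <= e / 2 * `|h|.
  apply: (le_trans b1); rewrite -mulrA ler_wpM2l ?divr_ge0 ?(ltW e0)//.
  rewrite mulrC ler_pdivrMr// (le_trans eta_le)// mulrC ler_wpM2l// lerDl.
  exact: ler01.
have b2 : `|\sum_i g i * (eta 0 i - lin (J i) h)| <= e / 2 * `|h|.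
  apply: (@le_trans _ _ (N * (G * (e / 2 / (N * (G + 1)) * `|h|)))).
    apply: ler_norm_sum_ord => i; rewrite normrM ler_pM// etaE.
    by have [] := hd i.
  rewrite (_ : N * _ = (e / 2 * `|h|) * (N * G / (N * (G + 1)))); last by ring.
  rewrite ler_piMr ?mulr_ge0 ?divr_ge0 ?(ltW e0)//.
  by rewrite ler_pdivrMr// mul1r ler_wpM2l// lerDl.
have -> : lin (compgrad g J) h = lin g eta - \sum_i g i * (eta 0 i - lin (J i) h).
  by rewrite lin_compgrad [lin g eta]/lin -sumrB; apply: eq_bigr => i _; ring.
rewrite (_ : _ - _ = (f (psi (x + h)) - f (psi x) - lin g eta) +
  \sum_i g i * (eta 0 i - lin (J i) h)); last by ring.
by rewrite (le_trans (ler_normD _ _))//; lra.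
Qed.

Lemma mvt_sym (phi dphi : R -> R) c :
  (forall t, `|t| <= `|c| -> is_derive t 1 phi (dphi t)) ->
  exists2 xi, `|xi| <= `|c| & phi c - phi 0 = dphi xi * c.
Proof.
move=> H.
have cont a b : (forall t, a <= t <= b -> `|t| <= `|c|) -> {within `[a, b], continuous phi}.
  move=> ab; apply: derivable_within_continuous => t; rewrite in_itv/= => /ab/H.
  by case.
have der a b : (forall t, a <= t <= b -> `|t| <= `|c|) ->
    forall t, t \in `]a, b[%R -> is_derive t 1 phi (dphi t).
  by move=> ab t; rewrite in_itv/= => /andP[ta tb]; apply/H/ab; rewrite !ltW.
have [c0|c0] := leP 0 c.
  have h t : 0 <= t <= c -> `|t| <= `|c|.
    by move=> /andP[t0 tc]; rewrite !ger0_norm.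
  have [xi] := MVT_segment c0 (der _ _ h) (cont _ _ h).
  by rewrite in_itv/= subr0 => /h ? ?; exists xi.
have h t : c <= t <= 0 -> `|t| <= `|c|.
  by move=> /andP[t0 tc]; rewrite !ler0_norm ?lerN2// ltW.
have [xi] := MVT_segment (ltW c0) (der _ _ h) (cont _ _ h).
rewrite in_itv/= => /h ? e; exists xi => //.
by rewrite -opprB e sub0r mulrN opprK.
Qed.

Lemma is_derive_line f y v t : derivable f (y + t *: v) v ->
  is_derive t 1 (fun s : R => f (y + s *: v)) ('D_v f (y + t *: v)).
Proof.
move=> fd.
have E : (fun h : R => h^-1 *: ((f \o shift (y + t *: v)) (h *: v) - f (y + t *: v))) =
   (fun h : R => h^-1 *: (((fun s : R => f (y + s *: v)) \o shift t) (h *: 1) -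
      (fun s : R => f (y + s *: v)) t)).
  apply/funext => h /=; congr (_ *: (f _ - _)).
  by rewrite [h%:A]mulr1 scalerDl addrCA.
apply: DeriveDef; first by rewrite /derivable -E.
by rewrite /derive -E.
Qed.

Lemma mvt_partial f y i c :
  (forall t, `|t| <= `|c| -> derivable f (y + t *: ei i) (ei i)) ->
  exists2 xi, `|xi| <= `|c| &
    f (y + c *: ei i) - f y = partial [:: i] f (y + xi *: ei i) * c.
Proof.
move=> fd; have [t tc|xi xic] := @mvt_sym (fun s => f (y + s *: ei i))
  (fun s => 'D_(ei i) f (y + s *: ei i)) c; first exact/is_derive_line/fd.
by rewrite scale0r addr0 => e; exists xi.
Qed.

Lemma frechet_of_partials f x :
  (\forall y \near x, forall i, derivable f y (ei i)) ->
  (forall i, {for x, continuous (partial [:: i] f)}) ->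
  frechet f x (fun i => partial [:: i] f x).
Proof.
move=> fd fc e e0.
have [r /= r0 rd] : exists2 r : R, 0 < r & forall y, `|y - x| < r ->
    forall i, derivable f y (ei i).
  move: fd => /nbhs_normP[r /= r0 rd]; exists r => // y yr.
  by apply: rd; rewrite /= distrC.
have eN : 0 < e / N by rewrite divr_gt0.
have [i|d d0 Hd] := @common_radius n.+1 (fun i h =>
  `|partial [:: i] f (x + h) - partial [:: i] f x| <= e / N).
  have /(@cvgrPdist_le _ _ _ (nbhs x))/(_ _ eN) := fc i.
  rewrite -nbhs_nbhs_norm => -[d /= d0 Hd]; exists (d / 2); first exact: divr_gt0.
  move=> h hd; rewrite distrC; apply: Hd => /=.
  by rewrite opprD addNKr normrN (le_lt_trans hd)// ltr_pdivrMr// ltr_pMr// ltr1n.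
exists (Num.min (r / 2) d); first by rewrite lt_min divr_gt0.
move=> h; rewrite le_min => /andP[hr hd].
(* [hk k] keeps the first [k] coordinates of [h], so consecutive points differ in one coordinate and
   the one-variable mean value theorem applies. *)
pose hk (k : nat) : V := \row_i (if (i < k)%N then h 0 i else 0).
have hk0 : hk 0%N = 0 by apply/rowP => i; rewrite !mxE.
have hkN : hk n.+1 = h by apply/rowP => i; rewrite !mxE ltn_ord.
have hkS (k : 'I_n.+1) : hk k.+1 = hk k + h 0 k *: ei k.
  apply/rowP => i; rewrite !mxE ltnS leq_eqVlt eqxx /=.
  have [<-|ik] := eqVneq i k; first by rewrite eqxx ltnn/= mulr1 add0r.
  have -> : (i == k :> nat) = false by apply/negbTE; exact: ik.
  by rewrite /= mulr0 addr0.
have hk_le k (t : R) (i : 'I_n.+1) : `|t| <= `|h 0 i| -> i = k :> nat -> `|hk k + t *: ei i| <= `|h|.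
  move=> ti ik; apply: norm_le_coord => // j; rewrite !mxE eqxx /=.
  have [->|ji] := eqVneq j i.
    by rewrite ik ltnn add0r mulr1 (le_trans ti)// coord_le_norm.
  by rewrite mulr0 addr0; case: ifP; rewrite ?normr0// coord_le_norm.
have tele : f (x + h) - f x = \sum_(k < n.+1) (f (x + hk k.+1) - f (x + hk k)).
  rewrite -{1}hkN -{2}[x]addr0 -hk0.
  by rewrite -(big_mkord xpredT (fun k => f (x + hk k.+1) - f (x + hk k))) telescope_sumr.
rewrite tele /lin -sumrB.
rewrite (_ : e * `|h| = N * (e / N * `|h|)); last by rewrite mulrA [N * _]mulrC divfK ?pnatr_eq0.
apply: ler_norm_sum_ord => k.
have ball_h y : `|y| <= `|h| -> forall i, derivable f (x + y) (ei i).
  move=> yh; apply: rd; rewrite addrAC subrr add0r (le_lt_trans yh)//.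
  by rewrite (le_lt_trans hr)// ltr_pdivrMr// ltr_pMr// ltr1n.
have [t tc|xi xic] := @mvt_partial f (x + hk k) k (h 0 k).
  by rewrite -addrA; apply: ball_h; exact: hk_le.
rewrite -addrA -hkS => ->; rewrite -mulrBl normrM ler_pM// ?coord_le_norm//.
rewrite -addrA; apply: Hd; rewrite (le_trans _ hd)//.
exact: hk_le.
Qed.

(** The second difference over a square of side [s] equals [s ^+ 2] times a mixed derivative at a
    nearby point, in either order of differentiation. Continuity at [x] then excludes a gap between
    the two derivatives. *)
Lemma schwarz f x i j (r : R) : 0 < r ->
  (forall y, `|y - x| < r -> forall k, derivable f y (ei k)) ->
  (forall y, `|y - x| < r -> forall k l, derivable (partial [:: k] f) y (ei l)) ->
  (forall k l, {for x, continuous (partial [:: k; l] f)}) ->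
  partial [:: i; j] f x = partial [:: j; i] f x.
Proof.
move=> r0 fd fdd fc.
have delta k l (s : R) : 0 < s -> s < r / 2 -> exists2 p, `|p - x| <= 2 * s &
    f (x + s *: ei k + s *: ei l) - f (x + s *: ei k) - f (x + s *: ei l) + f x =
    partial [:: l; k] f p * s ^+ 2.
  move=> s0 sr.
  have xuv (u v : V) : x + u + v - x = u + v by rewrite -(addrA x) (addrC x) addrK.
  have small a b : `|a| <= s -> `|b| <= s -> `|b *: ei l + a *: ei k| <= 2 * s.
    move=> a1 b1; rewrite (le_trans (ler_normD _ _))//.
    by rewrite !norm_scale_delta; lra.
  have inb a b : `|a| <= s -> `|b| <= s -> `|x + b *: ei l + a *: ei k - x| < r.
    move=> a1 b1; rewrite xuv.
    by rewrite (le_lt_trans (small _ _ a1 b1))//; lra.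
  have in0 a : `|a| <= s -> `|x + a *: ei k - x| < r.
    move=> a1; have := @inb a 0 a1; rewrite scale0r addr0; apply.
    by rewrite normr0 ltW.
  have ss : `|s| = s by rewrite gtr0_norm.
  pose G t := f (x + s *: ei l + t *: ei k) - f (x + t *: ei k).
  have [t|xi] := @mvt_sym G (fun t => partial [:: k] f (x + s *: ei l + t *: ei k)
      - partial [:: k] f (x + t *: ei k)) s.
    rewrite ss => ts; apply: is_deriveB; apply: is_derive_line; apply: fd.
      by apply: inb; rewrite ?ss.
    exact: in0.
  rewrite ss /G scale0r !addr0 => xis Ge.
  have inb' a b : `|a| <= s -> `|b| <= s -> `|x + a *: ei k + b *: ei l - x| < r.
    by move=> a1 b1; rewrite (addrAC x); apply: inb.
  have [t|eta] := @mvt_partial (partial [:: k] f) (x + xi *: ei k) l s.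
    by rewrite ss => ts; apply: fdd; exact: inb'.
  rewrite ss => etas Pe; exists (x + xi *: ei k + eta *: ei l).
    by rewrite xuv addrC small.
  by rewrite expr2 mulrA -Pe (addrAC x (xi *: ei k)) -Ge (addrAC x (s *: ei k)); ring.
have [//|ne] := eqVneq (partial [:: i; j] f x) (partial [:: j; i] f x).
set D := `|partial [:: i; j] f x - partial [:: j; i] f x|.
have D0 : 0 < D / 4 by rewrite divr_gt0// normr_gt0 subr_eq0.
have cont k l : exists2 d, 0 < d & forall y, `|y - x| < d ->
    `|partial [:: k; l] f y - partial [:: k; l] f x| <= D / 4.
  have /(@cvgrPdist_le _ _ _ (nbhs x))/(_ _ D0)/nbhs_normP[d /= d0 Hd] := fc k l.
  by exists d => // y yd; rewrite distrC; apply: Hd; rewrite /= distrC.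
have [d d0 Hd] := cont i j; have [d' d0' Hd'] := cont j i.
pose s := Num.min (r / 4) (Num.min (d / 4) (d' / 4)).
have s0 : 0 < s by rewrite !lt_min !divr_gt0.
have [sr [sd sd']] : s <= r / 4 /\ s <= d / 4 /\ s <= d' / 4.
  by rewrite /s !ge_min !lexx !orbT.
clearbody s; have sr2 : s < r / 2 by clear -sr r0; lra.
have [p px pE] := delta j i s s0 sr2; have [q qx qE] := delta i j s s0 sr2.
have pq : partial [:: i; j] f p = partial [:: j; i] f q.
  apply: (@mulIf _ (s ^+ 2)); first by rewrite gt_eqF// exprn_gt0.
  by rewrite -pE -qE (addrAC x (s *: ei j)); congr (_ + _); rewrite [LHS]addrAC.
have pd : `|p - x| < d by clear -px sd d0; lra.
have qd : `|q - x| < d' by clear -qx sd' d0'; lra.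
have h1 := Hd _ pd; have h2 := Hd' _ qd; rewrite distrC in h1.
suff DD : D <= D / 4 + D / 4 by exfalso; clearbody D; clear -D0 DD; lra.
  apply: le_trans (lerD h1 h2); apply: le_trans (ler_normD _ _).
  by rewrite pq addrA subrK.
Qed.

Definition segment_closed S := forall z w, S z -> S w -> forall t, 0 <= t <= 1 ->
  S (w + t *: (z - w)).

Lemma frechet_segment_bound F S (G : V -> 'I_n.+1 -> R) B z w :
  (forall t, 0 <= t <= 1 -> frechet F (w + t *: (z - w)) (G (w + t *: (z - w))) /\
    forall v, `|lin (G (w + t *: (z - w))) v| <= B * `|v|) ->
  `|F z - F w| <= B * `|z - w|.
Proof.
move=> H; pose phi t := F (w + t *: (z - w)).
have der t : 0 <= t <= 1 ->
    is_derive t 1 phi (lin (G (w + t *: (z - w))) (z - w)).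
  by move=> /H[? _]; exact: frechet_line.
have [|t||c] := @MVT_segment _ phi (fun t => lin (G (w + t *: (z - w))) (z - w)) 0 1.
- exact: ler01.
- by rewrite in_itv/= => /andP[t0 t1]; apply: der; rewrite !ltW.
- apply: derivable_within_continuous => t; rewrite in_itv/= => /der.
  by case.
rewrite in_itv/= => c01; rewrite /phi scale1r scale0r addr0 subr0 mulr1 [w + (z - w)]addrC subrK => ->.
by have [_] := H _ c01; apply.
Qed.

Lemma lin_compgrad_le g J h B L : (forall i, `|g i| <= B) ->
  (forall i k, `|J i k| <= L) -> `|lin (compgrad g J) h| <= N ^+ 2 * B * L * `|h|.
Proof.
move=> gB JL; rewrite lin_compgrad.
rewrite (_ : _ * `|h| = N * (B * (N * L * `|h|))); last by ring.
apply: ler_norm_sum_ord => i; rewrite normrM ler_pM//.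
exact: lin_le.
Qed.

(** The expansion is carried along [psi] of a segment of [S], a curve inside [O]. A straight segment
    between two points of a curved domain may leave it, whereas the upper half of a chart ball is
    convex. The mean value inequality is used twice: for the gradient minus its affine part, then
    for [f] minus its quadratic part. *)
Lemma taylor_along S (O : set V) f (g : V -> 'I_n.+1 -> R)
    (H : V -> 'I_n.+1 -> 'I_n.+1 -> R) (psi : V -> V)
    (J : V -> 'I_n.+1 -> 'I_n.+1 -> R) K L :
  0 <= K ->
  (forall y, O y -> frechet f y (g y)) ->
  (forall y, O y -> forall j, frechet (fun y => g y j) y (H y j)) ->
  (forall y, O y -> forall i j, H y i j = H y j i) ->
  segment_closed S -> (forall z, S z -> O (psi z)) ->
  (forall z, S z -> forall i, frechet (fun z => psi z 0 i) z (J z i)) ->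
  (forall z, S z -> forall i k, `|J z i k| <= L) ->
  (forall z w, S z -> S w -> forall i j,
    `|H (psi z) i j - H (psi w) i j| <= K * `|z - w| `^ alpha) ->
  forall z w, S z -> S w ->
    `|f (psi z) - f (psi w) - lin (g (psi w)) (psi z - psi w)
      - quad (fun i j => H (psi w) i j / 2) (psi z - psi w)|
    <= N ^+ 4 * L ^+ 2 * K * omega `|z - w|.
Proof.
move=> K0 fd gd Hsym Sseg SO psid JL HK z w Sz Sw.
have L0 : 0 <= L by apply: le_trans (JL _ Sz ord0 ord0).
have N0 : 0 <= N by [].
have seg_le t u v : 0 <= t <= 1 -> `|v + t *: (u - v) - v| <= `|u - v|.
  by move=> /andP[t0 t1]; rewrite addrAC subrr add0r normrZ ger0_norm// ler_piMl.
have step1 u j : S u ->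
    `|g (psi u) j - g (psi w) j - lin (H (psi w) j) (psi u - psi w)| <=
    N ^+ 2 * (K * `|u - w| `^ alpha) * L * `|u - w|.
  move=> Su.
  (* The zero quadratic part only brings the subtracted linear function into the form of
     [frechet_quad]. *)
  pose F y := g y j - (lin (H (psi w) j) (y - psi w) + quad (fun _ _ => 0) (y - psi w)).
  have -> : g (psi u) j - g (psi w) j - lin (H (psi w) j) (psi u - psi w) =
      F (psi u) - F (psi w).
    by rewrite /F !quad0 subrr lin_at0; ring.
  apply: (@frechet_segment_bound (fun z => F (psi z)) S (fun z => compgrad
    (fun i => H (psi z) j i - (H (psi w) j i + \sum_k (0 + 0) * (psi z - psi w) 0 k))
    (J z))) => t t01.
  have St := Sseg _ _ Su Sw _ t01; split.
    apply: frechet_comp; first by move=> i; exact: psid.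
    by apply: frechetB; [exact/gd/SO|exact: frechet_quad].
  move=> v; apply: lin_compgrad_le => [i|]; last exact: JL.
  rewrite big1 => [|k _]; last by rewrite addr0 mul0r.
  rewrite addr0.
  apply: (le_trans (HK _ _ St Sw _ _)); rewrite ler_wpM2l//.
  apply: (ge0_ler_powR (ltW alpha_gt0)); rewrite ?nnegrE//.
  exact: seg_le.
pose F y := f y - (lin (g (psi w)) (y - psi w)
  + quad (fun i j => H (psi w) i j / 2) (y - psi w)).
have -> : f (psi z) - f (psi w) - lin (g (psi w)) (psi z - psi w)
      - quad (fun i j => H (psi w) i j / 2) (psi z - psi w) =
    F (psi z) - F (psi w).
  by rewrite /F subrr lin_at0 quad_at0; ring.
rewrite (_ : _ * omega _ = N ^+ 2 * (N ^+ 2 * (K * `|z - w| `^ alpha) * L * `|z - w|) * L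
   * `|z - w|); last by rewrite /omega; ring.
apply: (@frechet_segment_bound (fun z => F (psi z)) S (fun z => compgrad
    (fun i => g (psi z) i - (g (psi w) i + \sum_k (H (psi w) i k / 2 +
       H (psi w) k i / 2) * (psi z - psi w) 0 k)) (J z))) => t t01.
have St := Sseg _ _ Sz Sw _ t01; split.
  apply: frechet_comp; first by move=> i; exact: psid.
  by apply: frechetB; [exact/fd/SO|exact: frechet_quad].
move=> v; apply: lin_compgrad_le => [i|]; last exact: JL.
have -> : \sum_k (H (psi w) i k / 2 + H (psi w) k i / 2) *
   (psi (w + t *: (z - w)) - psi w) 0 k =
   lin (H (psi w) i) (psi (w + t *: (z - w)) - psi w).
  apply: eq_bigr => k _; rewrite (Hsym _ (SO _ Sw) k i); congr (_ * _).
  by rewrite -splitr.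
rewrite opprD addrA; apply: (le_trans (step1 _ _ St)).
rewrite ler_pM ?seg_le//.
  by rewrite !mulr_ge0 ?sqr_ge0 ?powR_ge0.
rewrite ler_wpM2r// ler_wpM2l ?sqr_ge0// ler_wpM2l//.
apply: (ge0_ler_powR (ltW alpha_gt0)); rewrite ?nnegrE//.
exact: seg_le.
Qed.

End Frechet.

(** * From classical C^{2,alpha} bounds to expansions *)

Section Classical.
Context {R : realType} {n : nat} (alpha : R).
Context (alpha_gt0 : 0 < alpha) (alpha_lt1 : alpha < 1).
Local Notation V := 'rV[R]_n.+1.
Local Notation N := (n.+1%:R : R).
Local Notation jet := (@jet R n alpha).
Implicit Types (f : V -> R) (S O : set V) (x y h u v : V) (K L t r : R).

Lemma partial_cat (s t : seq 'I_n.+1) f : partial s (partial t f) = partial (s ++ t) f.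
Proof. by rewrite /partial foldr_cat. Qed.

Lemma Ck_partial k (t : seq 'I_n.+1) O f : Ck (k + size t) O f -> Ck k O (partial t f).
Proof.
move=> fk s; have [c d] := fk (s ++ t); rewrite partial_cat; split.
  by move=> sk; apply: c; rewrite size_cat leq_add2r.
by move=> sk; apply: d; rewrite size_cat ltn_add2r.
Qed.

Lemma CkW k k' O f : (k' <= k)%N -> Ck k O f -> Ck k' O f.
Proof.
move=> kk fk s; have [c d] := fk s; split=> sk.
  by apply: c; rewrite (leq_trans sk).
by apply: d; rewrite (leq_trans sk).
Qed.

Lemma open_ball_sub O x : open O -> O x -> exists2 r, 0 < r & forall y, `|y - x| < r -> O y.
Proof.
move=> oO Ox; have /nbhs_normP[r /= r0 rO] := open_nbhs_nbhs (conj oO Ox).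
by exists r => // y yr; apply: rO; rewrite /= distrC.
Qed.

Lemma Ck1_frechet O f x : open O -> Ck 1 O f -> O x ->
  frechet f x (fun i => partial [:: i] f x).
Proof.
move=> oO fk Ox; apply: frechet_of_partials => [|i].
  apply: filterS (open_nbhs_nbhs (conj oO Ox)) => y Oy i.
  by have [_] := fk [::]; apply.
by have [+ _] := fk [:: i]; apply.
Qed.

Lemma Ck2_frechet_partial O f x j : open O -> Ck 2 O f -> O x ->
  frechet (partial [:: j] f) x (fun i => partial [:: i; j] f x).
Proof.
move=> oO fk Ox; apply: (@Ck1_frechet O) => //.
exact: (@Ck_partial 1 [:: j]).
Qed.

Lemma Ck2_schwarz O f x i j : open O -> Ck 2 O f -> O x ->
  partial [:: i; j] f x = partial [:: j; i] f x.
Proof.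
move=> oO fk Ox; have [r r0 rO] := open_ball_sub oO Ox.
apply: (@schwarz _ _ f x i j r r0) => [y /rO Oy k|y /rO Oy k l|k l].
- by have [_] := fk [::]; apply.
- by have [_] := fk [:: k]; apply.
- by have [+ _] := fk [:: k; l]; apply.
Qed.

Lemma Ck2_frechet_partial_sym O f x j : open O -> Ck 2 O f -> O x ->
  frechet (fun y => partial [:: j] f y) x (fun i => partial [:: j; i] f x).
Proof.
move=> oO fk Ox.
have -> : (fun i => partial [:: j; i] f x) = (fun i => partial [:: i; j] f x).
  by apply/funext => i; exact: (Ck2_schwarz _ _ oO).
exact: (Ck2_frechet_partial j oO fk Ox).
Qed.

Lemma segment_closed_ball x r : segment_closed [set y | `|y - x| <= r].
Proof.
move=> z w /= zx wx t /andP[t0 t1].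
have -> : w + t *: (z - w) - x = t *: (z - x) + (1 - t) *: (w - x).
  by apply/rowP => i; rewrite !mxE; ring.
rewrite (le_trans (ler_normD _ _))// !normrZ !ger0_norm ?subr_ge0//.
have -> : r = t * r + (1 - t) * r by ring.
by rewrite lerD// ler_wpM2l// subr_ge0.
Qed.

(* The sup norm is used on both sides of the Hoelder condition. *)
Definition C2bnd O K f := (forall s x, (size s <= 2)%N -> O x -> `|partial s f x| <= K) /\
  (forall s x y, size s = 2 -> O x -> O y ->
    `|partial s f x - partial s f y| <= K * `|x - y| `^ alpha).

Lemma ball_jet O f x0 r K : open O -> [set x | `|x - x0| <= r] `<=` O -> Ck 2 O f ->
  C2bnd [set x | `|x - x0| <= r] K f ->
  forall x, `|x - x0| <= r -> jet [set x | `|x - x0| <= r] (N ^+ 4 * K) f x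
    (fun i => partial [:: i] f x) (fun i j => partial [:: i; j] f x / 2).
Proof.
move=> oO rO fk [fK fH] x xr.
have K0 : 0 <= K by apply: le_trans (fK [::] x isT xr).
have KN : K <= N ^+ 4 * K by rewrite ler_peMl// exprn_ege1// ler1n.
split=> [|i|i j|y yr yx].
- by rewrite (le_trans _ KN)// (fK [::]).
- by rewrite (le_trans _ KN)// (fK [:: i]).
- have := fK [:: i; j] x isT xr; rewrite normrM (@ger0_norm _ 2^-1)// => h.
  rewrite ler_pdivrMr//; lra.
have -> : N ^+ 4 * K = N ^+ 4 * 1 ^+ 2 * K by rewrite expr1n mulr1.
apply: (@taylor_along _ _ _ alpha_gt0 [set x | `|x - x0| <= r] O f
  (fun y i => partial [:: i] f y) (fun y i j => partial [:: i; j] f y) id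
  (fun _ i k => (i == k)%:R) K 1 K0).
- by move=> z /(Ck1_frechet oO); apply; exact: CkW fk.
- by move=> z Oz j; exact: Ck2_frechet_partial_sym Oz.
- by move=> z Oz i j; exact: Ck2_schwarz Oz.
- exact: segment_closed_ball.
- exact: rO.
- move=> z _ i e e0; exists 1 => // h _.
  have -> : lin (fun k => (i == k)%:R) h = h 0 i.
    rewrite /lin (bigD1 i)//= eqxx mul1r big1 ?addr0// => k ki.
    by rewrite eq_sym (negbTE ki) mul0r.
  by rewrite mxE -addrA -opprD subrr normr0 mulr_ge0// ltW.
- by move=> z _ i k; case: eqP; rewrite ?normr1 ?normr0.
- by move=> z w zr wr i j; exact: fH.
- exact: yr.
- exact: xr.
Qed.

Lemma enorm_powR_le h : enorm h `^ alpha <= N * `|h| `^ alpha.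
Proof.
apply: (@le_trans _ _ ((N * `|h|) `^ alpha)).
  by apply: (ge0_ler_powR (ltW alpha_gt0)); rewrite ?nnegrE ?sqrtr_ge0 ?mulr_ge0 ?enorm_le_norm.
by rewrite powRM// ler_wpM2r ?powR_ge0// ler1_powR// ?ler1n// ltW.
Qed.

Lemma locally_bounded f x : {for x, continuous f} -> exists2 r, 0 < r &
  forall y, `|y - x| <= r -> `|f y| <= `|f x| + 1.
Proof.
move=> /(@cvgrPdist_le _ _ _ (nbhs x))/(_ _ ltr01)/nbhs_normP[d /= d0 Hd].
exists (d / 2); first exact: divr_gt0.
move=> y yd; have : `|f x - f y| <= 1.
  by apply: Hd => /=; rewrite distrC (le_lt_trans yd)// ltr_pdivrMr// ltr_pMr// ltr1n.
by move=> h; rewrite -(subKr (f x) (f y)) (le_trans (ler_normB _ _))// lerD2l.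
Qed.

Lemma common_shrink m (P : 'I_m -> R -> Prop) :
  (forall i r r', 0 < r' -> r' <= r -> P i r -> P i r') ->
  (forall i, exists2 r, 0 < r & P i r) -> exists2 r, 0 < r & forall i, P i r.
Proof.
move=> Pshrink H.
have /choice[d Hd] : forall i, exists d : R, 0 < d /\ P i d.
  by move=> i; have [d ? ?] := H i; exists d.
have d0 : 0 < \big[Num.min/1]_i d i.
  by apply/bigmin_gtP; split => // i _; case: (Hd i).
exists (\big[Num.min/1]_i d i) => // i; have [_] := Hd i.
by apply: Pshrink => //; exact: bigmin_le.
Qed.

(** For each order there are finitely many tuples of directions, so local bounds for single
    derivatives have a common radius and a common constant. *)
Lemma partials_locally_bounded k O f x : open O -> Ck k O f -> O x ->
  exists2 r, 0 < r & [set y | `|y - x| <= r] `<=` O /\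
  exists K, forall s y, (size s <= k)%N -> `|y - x| <= r -> `|partial s f y| <= K.
Proof.
move=> oO fk Ox.
suff : exists2 r, 0 < r & [set y | `|y - x| <= r] `<=` O /\
    forall m : 'I_k.+1, exists K, forall s y, size s = m -> `|y - x| <= r ->
    `|partial s f y| <= K.
  move=> [r r0 [rO /choice[K HK]]]; exists r => //; split => //.
  exists (\big[Num.max/0]_i K i) => s y sk yr.
  have := HK (Ordinal (sk : (size s < k.+1)%N)) s y erefl yr.
  by move=> /le_trans; apply; exact: le_bigmax.
have [r0 r00 r0O] := open_ball_sub oO Ox.
have [||r rr0 H] := @common_shrink k.+1 (fun m r => exists K, forall s y, size s = m ->
    `|y - x| <= r -> `|partial s f y| <= K).
- move=> m r r' _ rr [K HK]; exists K => s y sm yr; apply: HK => //.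
  exact: le_trans rr.
- move=> m.
  pose P (t : m.-tuple 'I_n.+1) := fun r => forall y, `|y - x| <= r ->
    `|partial t f y| <= `|partial t f x| + 1.
  have [||r rr0 H] := @common_shrink #|{: m.-tuple 'I_n.+1}| (fun i => P (enum_val i)).
  + by move=> i r r' _ rr + y yr; apply; exact: le_trans rr.
  + move=> i; apply: locally_bounded; have [+ _] := fk (enum_val i); apply => //.
    by rewrite size_tuple -ltnS.
  exists r => //; exists (\sum_(t : m.-tuple 'I_n.+1) (`|partial t f x| + 1)) => s y sm yr.
  have Hs : size s == m by rewrite sm.
  have := H (enum_rank (Tuple Hs)) y yr; rewrite enum_rankK /= => /le_trans; apply.
  by rewrite (bigD1 (Tuple Hs))//= lerDl sumr_ge0.
exists (Num.min r (r0 / 2)); first by rewrite lt_min rr0 divr_gt0.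
split=> [y /=|m].
  rewrite le_min => /andP[_ yr]; apply: r0O; rewrite (le_lt_trans yr)//.
  by rewrite ltr_pdivrMr// ltr_pMr// ltr1n.
by have [K HK] := H m; exists K => s y sm; rewrite le_min => /andP[? _]; exact: HK.
Qed.

Lemma C2bndS O O' K f : O' `<=` O -> C2bnd O K f -> C2bnd O' K f.
Proof.
move=> OO [fK fH]; split=> [s x s2 /OO|s x y s2 /OO Ox /OO]; first exact: fK.
exact: fH.
Qed.

(** The Hoelder bound for second derivatives comes from bounded third derivatives; the radius [1/2]
    keeps distances below 1, where [t <= t^alpha]. *)
Lemma Ck3_C2bnd O f x : open O -> Ck 3 O f -> O x -> exists2 r, 0 < r &
  [set y | `|y - x| <= r] `<=` O /\ exists K, C2bnd [set y | `|y - x| <= r] K f.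
Proof.
move=> oO fk Ox; have [r r0 [rO [K HK]]] := partials_locally_bounded oO fk Ox.
have K0 : 0 <= K by rewrite (le_trans _ (HK [::] x isT _))// subrr normr0 ltW.
exists (Num.min r (1/2)); first by rewrite lt_min r0/=.
have rr y : `|y - x| <= Num.min r (1/2) -> `|y - x| <= r /\ `|y - x| <= 1/2.
  by rewrite le_min => /andP[].
split=> [y /= /rr[? _]|]; first exact: rO.
exists (N * K + K); split=> [s y s2 /= /rr[yr _]|s y z s2 /= /rr[yr y2] /rr[zr z2]].
  by rewrite (le_trans (HK _ _ _ yr)) ?(leq_trans s2)// lerDr mulr_ge0.
have fs u : O u -> frechet (partial s f) u (fun i => partial [:: i] (partial s f) u).
  by apply: Ck1_frechet => //; apply: Ck_partial; rewrite s2.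
have yz1 : `|y - z| <= 1.
  have := ler_normD (y - x) (x - z); rewrite subrKA (distrC x z) => /le_trans.
  by apply; clear -y2 z2; lra.
have : `|partial s f y - partial s f z| <= N * K * `|y - z|.
  apply: (@frechet_segment_bound _ _ _ O (fun u i => partial [:: i] (partial s f) u)).
  move=> t t01; have Bt := segment_closed_ball yr zr t01.
  split; first exact/fs/rO.
  move=> v; apply: lin_le => i; rewrite partial_cat; apply: HK => //.
  by rewrite size_cat s2.
move/le_trans; apply; apply: ler_pM; rewrite ?mulr_ge0 ?lerDl//.
have [->|yz] := eqVneq (y - z) 0; first by rewrite normr0 powR_ge0.
by rewrite ger1_powR ?normr_gt0 ?yz//= ltW.
Qed.

Lemma Ckalpha_open_C2bnd O f x : open O -> Ckalpha_open 2 alpha O f -> O x ->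
  exists2 r, 0 < r &
  [set y | `|y - x| <= r] `<=` O /\ exists K, C2bnd [set y | `|y - x| <= r] K f.
Proof.
move=> oO [fk fH] Ox; have [r r0 [rO [K HK]]] := partials_locally_bounded oO fk Ox.
have K0 : 0 <= K by rewrite (le_trans _ (HK [::] x isT _))// subrr normr0 ltW.
pose P (t : 2.-tuple 'I_n.+1) := fun r => exists2 M, 0 <= M & forall y z,
  O y -> O z -> `|y - x| <= r -> `|z - x| <= r ->
  `|partial t f y - partial t f z| <= M * `|y - z| `^ alpha.
have [||r' rr0 H] := @common_shrink #|{: 2.-tuple 'I_n.+1}| (fun i => P (enum_val i)).
- move=> i a a' _ aa [M M0 HM]; exists M => // y z Oy Oz ya za; apply: HM => //.
    exact: le_trans aa.
  exact: le_trans aa.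
- move=> i; have [W /nbhs_normP[d /= d0 dW] [M HM]] := fH (enum_val i) (size_tuple _) _ Ox.
  exists (d / 2); first exact: divr_gt0.
  exists (`|M| * N); first by rewrite mulr_ge0.
  have WP y : `|y - x| <= d / 2 -> W y.
    move=> yd; apply: dW; rewrite /= distrC (le_lt_trans yd)//.
    by rewrite ltr_pdivrMr// ltr_pMr// ltr1n.
  move=> y z Oy Oz /WP Wy /WP Wz; apply: (le_trans (HM _ _ (conj Oy Wy) (conj Oz Wz))).
  apply: (@le_trans _ _ (`|M| * enorm (y - z) `^ alpha)).
    by rewrite ler_wpM2r ?powR_ge0// ler_norm.
  by rewrite -mulrA ler_wpM2l// enorm_powR_le.
exists (Num.min r r'); first by rewrite lt_min r0.
split=> [y /=|]; first by rewrite le_min => /andP[? _]; exact: rO.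
have /choice[M HM] : forall t : 2.-tuple 'I_n.+1, exists M, 0 <= M /\ forall y z,
  O y -> O z -> `|y - x| <= r' -> `|z - x| <= r' ->
  `|partial t f y - partial t f z| <= M * `|y - z| `^ alpha.
  by move=> t; have [M M0 HM] := H (enum_rank t); exists M; rewrite enum_rankK in HM.
have M0 (t : 2.-tuple 'I_n.+1) : 0 <= M t by case: (HM t).
exists (K + \sum_t M t); split.
  move=> s y s2 /=; rewrite le_min => /andP[yr _].
  by rewrite (le_trans (HK _ _ s2 yr))// lerDl sumr_ge0.
move=> s y z s2 /=; rewrite !le_min => /andP[yr yr'] /andP[zr zr'].
have Hs : size s == 2 by rewrite s2.
have [_ /(_ y z)] := HM (Tuple Hs); move/(_ (rO _ yr) (rO _ zr) yr' zr')/le_trans; apply.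
rewrite ler_wpM2r ?powR_ge0// (bigD1 (Tuple Hs))//= addrCA lerDl addr_ge0// sumr_ge0//.
Qed.

End Classical.

(** * Values of the continuous extension at interior points *)

Section ContinuousExtension.
Context {R : realType} {n : nat}.
Local Notation V := 'rV[R]_n.+1.
Implicit Types (f : V -> R) (Omega : set V).

Lemma cext_in Omega f x : Omega x -> {for x, continuous f} -> cext Omega f x = f x.
Proof.
move=> Ox fx; have P : ProperFilter (within Omega (nbhs x)).
  by apply: within_nbhs_proper; exact: subset_closure.
by apply: cvg_lim => //; apply: cvg_within_filter.
Qed.

Lemma cvg_sum_ord {T : Type} (F : set_system T) {FF : Filter F} m (G : 'I_m -> T -> R)
    (l : 'I_m -> R) : (forall i, G i @ F --> l i) ->
  (fun x => \sum_i G i x) @ F --> \sum_i l i.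
Proof.
move=> Gl; have H (s : seq 'I_m) : (fun x => \sum_(i <- s) G i x) @ F --> \sum_(i <- s) l i.
  elim: s => [|i s IH].
    by under eq_fun do rewrite big_nil; rewrite big_nil; exact: cvg_cst.
  under eq_fun do rewrite big_cons; rewrite big_cons.
  by apply: cvgD; [exact: Gl|exact: IH].
exact: H.
Qed.

End ContinuousExtension.

(** * Expansions up to the boundary in a chart *)

Section Chart.
Context {R : realType} {n : nat} (alpha : R).
Context (alpha_gt0 : 0 < alpha) (alpha_lt1 : alpha < 1).
Local Notation V := 'rV[R]_n.+1.
Local Notation N := (n.+1%:R : R).
Local Notation omega := (@omega R alpha).
Local Notation jet := (@jet R n alpha).
Local Notation C2bnd := (@C2bnd R n alpha).
Local Notation en := (delta_mx 0 ord_max : V).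
Implicit Types (z w : V) (f u : V -> R) (K : R).
Context (Omega : set V) (psi : V -> V) (p : V) (r L : R)
  (J : V -> 'I_n.+1 -> 'I_n.+1 -> R).

(** The map [psi] is differentiable on the full ball, but only its upper half is sent into the
    domain. [chart_inv] allows remainders in [|z - w|] to be rewritten in terms of
    [|psi z - psi w|]. *)
Record chart := Chart {
  chart_open : open Omega;
  chart_r0 : 0 < r;
  chart_L1 : 1 <= L;
  chart_frechet : forall z, `|z - p| <= r ->
    forall i, frechet (fun y => psi y 0 i) z (J z i);
  chart_J : forall z, `|z - p| <= r -> forall i k, `|J z i k| <= L;
  chart_in : forall z, `|z - p| <= r -> 0 < z 0 ord_max -> Omega (psi z);
  chart_cl : forall z, `|z - p| <= r -> 0 <= z 0 ord_max -> closure Omega (psi z);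
  chart_inv : forall z w, `|z - p| <= r -> `|w - p| <= r ->
    `|z - w| <= L * `|psi z - psi w|
}.

Context (ch : chart).

Definition halfcube (rho : R) := [set z : V | `|z - p| <= rho /\ 0 <= z 0 ord_max].

Lemma chart_lip z w : `|z - p| <= r -> `|w - p| <= r ->
  `|psi z - psi w| <= N * L * `|z - w|.
Proof.
move=> zp wp; have L0 : 0 <= L by rewrite (le_trans _ (chart_L1 ch)).
apply: norm_le_coord => [|i]; first by rewrite !mulr_ge0.
rewrite !mxE; apply: (@frechet_segment_bound _ _ (fun z => psi z 0 i) setT (fun z => J z i)).
move=> t t01; have B := segment_closed_ball zp wp t01.
split; first exact: chart_frechet.
by move=> v; apply: lin_le => k; exact: chart_J.
Qed.

Lemma shift_in z (e : R) : `|z - p| <= r / 2 -> `|e| <= r / 2 -> `|z + e *: en - p| <= r.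
Proof.
move=> zp er; rewrite addrAC (le_trans (ler_normD _ _))// norm_scale_delta.
by rewrite [leRHS]splitr lerD.
Qed.

Lemma shift_coord z (e : R) : (z + e *: en) 0 ord_max = z 0 ord_max + e.
Proof. by rewrite !mxE !eqxx mulr1. Qed.

(** Boundary values are approached by moving upwards in the chart, a path that enters the domain
    from every point of the half ball. *)
Lemma shift_cvg (G : V -> R) z : {within closure Omega, continuous G} ->
  halfcube (r / 2) z -> (fun e : R => G (psi (z + e *: en))) @ 0^'+ --> G (psi z).
Proof.
move=> Gc [zp z0]; have r0 := chart_r0 ch; have L0 : 0 < L by rewrite (lt_le_trans _ (chart_L1 ch)).
have zr : `|z - p| <= r by rewrite (le_trans zp)// ler_pdivrMr// ler_pMr// ler1n.
have clz := chart_cl ch zr z0.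
have /subspace_continuousP/(_ _ clz) Gz := Gc.
have NL : 0 < N * L by rewrite mulr_gt0.
apply/cvgrPdist_lt => e e0.
have /(@cvgrPdist_lt _ _ _ (within (closure Omega) (nbhs (psi z))))/(_ _ e0) := Gz.
rewrite /within/= => /nbhs_normP[d /= d0 Hd].
near=> t.
have t0 : 0 < t by near: t; exact: nbhs_right_gt.
have tr : t <= r / 2 by near: t; apply: nbhs_right_le; rewrite divr_gt0.
have td : t < d / (N * L) by near: t; apply: nbhs_right_lt; rewrite divr_gt0.
have tin : `|z + t *: en - p| <= r by apply: shift_in; rewrite ?gtr0_norm.
apply: Hd => /=.
  rewrite (le_lt_trans (chart_lip zr tin))//.
  rewrite opprD addNKr normrN norm_scale_delta gtr0_norm//.
  by rewrite mulrC -ltr_pdivlMr.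
by apply: chart_cl => //; rewrite shift_coord addr_ge0// ltW.
Unshelve. all: by end_near. Qed.

Lemma shift_bound (F : R -> R) l B : F @ 0^'+ --> l ->
  (forall e, 0 < e -> e <= r / 2 -> `|F e| <= B) -> `|l| <= B.
Proof.
move=> Fl FB; apply: (cvgr_to_le (cvg_norm Fl)); near=> t.
apply: FB; first by near: t; exact: nbhs_right_gt.
by near: t; apply: nbhs_right_le; rewrite divr_gt0// chart_r0.
Unshelve. all: by end_near. Qed.

Lemma shift_cvg_sub z w i : halfcube (r / 2) z -> halfcube (r / 2) w ->
  (fun e : R => (psi (z + e *: en) - psi (w + e *: en)) 0 i) @ 0^'+ -->
    (psi z - psi w) 0 i.
Proof.
move=> zh wh.
have c : {within closure Omega, continuous (fun x : V => x 0 i)}.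
  apply: continuous_subspaceT; exact: coord_continuous.
rewrite !mxE; under eq_fun do rewrite !mxE.
by apply: cvgB; [exact: (shift_cvg c zh)|exact: (shift_cvg c wh)].
Qed.

(** [N ^+ 5 * L ^+ 3] is the constant of [chart_taylor]; another [L ^+ 3] is the price of
    [|z - w| <= L * |psi z - psi w|] inside [omega]. *)
Definition traceC : R := N ^+ 5 * L ^+ 6.

Lemma chart_taylor u K : Ck 2 Omega u -> C2bnd Omega K u ->
  forall z w, `|z - p| <= r -> `|w - p| <= r -> 0 < z 0 ord_max -> 0 < w 0 ord_max ->
  `|u (psi z) - u (psi w) - lin (fun i => partial [:: i] u (psi w)) (psi z - psi w)
    - quad (fun i j => partial [:: i; j] u (psi w) / 2) (psi z - psi w)|
  <= N ^+ 5 * L ^+ 3 * K * omega `|z - w|.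
Proof.
move=> uk [uK uH] z w zr wr z0 w0.
have K0 : 0 <= K by rewrite (le_trans _ (uK [::] _ isT (chart_in ch zr z0))).
have L0 : 0 <= L by rewrite (le_trans _ (chart_L1 ch)).
have oO := chart_open ch.
pose S := [set z : V | `|z - p| <= r /\ 0 < z 0 ord_max].
have NL1 : 1 <= N * L.
  by rewrite -[leLHS]mulr1 ler_pM ?ler1n// chart_L1.
have -> : N ^+ 5 * L ^+ 3 * K = N ^+ 4 * L ^+ 2 * (N * L * K) by ring.
apply: (@taylor_along _ _ _ alpha_gt0 S Omega u
  (fun y i => partial [:: i] u y) (fun y i j => partial [:: i; j] u y) psi J (N * L * K) L).
- by rewrite !mulr_ge0.
- by move=> y /(Ck1_frechet oO); apply; exact: CkW uk.
- by move=> y Oy j; exact: (Ck2_frechet_partial_sym j oO uk Oy).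
- by move=> y Oy i j; exact: (Ck2_schwarz i j oO uk Oy).
- move=> a b [/= ar a0] [/= br b0] t t01; split=> /=.
    exact: segment_closed_ball ar br _ t01.
  rewrite !mxE; move: t01 => /andP[t0 t1].
  have [->|tn] := eqVneq t 0; first by rewrite mul0r addr0.
  have : 0 < t * a 0 ord_max by rewrite mulr_gt0// lt_neqAle eq_sym tn.
  have : 0 <= (1 - t) * b 0 ord_max by rewrite mulr_ge0 ?subr_ge0// ltW.
  by move=> h1 h2; have := ltr_wpDl h1 h2; congr (_ < _); ring.
- by move=> y [yr y0]; exact: chart_in.
- by move=> y [yr y0]; exact: chart_frechet.
- by move=> y [yr y0]; exact: chart_J.
- move=> a b [/= ar a0] [/= br b0] i j.
  apply: (le_trans (uH [:: i; j] _ _ erefl (chart_in ch ar a0) (chart_in ch br b0))).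
  rewrite [leRHS]mulrAC [leRHS]mulrC ler_wpM2l//.
  apply: (@le_trans _ _ ((N * L * `|a - b|) `^ alpha)).
    apply: (ge0_ler_powR (ltW alpha_gt0)); rewrite ?nnegrE ?mulr_ge0//.
    exact: chart_lip.
  by rewrite powRM ?mulr_ge0// ler_wpM2r ?powR_ge0// ler1_powR// ltW.
- by [].
- by [].
Qed.

(** Derivatives are only available in the open domain. Both points are shifted upwards by the same
    [e]: this leaves [z - w], hence the remainder, unchanged, and all other terms converge as [e]
    tends to 0. *)
Lemma trace_jet u K : Ckalpha 2 alpha Omega u -> C2bnd Omega K u ->
  forall w, halfcube (r / 2) w ->
  jet (psi @` halfcube (r / 2)) (traceC * K) u (psi w)
    (fun i => cext Omega (partial [:: i] u) (psi w))
    (fun i j => cext Omega (partial [:: i; j] u) (psi w) / 2).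
Proof.
move=> [uk uc uext _] uB w wh; have r0 := chart_r0 ch.
have [uK uH] := uB.
have L1 := chart_L1 ch; have L0 : 0 <= L by rewrite (le_trans _ L1).
have N1 : 1 <= N by rewrite ler1n.
have hin z e : halfcube (r / 2) z -> 0 < e -> e <= r / 2 ->
    `|z + e *: en - p| <= r /\ 0 < (z + e *: en) 0 ord_max.
  move=> [zp z0] e0 er; split; first by rewrite shift_in// gtr0_norm.
  by rewrite shift_coord ltr_wpDl.
have hO z e : halfcube (r / 2) z -> 0 < e -> e <= r / 2 -> Omega (psi (z + e *: en)).
  by move=> zh e0 er; have [? ?] := hin z e zh e0 er; exact: chart_in.
have r20 : 0 < r / 2 by rewrite divr_gt0.
have K0 : 0 <= K by rewrite (le_trans _ (uK [::] _ isT (hO w _ wh r20 (lexx _)))).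
have C1 : 1 <= traceC.
  by rewrite /traceC -[leLHS]mulr1 ler_pM// exprn_ege1.
have KC : K <= traceC * K by rewrite ler_peMl.
have cextO s x : (size s <= 2)%N -> Omega x -> cext Omega (partial s u) x = partial s u x.
  by move=> s2 Ox; apply: cext_in => //; have [+ _] := uk s; apply.
have ext_cvg s z : (size s <= 2)%N -> halfcube (r / 2) z ->
  (fun e : R => cext Omega (partial s u) (psi (z + e *: en))) @ 0^'+ -->
    cext Omega (partial s u) (psi z).
  by move=> s2 zh; apply: shift_cvg => //; exact: uext.
have ext_le s : (size s <= 2)%N -> `|cext Omega (partial s u) (psi w)| <= K.
  move=> s2; apply: (shift_bound (ext_cvg s w s2 wh)) => e e0 er.
  by rewrite cextO//; [apply: uK => //|]; exact: hO.
split=> [|i|i j|_ [z zh <-] _].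
- rewrite (le_trans _ KC)//; apply: (shift_bound (shift_cvg uc wh)) => e e0 er.
  by apply: (uK [::]) => //; exact: hO.
- by rewrite (le_trans _ KC)// ext_le.
- rewrite normrM (@ger0_norm _ 2^-1)// ler_pdivrMr// (le_trans (ext_le _ _))//.
  by rewrite (le_trans KC)// ler_peMr ?ler1n// (le_trans K0).
have half_r x : halfcube (r / 2) x -> `|x - p| <= r.
  by move=> [xp _]; rewrite (le_trans xp)// ler_pdivrMr// ler_pMr// ler1n.
apply: (@le_trans _ _ (N ^+ 5 * L ^+ 3 * K * omega `|z - w|)); last first.
  rewrite (_ : traceC * K * _ = N ^+ 5 * L ^+ 3 * K * (L ^+ 3 * omega `|psi z - psi w|));
    last by rewrite /traceC; ring.
  rewrite ler_wpM2l ?mulr_ge0 ?exprn_ge0//.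
  apply: (le_trans _ (omegaM_le alpha_lt1 L1 (normr_ge0 _))).
  by apply: (le_omega alpha_gt0); rewrite normr_ge0 (chart_inv ch)//; exact: half_r.
apply: (@shift_bound (fun e : R => u (psi (z + e *: en)) - u (psi (w + e *: en)) -
  lin (fun i => cext Omega (partial [:: i] u) (psi (w + e *: en)))
    (psi (z + e *: en) - psi (w + e *: en)) -
  quad (fun i j => cext Omega (partial [:: i; j] u) (psi (w + e *: en)) / 2)
    (psi (z + e *: en) - psi (w + e *: en)))).
  apply: cvgB; first apply: cvgB; first by apply: cvgB; exact: shift_cvg.
    apply: cvg_sum_ord => i; apply: cvgM; first exact: ext_cvg.
    exact: shift_cvg_sub.
  apply: cvg_sum_ord => i; apply: cvg_sum_ord => j.
  apply: cvgM; last exact: shift_cvg_sub.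
  apply: cvgM; last exact: shift_cvg_sub.
  by apply: cvgM; [exact: ext_cvg|exact: cvg_cst].
move=> e e0 er; have [zr z0] := hin z e zh e0 er; have [wr w0] := hin w e wh e0 er.
have := chart_taylor uk uB zr wr z0 w0.
rewrite (_ : z + e *: en - (w + e *: en) = z - w); last first.
  by rewrite opprD addrACA subrr addr0.
congr (`| _ - _ - _ | <= _).
  by apply: eq_bigr => i _; rewrite cextO//; exact: hO.
by apply: eq_bigr => i _; apply: eq_bigr => j _; rewrite cextO//; exact: hO.
Qed.

End Chart.

(** * The bent odd reflection in the half space *)

Section Reflection.
Context {R : realType} {n : nat} (alpha : R).
Context (alpha_gt0 : 0 < alpha) (alpha_lt1 : alpha < 1).
Local Notation V := 'rV[R]_n.+1.
Local Notation N := (n.+1%:R : R).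
Local Notation cN := (@cN R n).
Local Notation omega := (@omega R alpha).
Local Notation jet := (@jet R n alpha).
Local Notation C2a := (@C2a R n alpha).
Local Notation C2ex := (@C2ex R n alpha).
Local Notation en := (delta_mx 0 ord_max : V).
Local Notation last z := ((z : V) 0 ord_max).
Implicit Types (x y z w h v : V) (f u : V -> R) (K : R).
Implicit Types (g : 'I_n.+1 -> R) (H : 'I_n.+1 -> 'I_n.+1 -> R).

Lemma order2_zero (a b K d : R) : 0 < d ->
  (forall t, 0 < t -> t <= d -> `|a * t + b * t ^+ 2| <= K * omega t) -> a = 0 /\ b = 0.
Proof.
move=> d0 H.
have K0 : 0 <= K.
  have := H _ d0 (lexx _) => /(le_trans (normr_ge0 _)).
  by rewrite pmulr_lge0// /(omega _) mulr_gt0 ?exprn_gt0 ?powR_gt0.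
have a0 : a = 0.
  apply/eqP; rewrite -normr_le0 leNgt; apply/negP => a0.
  have bK : 0 < `|b| + K + 1 by rewrite ltr_wpDl// addr_ge0.
  (* Small enough that [(|b| + K) * t < |a| / 2], contradicting the bound [|a| <= (|b| + K) * t]
     obtained after dividing by [t]. *)
  pose t := Num.min (Num.min d 1) (`|a| / 2 / (`|b| + K + 1)).
  have t0 : 0 < t by rewrite !lt_min d0 ltr01 !divr_gt0.
  have [td [t1 tb]] : t <= d /\ t <= 1 /\ t <= `|a| / 2 / (`|b| + K + 1).
    by rewrite /t !ge_min !lexx !orbT.
  clearbody t; move: tb; rewrite ler_pdivlMr// => tb.
  have := H t t0 td.
  have o := omega_le alpha_gt0 (_ : 0 <= t <= 1); rewrite (ltW t0) t1 in o.
  have {}o := o isT.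
  have -> : a * t + b * t ^+ 2 = a * t - (- b * t ^+ 2) by ring.
  have := lerB_dist (a * t) (- b * t ^+ 2); rewrite !normrM normrN (gtr0_norm t0).
  rewrite -expr2 => h1 /(le_trans h1) h2.
  have h3 : `|a| * t <= (`|b| + K) * t ^+ 2.
    have := ler_wpM2l K0 o; clear -h2; rewrite mulrDl.
    by move: (`|a| * t) (`|b| * t ^+ 2) (K * omega t) (K * t ^+ 2) h2 => *; lra.
  have h4 : `|a| <= (`|b| + K) * t.
    by rewrite -(ler_pM2r t0) (le_trans h3)// -mulrA -expr2.
  have h5 : t * (`|b| + K + 1) = (`|b| + K) * t + t by ring.
  rewrite h5 in tb; clear -tb h4 t0 a0.
  by move: (`|a|) ((`|b| + K) * t) a0 h4 tb => *; lra.
split => //; apply/eqP; rewrite -normr_le0 leNgt; apply/negP => b0.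
have K1 : 0 < K + 1 by rewrite ltr_wpDl.
have [e e0 He] := powR_small alpha_gt0 (divr_gt0 (divr_gt0 b0 (ltr0Sn R 1)) K1).
have t0 : 0 < Num.min d e by rewrite lt_min d0.
have := H _ t0; rewrite ge_min lexx => /(_ isT).
have := He (Num.min d e); rewrite (ltW t0) ge_min lexx orbT => /(_ isT).
move: (Num.min d e) t0 => t t0.
rewrite a0 mul0r add0r normrM normrX (gtr0_norm t0) ler_pdivlMr// => h1 h2.
have h3 : `|b| <= K * t `^ alpha.
  by rewrite -(ler_pM2r (exprn_gt0 2 t0)) (le_trans h2)// /(omega _) mulrA mulrAC.
have P0 := powR_ge0 t alpha; move: (t `^ alpha) h1 h3 P0 => P h1 h3 P0.
have e1 : P * (K + 1) = K * P + P by ring.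
rewrite e1 in h1; lra.
Qed.

Lemma normrM_le (a b A A' : R) : `|a| <= A -> `|b| <= A' -> `|a * b| <= A * A'.
Proof. by move=> aA bA; rewrite normrM ler_pM. Qed.

Lemma quad_bil H h : quad H h = bil H h h / 2.
Proof.
have := quadDr H h h; rewrite -mulr2n -scaler_nat quadZr => e.
apply: (@mulIf _ 2); first by rewrite pnatr_eq0.
rewrite divfK ?pnatr_eq0//; move: e; move: (quad H h) (bil H h h) => a b; lra.
Qed.

Context (p : V) (p0 : last p = 0).
Local Notation half rho := (halfcube p rho).

(** Since [u] vanishes on the hyperplane, [order2_zero] makes both [lin g] and [quad H] vanish on
    tangential vectors. The Taylor polynomial is thus divisible by the normal coordinate, and the
    right-hand side displays the quotient. *)
Lemma boundary_taylor (r K : R) u w g H : 0 < r -> jet (half r) K u w g H ->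
  `|w - p| <= r / 2 -> last w = 0 ->
  (forall z, `|z - p| <= r -> last z = 0 -> u z = 0) ->
  forall h, lin g h + quad H h =
    last h * (g ord_max + \sum_i (H i ord_max + H ord_max i) * h 0 i
      - H ord_max ord_max * last h).
Proof.
move=> r0 Jw; have K0 := jet_ge0 Jw; case: Jw => _ _ _ e wp w0 u0 h.
have flat v : last v = 0 -> lin g v = 0 /\ quad H v = 0.
  move=> v0; have v1 : 0 < `|v| + 1 by rewrite ltr_wpDl.
  have d0 : 0 < Num.min (r / 2) 1 / (`|v| + 1).
    by rewrite divr_gt0// lt_min ltr01 divr_gt0.
  apply: (@order2_zero _ _ (K * (`|v| + 1) ^+ 3) _ d0) => t t0 td.
  have tv : `|t *: v| <= t * (`|v| + 1).
    by rewrite normrZ gtr0_norm// ler_wpM2l ?(ltW t0)// lerDl.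
  have tm : t * (`|v| + 1) <= Num.min (r / 2) 1 by rewrite -ler_pdivlMr.
  have [tr t1] : `|t *: v| <= r / 2 /\ `|t *: v| <= 1.
    by move: tm; rewrite le_min => /andP[/(le_trans tv) ? /(le_trans tv)].
  have wt : last (w + t *: v) = 0 by rewrite !mxE w0 v0 mulr0 addr0.
  have wr : `|w + t *: v - p| <= r.
    by rewrite addrAC (le_trans (ler_normD _ _))// [leRHS]splitr lerD.
  have := e (w + t *: v); rewrite addrAC subrr add0r u0// u0//; last first.
    by rewrite (le_trans wp)// ler_pdivrMr// ler_pMr// ler1n.
  rewrite subrr sub0r linZr quadZr => /(_ _ t1) h1.
  rewrite (_ : `|_ + _| = `|- (t * lin g v) - t ^+ 2 * quad H v|); last first.
    by rewrite -[LHS]normrN; congr `|_|; ring.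
  apply: (le_trans (h1 _)); first by split => //; rewrite wt.
  rewrite -mulrA ler_wpM2l//.
  have v11 : 1 <= `|v| + 1 by rewrite lerDr.
  apply: (le_trans _ (omegaM_le alpha_lt1 v11 (ltW t0))).
  by apply: (le_omega alpha_gt0); rewrite normr_ge0 mulrC.
pose h' := h - last h *: en.
have h'0 : last h' = 0 by rewrite !mxE !eqxx mulr1 subrr.
have [l0 q0] := flat _ h'0.
have hE : h = h' + last h *: en by rewrite subrK.
rewrite {1 2}hE linDr quadDr l0 q0 lin_delta quadZr bilZr bil_delta.
have -> : quad H en = H ord_max ord_max.
  by rewrite quad_bil bil_delta2 mulrDl -splitr.
have -> : \sum_i (H i ord_max + H ord_max i) * h' 0 i =
    \sum_i (H i ord_max + H ord_max i) * h 0 i - 2 * H ord_max ord_max * last h.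
  rewrite (eq_bigr (fun i => (H i ord_max + H ord_max i) * h 0 i -
     last h * ((H i ord_max + H ord_max i) * en 0 i))).
    rewrite sumrB; congr (_ - _); rewrite -mulr_sumr -bil_delta bil_delta2; ring.
  by move=> i _; rewrite !mxE; ring.
ring.
Qed.

Section ReflectionMap.
Context (r : R) (r0 : 0 < r) (r12 : r <= 1 / 2).
Context (m : V -> 'I_n.+1 -> R) (f : V -> R) (B : R) (B1 : 1 <= B).
Context (mB : forall i, C2a (half r) B (fun z => m z i)).
Context (fB : C2a (half r) B f).
Context (m_last : forall z, half r z -> m z ord_max = -2).

Definition mirror z : V := z - (2 * last z) *: en.

(* m and f are only regular on the upper half, hence are evaluated at the mirror image. *)
Definition bent_reflection z : V :=
  z + last z *: (\row_i m (mirror z) i) + (last z ^+ 2 * f (mirror z)) *: en.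

Lemma mirror_coord z i : mirror z 0 i = if i == ord_max then - last z else z 0 i.
Proof.
rewrite !mxE eqxx /=; case: eqP => [->|_]; first by rewrite mulr1; ring.
by rewrite mulr0 subr0.
Qed.

Lemma mirror_le z w : `|mirror z - mirror w| <= `|z - w|.
Proof.
apply: norm_le_coord => // i; rewrite !mxE -/(mirror z 0 i).
have := mirror_coord z i; have := mirror_coord w i; rewrite !mxE => -> ->.
have := coord_le_norm (z - w) i; rewrite !mxE; case: eqP => // -> h.
by rewrite -opprB opprK opprB addrC distrC in h *.
Qed.

Lemma mirror_fix w : last w = 0 -> mirror w = w.
Proof. by move=> w0; rewrite /mirror w0 mulr0 scale0r subr0. Qed.

Lemma mirror_half z rho : `|z - p| <= rho -> last z <= 0 -> half rho (mirror z).
Proof.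
move=> zp z0; split; last by rewrite mirror_coord eqxx oppr_ge0.
by rewrite -(mirror_fix p0) (le_trans (mirror_le _ _)).
Qed.

Lemma reflect_coord z i : bent_reflection z 0 i = z 0 i + last z * m (mirror z) i
  + last z ^+ 2 * f (mirror z) * (i == ord_max)%:R.
Proof. by rewrite !mxE eqxx. Qed.

Local Notation lower rho := [set z : V | `|z - p| <= rho /\ last z <= 0].

Lemma m_le z i : `|z - p| <= r -> last z <= 0 -> `|m (mirror z) i| <= B.
Proof. by move=> zp z0; have [g [H []]] := mB i (mirror_half zp z0). Qed.

Lemma f_le z : `|z - p| <= r -> last z <= 0 -> `|f (mirror z)| <= B.
Proof. by move=> zp z0; have [g [H []]] := fB (mirror_half zp z0). Qed.

Lemma reflect_diff z w : `|z - p| <= r -> last z <= 0 -> last w = 0 ->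
  `|z - w| <= 1 -> `|bent_reflection z - w| <= (1 + 2 * B) * `|z - w|.
Proof.
move=> zp z0 w0 zw1; have B0 : 0 <= B by rewrite (le_trans _ B1).
have hz : `|last z| <= `|z - w|.
  by have := coord_le_norm (z - w) ord_max; rewrite !mxE w0 subr0.
apply: norm_le_coord => [|i]; first by rewrite mulr_ge0// addr_ge0// mulr_ge0.
have -> : (bent_reflection z - w) 0 i = (z - w) 0 i + last z * m (mirror z) i
    + last z * (last z * f (mirror z) * (i == ord_max)%:R).
  rewrite [LHS]mxE reflect_coord !mxE; ring.
have -> : (1 + 2 * B) * `|z - w| = `|z - w| + `|z - w| * B + `|z - w| * B by ring.
apply: (le_trans (ler_normD _ _)); apply: lerD.
  apply: (le_trans (ler_normD _ _)); apply: lerD; first exact: coord_le_norm.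
  by rewrite normrM ler_pM// m_le.
rewrite normrM ler_pM// !normrM -[leRHS]mulr1 ler_pM ?mulr_ge0//; last first.
  by case: eqP; rewrite ?normr1 ?normr0.
by rewrite -[leRHS]mul1r ler_pM ?f_le// (le_trans hz).
Qed.

(** The factor [1 + 2 * B] bounds how far the reflection can move a point away from [p]. The
    smallness also gives [safe_radius * B <= 1], so the new normal coordinate
    [- z_n * (1 - z_n * f)] keeps the sign of [- z_n]. *)
Definition safe_radius : R := r / (2 * (1 + 2 * B)).

Lemma safe_radius_bound : [/\ 0 < safe_radius, safe_radius <= r / 2, (1 + 2 * B) * safe_radius <= r & safe_radius * B <= 1].
Proof.
have B0 : 0 < 1 + 2 * B by rewrite ltr_wpDr// mulr_ge0// (le_trans _ B1).
have rr0 : 0 < safe_radius by rewrite divr_gt0// mulr_gt0.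
have e : 2 * (1 + 2 * B) * safe_radius = r.
  by rewrite /safe_radius mulrC divfK// gt_eqF// mulr_gt0.
have Brr : 0 <= B * safe_radius by rewrite mulr_ge0 ?ltW// (lt_le_trans _ B1).
have e' : 2 * safe_radius + 4 * (B * safe_radius) = r by rewrite -[RHS]e; ring.
split => //.
- by rewrite ler_pdivlMr//; lra.
- have -> : (1 + 2 * B) * safe_radius = safe_radius + 2 * (B * safe_radius) by ring.
  lra.
- have -> : safe_radius * B = B * safe_radius by exact: mulrC.
  apply: (@le_trans _ _ r); last by rewrite (le_trans r12)//; lra.
  lra.
Qed.

Lemma reflect_half z : `|z - p| <= safe_radius -> last z <= 0 -> half r (bent_reflection z).
Proof.
move=> zp z0; have [rr0 rrr Brr rrB] := safe_radius_bound.
have zr : `|z - p| <= r.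
  by rewrite (le_trans zp)// (le_trans rrr)// ler_pdivrMr// ler_pMr// ler1n.
split.
  have z1 : `|z - p| <= 1 by rewrite (le_trans zr)// (le_trans r12)//; lra.
  rewrite (le_trans (reflect_diff zr z0 p0 z1))// (le_trans _ Brr)//.
  by rewrite ler_wpM2l// addr_ge0// mulr_ge0// (le_trans _ B1).
rewrite reflect_coord eqxx mulr1 m_last; last exact: mirror_half.
have -> : last z + last z * -2 + last z ^+ 2 * f (mirror z) =
  (- last z) * (1 - last z * f (mirror z)) by ring.
rewrite mulr_ge0 ?oppr_ge0// subr_ge0.
have hz : `|last z| <= safe_radius.
  rewrite (le_trans _ zp)//.
  by have := coord_le_norm (z - p) ord_max; rewrite !mxE p0 subr0.
rewrite (le_trans (ler_norm _))// normrM (le_trans _ rrB)// ler_pM//.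
exact: f_le.
Qed.

Lemma C2ex_flip (F : V -> R) K : C2a (half r) K F -> C2ex (lower r) (fun z => F (mirror z)).
Proof.
move=> FK.
have lowB z : lower r z -> `|z| <= `|p| + r.
  move=> [zp _]; rewrite -(subrK p z) addrC (le_trans (ler_normD _ _))// lerD2l.
  exact: zp.
have /choice[Ki HKi] : forall i, exists K, C2a (lower r) K (fun z => mirror z 0 i).
  move=> i; have [->|ni] := eqVneq i ord_max.
    have : C2ex (lower r) (fun z => -1 * last z) by apply: C2exZ; exact: C2ex_coord lowB.
    by case=> K' H'; exists K'; apply: eq_C2a H' => z _; rewrite mirror_coord eqxx mulN1r.
  have [K' H'] := @C2ex_coord _ _ alpha (lower r) i _ lowB.
  by exists K'; apply: eq_C2a H' => z _; rewrite mirror_coord (negbTE ni).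
pose L := \big[Num.max/1]_i Ki i.
have L1 : 1 <= L by exact: bigmax_ge_id.
eexists; apply: (C2a_comp alpha_gt0 alpha_lt1 L1 (S' := half r)).
- by move=> z [zp z0]; exact: mirror_half.
- by move=> z w _ _ zw; rewrite (le_trans (mirror_le _ _)).
- by move=> i; apply: C2aW (HKi i) => //; exact: le_bigmax.
- exact: FK.
Qed.

Lemma C2ex_reflect : exists2 L, 1 <= L &
  forall i, C2a (lower safe_radius) L (fun z => bent_reflection z 0 i).
Proof.
have [rr0 rrr _ _] := safe_radius_bound.
have rrr' : safe_radius <= r by rewrite (le_trans rrr)// ler_pdivrMr// ler_pMr// ler1n.
have lowB z : lower r z -> `|z| <= `|p| + r.
  move=> [zp _]; rewrite -(subrK p z) addrC (le_trans (ler_normD _ _))// lerD2l.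
  exact: zp.
have C i : C2ex (lower r) (fun z => z 0 i) by exact: C2ex_coord lowB.
have /choice[Ki HKi] : forall i, exists K, C2a (lower r) K (fun z => bent_reflection z 0 i).
  move=> i; apply: (@eq_C2ex _ _ _ _ (fun z => z 0 i + last z * m (mirror z) i +
     last z * last z * f (mirror z) * (i == ord_max)%:R)).
    by move=> z _; rewrite reflect_coord expr2.
  apply: C2exD; first by apply: C2exD => //; apply: C2exM => //; exact: C2ex_flip (mB i).
  apply: C2exM => //; last exact: C2ex_cst.
  by apply: C2exM => //; [exact: C2exM|exact: C2ex_flip fB].
exists (\big[Num.max/1]_i Ki i); first exact: bigmax_ge_id.
move=> i; apply: C2aW (HKi i); last exact: le_bigmax.
by move=> z [zp z0]; split => //; exact: le_trans rrr'.
Qed.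

Definition reflected u z := if 0 <= last z then u z else - u (bent_reflection z).

(* The relation under which u and - (u \o bent_reflection) have the same 2-jet at w. *)
Definition boundary_jets u K := forall w, `|w - p| <= r -> last w = 0 -> u w = 0 /\
  exists g H, jet (half r) K u w g H /\
   g ord_max * f w - 2 * H ord_max ord_max
     - \sum_i (H i ord_max + H ord_max i) * m w i = 0.

(** The first summand comes from the remainder of [u] at the reflected point. The others bound cubic
    errors: the variation of [f], the variation of [m], the product of [f] with the pure normal
    coefficient, and the correction [z_n ^+ 2 * f] multiplied by the first-order terms of the
    quotient. *)
Definition reflectC : R := (1 + 2 * B) ^+ 3 + 2 * cN * B + 4 * N * cN * B + B
  + B * (2 * N + 2 * N * B + 1 + B).

(** By [boundary_taylor] the polynomials at [y - w] and at the reflected increment are normal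
    coordinates times affine functions. In their sum the lower-order terms cancel because [m] has
    last entry -2, and the coefficient of [hn ^+ 2] frozen at [w] is exactly the expression assumed
    to vanish. *)
Lemma jet_reflected u K w g H : jet (half r) K u w g H ->
  (forall z, `|z - p| <= r -> last z = 0 -> u z = 0) ->
  g ord_max * f w - 2 * H ord_max ord_max
     - \sum_i (H i ord_max + H ord_max i) * m w i = 0 ->
  `|w - p| <= safe_radius -> last w = 0 -> forall y, lower safe_radius y -> `|y - w| <= 1 ->
  `|- u (bent_reflection y) - lin g (y - w) - quad H (y - w)| <=
    reflectC * K * omega `|y - w|.
Proof.
move=> Jw u0 pde wp w0 y [yp y0] yw1.
have B0 : 0 <= B by rewrite (le_trans _ B1).
have [rr0 rrr Brr rrB] := safe_radius_bound.
have K0 := jet_ge0 Jw; have [_ gK HK e] := Jw.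
have rr2 : r / 2 <= r by rewrite ler_pdivrMr// ler_pMr// ler1n.
have yr : `|y - p| <= r by rewrite (le_trans yp)// (le_trans rrr).
have wr2 : `|w - p| <= r / 2 by rewrite (le_trans wp).
have wr : `|w - p| <= r by rewrite (le_trans wr2).
set t := `|y - w| in yw1 *; have t0 : 0 <= t := normr_ge0 _.
have t01 : 0 <= t <= 1 by rewrite t0 yw1.
have w3 := cube_le_omega alpha_lt1 t01.
have om0 := omega_ge0 alpha t.
have hy := reflect_half yp y0.
have h'le : `|bent_reflection y - w| <= (1 + 2 * B) * t by apply: reflect_diff.
have h'1 : `|bent_reflection y - w| <= 1.
  have := ler_normD (bent_reflection y - p) (p - w); rewrite subrKA (distrC p).
  case: hy => hy _ /le_trans; apply; rewrite (le_trans (lerD hy wr))//.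
  by rewrite -mulr2n -mulr_natr -ler_pdivlMr.
have E1 : `|u (bent_reflection y) - u w - lin g (bent_reflection y - w) - quad H (bent_reflection y - w)|
    <= K * ((1 + 2 * B) ^+ 3 * omega t).
  apply: (le_trans (e _ hy h'1)); rewrite ler_wpM2l//.
  have l1 : 1 <= 1 + 2 * B by rewrite lerDl mulr_ge0.
  apply: (le_trans _ (omegaM_le alpha_lt1 l1 t0)).
  by apply: (le_omega alpha_gt0); rewrite normr_ge0.
rewrite (u0 w)// subr0 in E1.
set fy := f (mirror y); set hn := last y.
have lh : last (y - w) = hn by rewrite !mxE w0 subr0.
have rl : last (bent_reflection y) = - hn + hn ^+ 2 * fy.
  rewrite reflect_coord eqxx mulr1 m_last; last exact: mirror_half.
  by rewrite -/fy -/hn; ring.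
have lh' : last (bent_reflection y - w) = - hn + hn ^+ 2 * fy.
  by rewrite [LHS]mxE [(- w) 0 ord_max]mxE w0 oppr0 addr0.
have T := boundary_taylor r0 Jw wr2 w0 u0.
have Th := T (y - w); have Th' := T (bent_reflection y - w); rewrite lh in Th; rewrite lh' in Th'.
pose sg i := H i ord_max + H ord_max i.
set gn := g ord_max in pde Th Th'; set c := H ord_max ord_max in pde Th Th'.
set X := \sum_i _ * (y - w) 0 i in Th.
set Sw := \sum_i _ * m w i in pde.
pose Sm := \sum_i sg i * m (mirror y) i.
have X' : \sum_i (H i ord_max + H ord_max i) * (bent_reflection y - w) 0 i =
    X + hn * Sm + 2 * c * (hn ^+ 2 * fy).
  rewrite (eq_bigr (fun i => (H i ord_max + H ord_max i) * (y - w) 0 i +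
    hn * (sg i * m (mirror y) i) + hn ^+ 2 * fy * (sg i * (i == ord_max)%:R))).
    rewrite !big_split /= -!mulr_sumr -/X -/Sm; congr (_ + _).
    rewrite (bigD1 ord_max)//= eqxx mulr1 big1 => [|i ni]; last by rewrite (negbTE ni) mulr0.
    by rewrite addr0 /sg -/c; ring.
  move=> i _; rewrite mxE reflect_coord -/hn -/fy [(- w) 0 i]mxE [(y - w) 0 i]mxE [(- w) 0 i]mxE.
  by rewrite /sg; ring.
rewrite X' in Th'.
(* After inserting [pde], only the differences of [f] and [m] between [mirror y] and [w], and
   explicitly cubic terms, are left. *)
have P : lin g (bent_reflection y - w) + quad H (bent_reflection y - w) + (lin g (y - w) + quad H (y - w)) =
   hn ^+ 2 * ((fy - f w) * gn) - hn ^+ 2 * (Sm - Sw) - c * fy * hn ^+ 3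
   + hn ^+ 2 * fy * (X + hn * Sm + c * hn + c * hn ^+ 2 * fy).
  have -> : hn ^+ 2 * (Sm - Sw) = hn ^+ 2 * (Sm - Sw - (gn * f w - 2 * c - Sw)).
    by rewrite pde subr0.
  by rewrite Th Th'; ring.
have hnt : `|hn| <= t by rewrite -lh; exact: coord_le_norm.
have hn2 : `|hn ^+ 2| <= t ^+ 2 by rewrite normrX lerXn2r ?nnegrE.
have hn3 : `|hn ^+ 3| <= t ^+ 3 by rewrite normrX lerXn2r ?nnegrE.
have fyB : `|fy| <= B by apply: f_le.
have cK : `|c| <= K by apply: HK.
have flipy : half r (mirror y) by apply: mirror_half.
have hw : half r w by split => //; rewrite w0.
have flw : `|mirror y - w| <= t by rewrite -{1}(mirror_fix w0); exact: mirror_le.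
have flw1 : `|mirror y - w| <= 1 by rewrite (le_trans flw).
have c0 : 0 <= cN by rewrite (le_trans _ (@cN_ge1 R n)).
have dlip (F : V -> R) : C2a (half r) B F -> `|F (mirror y) - F w| <= 2 * cN * B * t.
  move=> FB; have [g1 [H1 J1]] := FB _ hw.
  apply: (le_trans (jet_lip alpha_gt0 J1 flipy flw1)).
  by rewrite ler_wpM2l// !mulr_ge0.
have sgK i : `|sg i| <= 2 * K.
  by rewrite (le_trans (ler_normD _ _))// (_ : 2 * K = K + K) ?lerD//; ring.
have b1 : `|hn ^+ 2 * ((fy - f w) * gn)| <= t ^+ 2 * (2 * cN * B * t * K).
  by apply: normrM_le => //; apply: normrM_le; [exact: (dlip _ fB)|exact: gK].
have b2 : `|hn ^+ 2 * (Sm - Sw)| <= t ^+ 2 * (N * (2 * K * (2 * cN * B * t))).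
  apply: normrM_le => //; rewrite /Sm /Sw -sumrB.
  apply: ler_norm_sum_ord => i; rewrite -mulrBr; apply: normrM_le; first exact: sgK.
  exact: (dlip _ (mB i)).
have b3 : `|c * fy * hn ^+ 3| <= K * B * t ^+ 3.
  by apply: normrM_le => //; apply: normrM_le.
have XK : `|X| <= N * (2 * K * t).
  apply: ler_norm_sum_ord => i; rewrite normrM; apply: ler_pM => //.
    exact: sgK.
  exact: coord_le_norm.
have SmK : `|Sm| <= N * (2 * K * B).
  apply: ler_norm_sum_ord => i; rewrite normrM; apply: ler_pM => //.
  exact: m_le.
have b4 : `|hn ^+ 2 * fy * (X + hn * Sm + c * hn + c * hn ^+ 2 * fy)| <=
    t ^+ 2 * B * (N * (2 * K * t) + t * (N * (2 * K * B)) + K * t + K * t * B).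
  apply: normrM_le => //; first by apply: normrM_le.
  apply: (le_trans (ler_normD _ _)); apply: lerD.
    apply: (le_trans (ler_normD _ _)); apply: lerD.
      apply: (le_trans (ler_normD _ _)); apply: lerD => //.
      by apply: normrM_le.
    by apply: normrM_le.
  apply: normrM_le => //; apply: normrM_le => //.
  by rewrite (le_trans hn2)// expr2 ler_piMl.
rewrite (_ : - u (bent_reflection y) - lin g (y - w) - quad H (y - w) =
  - (u (bent_reflection y) - lin g (bent_reflection y - w) - quad H (bent_reflection y - w))
  - (lin g (bent_reflection y - w) + quad H (bent_reflection y - w) + (lin g (y - w) + quad H (y - w))));
  last by ring.
rewrite P (le_trans (ler_normB _ _))// normrN.
have b5 : `|hn ^+ 2 * ((fy - f w) * gn) - hn ^+ 2 * (Sm - Sw) - c * fy * hn ^+ 3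
   + hn ^+ 2 * fy * (X + hn * Sm + c * hn + c * hn ^+ 2 * fy)| <=
   (reflectC - (1 + 2 * B) ^+ 3) * K * t ^+ 3.
  apply: (le_trans (ler_normD _ _)); apply: (le_trans (lerD (ler_normB _ _) b4)).
  apply: (le_trans (lerD (lerD (ler_normB _ _) b3) (lexx _))).
  apply: (le_trans (lerD (lerD (lerD b1 b2) (lexx _)) (lexx _))).
  by rewrite le_eqVlt; apply/orP; left; apply/eqP; rewrite /reflectC; ring.
rewrite (_ : reflectC * K * omega t = K * ((1 + 2 * B) ^+ 3 * omega t) +
  (reflectC - (1 + 2 * B) ^+ 3) * K * omega t); last by ring.
apply: lerD => //; apply: (le_trans b5); rewrite ler_wpM2l//.
rewrite mulr_ge0// /reflectC.
rewrite (_ : _ - _ = 2 * cN * B + 4 * N * cN * B + B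
  + B * (2 * N + 2 * N * B + 1 + B)); last by ring.
by rewrite !(addr_ge0, mulr_ge0).
Qed.

Lemma C2a_reflected : exists2 C, 0 <= C & forall u K, C2a (half r) K u ->
  boundary_jets u K -> C2a [set z | `|z - p| <= safe_radius / 10] (C * K) (reflected u).
Proof.
have B0 : 0 <= B by rewrite (le_trans _ B1).
have [L L1 HL] := C2ex_reflect; have [rr0 rrr Brr rrB] := safe_radius_bound.
have rr2 : r / 2 <= r by rewrite ler_pdivrMr// ler_pMr// ler1n.
have rrr' : safe_radius <= r by rewrite (le_trans rrr).
have c0 : 0 <= cN by rewrite (le_trans _ (@cN_ge1 R n)).
have rC : 1 <= reflectC.
  rewrite /reflectC -!addrA; apply: ler_wpDr.
    by rewrite !(addr_ge0, mulr_ge0).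
  by rewrite exprn_ege1// lerDl mulr_ge0.
have cC : 0 <= @compC R n L 
  by rewrite /compC; apply: mulr_ge0; [apply: mulr_ge0 => //|]; apply: exprn_ge0 => //; apply: le_trans L1.
exists (379 * (@compC R n L + reflectC)); first by rewrite mulr_ge0// addr_ge0// (le_trans _ rC).
move=> u K uK uJ; rewrite -(mulrA 379).
have u0 z : `|z - p| <= r -> last z = 0 -> u z = 0 by move=> zr /(uJ z zr)[].
have K0 : 0 <= K.
  have [||_ [g [H [J _]]]] := uJ p; rewrite ?subrr ?normr0 ?(ltW r0)//.
  exact: jet_ge0 J.
have KC : K <= (@compC R n L + reflectC) * K.
  by rewrite ler_peMl// (le_trans rC)// lerDr.
have SK : C2a (lower safe_radius) (@compC R n L * K) (fun z => u (bent_reflection z)).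
  apply: (C2a_comp alpha_gt0 alpha_lt1 L1 (S' := half r)) => //.
  - by move=> z [zp z0]; exact: reflect_half.
  - move=> z w [zp z0] [wp w0'] _.
    have [zh _] := reflect_half zp z0; have [wh _] := reflect_half wp w0'.
    have := ler_normD (bent_reflection w - p) (p - bent_reflection z); rewrite subrKA (distrC p).
    move/le_trans; apply; rewrite (le_trans (lerD wh zh))//.
    by rewrite -mulr2n -mulr_natr -ler_pdivlMr.
have s1 : [set z : V | `|z - p| <= safe_radius /\ 0 <= 1 * last z] `<=` half r.
  by move=> z [zr]; rewrite mul1r => ?; split => //; exact: le_trans rrr'.
have s2 : [set z : V | `|z - p| <= safe_radius /\ 0 <= -1 * last z] `<=` lower safe_radius.
  by move=> z [zr]; rewrite mulN1r oppr_ge0.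
apply: (C2a_glue alpha_gt0 alpha_lt1) => //.
- by rewrite (le_trans rrr')// (le_trans r12)//; lra.
- exact: C2aW uK.
- have := @C2aZ _ _ _ _ _ _ (-1) SK; rewrite normrN1 mul1r => S1.
  have {}S1 : C2a (lower safe_radius) (@compC R n L * K) (fun z => - u (bent_reflection z)).
    by apply: eq_C2a S1 => z _; rewrite mulN1r.
  by apply: C2aW S1 => //; rewrite ler_wpM2r// lerDl (le_trans _ rC).
- move=> w wp w0; have wr := le_trans wp rrr'.
  have [uw [g [H [Jw pde]]]] := uJ w wr w0.
  have rw : bent_reflection w = w by rewrite /bent_reflection w0 scale0r addr0 expr0n mul0r scale0r addr0.
  rewrite rw uw oppr0; split => //; exists g, H; split; first exact: jetW Jw.
  have [_ gK HK _] := Jw; split => [|i|i j|y /s2 yl yw].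
  + by rewrite rw uw oppr0 normr0 (le_trans K0).
  + exact: le_trans KC.
  + exact: le_trans KC.
  + rewrite rw uw oppr0 subr0.
    apply: (le_trans (jet_reflected Jw u0 pde wp w0 yl yw)).
    by rewrite ler_wpM2r ?omega_ge0// ler_wpM2r// lerDr.
Qed.

End ReflectionMap.

End Reflection.

(** * Quantitative properties of a boundary chart *)

Section BoundaryChart.
Context {R : realType} {n : nat} (alpha : R).
Context (alpha_gt0 : 0 < alpha) (alpha_lt1 : alpha < 1).
Local Notation V := 'rV[R]_n.+1.
Local Notation N := (n.+1%:R : R).
Local Notation jet := (@jet R n alpha).
Local Notation C2ex := (@C2ex R n alpha).
Local Notation C2bnd := (@C2bnd R n alpha).
Local Notation last z := ((z : V) 0 ord_max).
Implicit Types (x y z w h v : V) (u : V -> R) (K r : R).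

Lemma common_shrink_fin (I : finType) (P : I -> R -> Prop) :
  (forall i r r', 0 < r' -> r' <= r -> P i r -> P i r') ->
  (forall i, exists2 r, 0 < r & P i r) -> exists2 r, 0 < r & forall i, P i r.
Proof.
move=> Ps H; have [||r r0 Hr] := @common_shrink _ #|I| (fun k => P (enum_val k)).
- by move=> k r r'; exact: Ps.
- by move=> k; exact: H.
by exists r => // i; have := Hr (enum_rank i); rewrite enum_rankK.
Qed.

Lemma ballS x r r' : r' <= r -> [set y : V | `|y - x| <= r'] `<=` [set y | `|y - x| <= r].
Proof. by move=> rr y /= /le_trans; apply. Qed.

Lemma C2bnd_C2ex O f x r K : open O -> [set y : V | `|y - x| <= r] `<=` O -> Ck 2 O f ->
  C2bnd [set y | `|y - x| <= r] K f -> C2ex [set y | `|y - x| <= r] f.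
Proof.
move=> oO rO fk fB; exists (N ^+ 4 * K) => y yr; eexists; eexists.
exact: (ball_jet alpha_gt0 oO rO fk fB).
Qed.

Lemma Ck3_C2ex O f x : open O -> Ck 3 O f -> O x ->
  exists2 r, 0 < r & C2ex [set y | `|y - x| <= r] f.
Proof.
move=> oO fk Ox; have [r r0 [rO [K HK]]] := Ck3_C2bnd alpha_lt1 oO fk Ox.
by exists r => //; apply: (C2bnd_C2ex oO rO _ HK); exact: CkW fk.
Qed.

Lemma Ckalpha_open_C2ex O f x : open O -> Ckalpha_open 2 alpha O f -> O x ->
  exists2 r, 0 < r & C2ex [set y | `|y - x| <= r] f.
Proof.
move=> oO fk Ox; have [r r0 [rO [K HK]]] := Ckalpha_open_C2bnd alpha_gt0 alpha_lt1 oO fk Ox.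
by exists r => //; apply: (C2bnd_C2ex oO rO _ HK); case: fk.
Qed.

Lemma Ckalpha_open_partial k (t : seq 'I_n.+1) O f :
  Ckalpha_open (k + size t) alpha O f -> Ckalpha_open k alpha O (partial t f).
Proof.
move=> [fk fH]; split; first exact: Ck_partial.
move=> s sk x Ox; have [|W Wx HW] := fH (s ++ t) _ x Ox; first by rewrite size_cat sk.
by exists W => //; rewrite partial_cat.
Qed.

Lemma frechet_unique f x g g' : frechet f x g -> frechet f x g' -> g = g'.
Proof.
move=> fg fg'; apply/funext => i.
by have [_ <-] := frechet_partial i fg; have [_ <-] := frechet_partial i fg'.
Qed.

Lemma frechet_near f f' x g d : 0 < d -> (forall y, `|y - x| <= d -> f y = f' y) ->
  frechet f x g -> frechet f' x g.
Proof.
move=> d0 ff fg e e0; have [d' d0' H] := fg e e0.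
exists (Num.min d d'); first by rewrite lt_min d0.
move=> h; rewrite le_min => /andP[hd hd'].
by rewrite -!ff ?H// ?subrr ?normr0 ?(ltW d0)// addrAC subrr add0r.
Qed.

Lemma frechet_coord x k : frechet (fun y : V => y 0 k) x (fun i => (k == i)%:R).
Proof.
move=> e e0; exists 1 => // h _.
have -> : lin (fun i => (k == i)%:R) h = h 0 k.
  rewrite /lin (bigD1 k)//= eqxx mul1r big1 ?addr0// => i ki.
  by rewrite eq_sym (negbTE ki) mul0r.
by rewrite mxE -addrA -opprD subrr normr0 mulr_ge0// ltW.
Qed.

Context (Omega W U : set V) (psi phi : V -> V) (x0 : V).

(** A smooth domain provides charts near [x0] without the normalisation [psi 0 = x0]; the base point
    is therefore [phi x0], known only to lie on the hyperplane. *)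
Record boundary_chart := BoundaryChart {
  bc_O : open Omega;
  bc_W : open W;
  bc_x0 : W x0;
  bc_U : open U;
  bc_psiW : forall z, U z -> W (psi z);
  bc_phiU : forall y, W y -> U (phi y);
  bc_psiK : forall z, U z -> phi (psi z) = z;
  bc_phiK : forall y, W y -> psi (phi y) = y;
  bc_psi : forall i, Ckalpha_open 4 alpha U (fun z => psi z 0 i);
  bc_phi : forall i, Ckalpha_open 4 alpha W (fun z => phi z 0 i);
  bc_in : forall z, U z -> Omega (psi z) <-> 0 < last z;
  bc_cl : forall z, U z -> closure Omega (psi z) <-> 0 <= last z;
  bc_bd : forall z, U z -> boundary Omega (psi z) <-> last z = 0;
  bc_p : last (phi x0) = 0
}.

Context (bc : boundary_chart).
Local Notation p := (phi x0).

Definition Jac z (i k : 'I_n.+1) : R := partial [:: k] (fun y => psi y 0 i) z.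
(** Evaluated at [psi z], so that the Jacobian of the inverse is a function of the flat variable. *)
Definition iJac z (k i : 'I_n.+1) : R := partial [:: i] (fun y => phi y 0 k) (psi z).

Lemma bc_psi_frechet z i : U z -> frechet (fun y => psi y 0 i) z (Jac z i).
Proof.
move=> Uz; apply: (Ck1_frechet (bc_U bc)) => //.
by have [+ _] := bc_psi bc i; exact: CkW.
Qed.

Lemma bc_phi_frechet y k : W y ->
  frechet (fun y => phi y 0 k) y (fun i => partial [:: i] (fun y => phi y 0 k) y).
Proof.
move=> Wy; apply: (Ck1_frechet (bc_W bc)) => //.
by have [+ _] := bc_phi bc k; exact: CkW.
Qed.

(** Differentiates [phi (psi y) = y], which holds near [z] because [U] is open. *)
Lemma iJacK z k l : U z -> \sum_i iJac z k i * Jac z i l = (k == l)%:R.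
Proof.
move=> Uz; have [r r0 rU] := open_ball_sub (bc_U bc) Uz.
have := frechet_comp (fun i => bc_psi_frechet i Uz) (bc_phi_frechet k (bc_psiW bc Uz)).
have r2 : 0 < r / 2 by rewrite divr_gt0.
move/(@frechet_near _ (fun y => y 0 k) _ _ _ r2).
have H y : `|y - z| <= r / 2 -> phi (psi y) 0 k = y 0 k.
  move=> yz; rewrite (bc_psiK bc)//; apply: rU; rewrite (le_lt_trans yz)//.
  by rewrite ltr_pdivrMr// ltr_pMr// ltr1n.
by move/(_ H)/(frechet_unique (frechet_coord z k))/(congr1 (fun F => F l)).
Qed.

(* A single radius on which all the analytic facts about the chart hold. *)
Lemma bc_chart : exists r L, [/\ r <= 1, [set z | `|z - p| <= r] `<=` U,
  chart Omega psi p r L Jac, forall z, `|z - p| <= r -> `|psi z - x0| <= 1 / 2 &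
  [/\ forall z, `|z - p| <= r -> forall i, jet [set z | `|z - p| <= r] L
        (fun y => psi y 0 i) z (Jac z i)
        (fun k l => partial [:: k; l] (fun y => psi y 0 i) z / 2),
      forall i k l, C2ex [set z | `|z - p| <= r] (partial [:: k; l] (fun y => psi y 0 i)) &
      forall i k, C2ex [set z | `|z - p| <= r] (fun z => iJac z k i)]].
Proof.
have Up : U p by apply: (bc_phiU bc); exact: bc_x0 bc.
have psip : psi p = x0 by rewrite (bc_phiK bc)//; exact: bc_x0 bc.
have oU := bc_U bc; have oW := bc_W bc.
have [||r1 r10 H1] := @common_shrink_fin _ (fun i r => [set z | `|z - p| <= r] `<=` U /\
    exists K, C2bnd [set z | `|z - p| <= r] K (fun y => psi y 0 i)).
- move=> i r r' _ rr [rU [K HK]]; split; first exact: subset_trans (ballS rr) rU.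
  by exists K; apply: C2bndS HK; exact: ballS.
- move=> i; apply: (Ck3_C2bnd alpha_lt1 oU) => //.
  by have [+ _] := bc_psi bc i; exact: CkW.
have r1U : [set z | `|z - p| <= r1] `<=` U by case: (H1 ord0).
have /choice[K1 HK1] : forall i, exists K, C2bnd [set z | `|z - p| <= r1] K (fun y => psi y 0 i).
  by move=> i; case: (H1 i).
(* Second derivatives of [psi] enter the curvature of the reflection and must be C^{2,alpha}
   themselves; this consumes the full C^{4,alpha} regularity. *)
have [||r2 r20 H2] := @common_shrink_fin ('I_n.+1 * 'I_n.+1 * 'I_n.+1)%type
  (fun t r => C2ex [set z | `|z - p| <= r]
     (partial [:: t.1.2; t.2] (fun y => psi y 0 t.1.1))).
- by move=> t r r' _ rr; apply: C2exS; exact: ballS.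
- move=> t; apply: (Ckalpha_open_C2ex oU) => //.
  exact: (@Ckalpha_open_partial 2 [:: _; _]) (bc_psi bc _).
have [||r3 r30 H3] := @common_shrink_fin _ (fun i r => [set z | `|z - x0| <= r] `<=` W /\
    exists K, C2bnd [set z | `|z - x0| <= r] K (fun y => phi y 0 i)).
- move=> i r r' _ rr [rU [K HK]]; split; first exact: subset_trans (ballS rr) rU.
  by exists K; apply: C2bndS HK; exact: ballS.
- move=> i; apply: (Ck3_C2bnd alpha_lt1 oW); last exact: bc_x0 bc.
  by have [+ _] := bc_phi bc i; exact: CkW.
have r3W : [set z | `|z - x0| <= r3] `<=` W by case: (H3 ord0).
have /choice[K3 HK3] : forall i, exists K, C2bnd [set z | `|z - x0| <= r3] K (fun y => phi y 0 i).
  by move=> i; case: (H3 i).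
have [||r4 r40 H4] := @common_shrink_fin ('I_n.+1 * 'I_n.+1)%type
  (fun t r => C2ex [set z | `|z - x0| <= r] (partial [:: t.1] (fun y => phi y 0 t.2))).
- by move=> t r r' _ rr; apply: C2exS; exact: ballS.
- move=> t; apply: (Ck3_C2ex oW); last exact: bc_x0 bc.
  by apply: (@Ck_partial _ _ 3 [:: _]); have [+ _] := bc_phi bc t.2.
pose e := Num.min (1/2) (Num.min r3 r4).
have e0 : 0 < e by rewrite !lt_min r30 r40 !andbT divr_gt0.
have [e2 [e3 e4]] : e <= 1/2 /\ e <= r3 /\ e <= r4 by rewrite /e !ge_min !lexx !orbT.
clearbody e.
have [||r5 r50 H5] := @common_shrink_fin _ (fun i r => forall z, `|z - p| <= r ->
    `|psi z 0 i - psi p 0 i| <= e).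
- by move=> i r r' _ rr H z zr; apply: H; exact: le_trans rr.
- move=> i; have [d d0 Hd] := frechet_lip (bc_psi_frechet i Up).
  set M := (_ + _) in Hd; have M0 : 0 < M by rewrite ltr_wpDl// mulr_ge0// sumr_ge0.
  exists (Num.min d (e / M)); first by rewrite lt_min d0 divr_gt0.
  move=> z; rewrite le_min ler_pdivlMr// => /andP[zd zM].
  by have := Hd _ zd; rewrite addrCA subrr addr0 => /le_trans; apply; rewrite mulrC.
pose r := Num.min (Num.min r1 r2) (Num.min r5 1).
have r0 : 0 < r by rewrite !lt_min r10 r20 r50 ltr01.
have [rr1 [rr2 [rr5 rle1]]] : r <= r1 /\ r <= r2 /\ r <= r5 /\ r <= 1.
  by rewrite /r !ge_min !lexx !orbT.
clearbody r.
have psie z : `|z - p| <= r -> `|psi z - x0| <= e.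
  move=> zp; apply: norm_le_coord => [|i]; first exact: ltW.
  by rewrite !mxE -psip; apply: H5; exact: le_trans rr5.
have rU : [set z | `|z - p| <= r] `<=` U by apply: subset_trans r1U; exact: ballS.
have K10 i : 0 <= K1 i.
  have [HK _] := HK1 i; rewrite (le_trans _ (HK [::] p isT _))//=.
  by rewrite subrr normr0 ltW.
have K30 i : 0 <= K3 i.
  have [HK _] := HK3 i; rewrite (le_trans _ (HK [::] x0 isT _))//=.
  by rewrite subrr normr0 ltW.
(* One constant for everything: [N ^+ 4 * K1 i] bounds the jets of [psi], and [N * K3 i] is a
   Lipschitz constant of the components of [phi]. *)
pose L := 1 + N ^+ 4 * \sum_i K1 i + N * \sum_i K3 i.
have S1 : 0 <= \sum_i K1 i by rewrite sumr_ge0.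
have S3 : 0 <= \sum_i K3 i by rewrite sumr_ge0.
have le1 i : K1 i <= \sum_i K1 i by rewrite (bigD1 i)//= lerDl sumr_ge0.
have le3 i : K3 i <= \sum_i K3 i by rewrite (bigD1 i)//= lerDl sumr_ge0.
have L1 : 1 <= L by rewrite /L -addrA lerDl addr_ge0// mulr_ge0// exprn_ge0.
have N1 : 1 <= N by rewrite ler1n.
have NL : N ^+ 4 * \sum_i K1 i <= L by rewrite /L -addrA addrCA lerDl addr_ge0// mulr_ge0.
have L3 : N * \sum_i K3 i <= L.
  by rewrite /L lerDr addr_ge0// mulr_ge0// exprn_ge0.
have psijet z : `|z - p| <= r -> forall i, jet [set z | `|z - p| <= r] L
        (fun y => psi y 0 i) z (Jac z i)
        (fun k l => partial [:: k; l] (fun y => psi y 0 i) z / 2).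
  move=> zr i; have fk : Ck 2 U (fun y => psi y 0 i) by have [+ _] := bc_psi bc i; exact: CkW.
  have Jz := ball_jet alpha_gt0 oU r1U fk (HK1 i) (le_trans zr rr1).
  apply: jetW Jz; first exact: ballS.
  by rewrite (le_trans _ NL)// ler_wpM2l// exprn_ge0.
exists r, L; split => //.
- split => //.
  + exact: bc_O bc.
  + by move=> z zr i; apply: bc_psi_frechet; exact: rU.
  + by move=> z zr i k; have [_ + _ _] := psijet z zr i.
  + by move=> z /rU Uz z0; apply/(bc_in bc Uz).
  + by move=> z /rU Uz z0; apply/(bc_cl bc Uz).
  + move=> z w zr wr; have Uz := rU _ zr; have Uw := rU _ wr.
    rewrite -{1}(bc_psiK bc Uz) -{1}(bc_psiK bc Uw).
    have B y : `|y - p| <= r -> `|psi y - x0| <= r3 by move=> /psie/le_trans; apply.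
    apply: norm_le_coord => [|k]; first by rewrite mulr_ge0// (le_trans _ L1).
    rewrite !mxE; apply: (@frechet_segment_bound _ _ (fun y => phi y 0 k) setT
      (fun y i => partial [:: i] (fun y => phi y 0 k) y)) => t t01.
    have St := segment_closed_ball (B _ zr) (B _ wr) t01.
    split; first by apply: bc_phi_frechet; exact: r3W.
    move=> v; apply: (@le_trans _ _ (N * K3 k * `|v|)).
      by apply: lin_le => i; have [HK _] := HK3 k; exact: (HK [:: i]).
    by rewrite ler_wpM2r// (le_trans _ L3)// ler_wpM2l.
- by move=> z zr; rewrite (le_trans (psie _ zr)).
- split => //.
  + move=> i k l; apply: C2exS (H2 (i, k, l)); exact: ballS.
  + move=> i k; have [Kf HKf] := H4 (i, k).
    eexists; apply: (C2a_comp alpha_gt0 alpha_lt1 L1 (S' := [set z | `|z - x0| <= r4]) _ _ _ HKf).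
    * by move=> y yr /=; rewrite (le_trans (psie _ yr)).
    * move=> y z yr zr _; have := ler_normD (psi z - x0) (x0 - psi y).
      rewrite subrKA (distrC x0) => /le_trans; apply.
      rewrite (le_trans (lerD (psie _ zr) (psie _ yr)))// [leRHS]splitr.
      by rewrite lerD.
    * by move=> j z zr; eexists; eexists; exact: psijet.
Qed.

End BoundaryChart.

(** * The boundary equation in flat coordinates *)

Section FlatEquation.
Context {R : realType} {n : nat}.
Local Notation V := 'rV[R]_n.+1.
Local Notation ei i := (delta_mx 0 i : V).
Local Notation mx := ord_max.
Implicit Types (g b : 'I_n.+1 -> R) (H A J G : 'I_n.+1 -> 'I_n.+1 -> R).

Lemma exchange4 (F : 'I_n.+1 -> 'I_n.+1 -> 'I_n.+1 -> 'I_n.+1 -> R) :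
  \sum_k \sum_l \sum_i \sum_j F k l i j = \sum_i \sum_j \sum_k \sum_l F k l i j.
Proof.
rewrite pair_bigA /=; under eq_bigr do rewrite pair_bigA /=.
rewrite exchange_big [RHS]pair_bigA /=; apply: eq_bigr => ij _.
by rewrite [RHS]pair_bigA.
Qed.

(** The entries of G A G^T, the leading coefficients of the operator in flat coordinates. *)
Definition conj_coef G A (k l : 'I_n.+1) : R := \sum_i \sum_j G k i * A i j * G l j.

Lemma conj_coef_sym G A k l : (forall i j, A i j = A j i) ->
  conj_coef G A k l = conj_coef G A l k.
Proof.
move=> As; rewrite /conj_coef exchange_big; apply: eq_bigr => i _.
by apply: eq_bigr => j _; rewrite (As j i); ring.
Qed.

Lemma inverse_sum J G : (forall k l, \sum_i G k i * J i l = (k == l)%:R) ->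
  forall i j, \sum_k J i k * G k j = (i == j)%:R.
Proof.
move=> GJ i j; pose Jm := \matrix_(i, k) J i k; pose Gm := \matrix_(k, i) G k i.
have /mulmx1C : Gm *m Jm = 1%:M.
  by apply/matrixP => k l; rewrite !mxE -GJ; apply: eq_bigr => ? _; rewrite !mxE.
move/matrixP/(_ i j); rewrite !mxE => <-; apply: eq_bigr => ? _; by rewrite !mxE.
Qed.

Lemma conj_coefK J G A : (forall k l, \sum_i G k i * J i l = (k == l)%:R) ->
  forall i j, \sum_k \sum_l conj_coef G A k l * (J i k * J j l) = A i j.
Proof.
move=> /inverse_sum JG i j.
transitivity (\sum_a \sum_c A a c * ((\sum_k J i k * G k a) * (\sum_l J j l * G l c))).
  under eq_bigr do under eq_bigr do rewrite /conj_coef mulr_suml.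
  under eq_bigr do under eq_bigr do under eq_bigr do rewrite mulr_suml.
  rewrite exchange4; apply: eq_bigr => a _; apply: eq_bigr => c _.
  rewrite mulr_suml mulr_sumr; apply: eq_bigr => k _.
  by rewrite !mulr_sumr; apply: eq_bigr => l _; ring.
rewrite (bigD1 i)//= (bigD1 j)//= !JG !eqxx !mulr1 big1 => [|c cj]; last first.
  by rewrite JG eq_sym (negbTE cj) !mulr0.
rewrite addr0 big1 ?addr0// => a ai; rewrite big1// => c _.
by rewrite JG eq_sym (negbTE ai) mul0r mulr0.
Qed.

Definition flat_drift G A b (D : 'I_n.+1 -> 'I_n.+1 -> 'I_n.+1 -> R) : R :=
  \sum_i G mx i * (b i - \sum_k \sum_l conj_coef G A k l * D i k l).

(** Vanishing on the hyperplane leaves only [g' mx] and the Hessian entries with a normal index. The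
    equation thereby becomes a relation among exactly the quantities that occur in the matching
    condition of the reflection. *)
Lemma flat_equation J G A H g b D :
  (forall k l, \sum_i G k i * J i l = (k == l)%:R) -> (forall i j, A i j = A j i) ->
  let g' := compgrad g J in
  let H' := comphess g (fun i j => H i j / 2) J (fun i k l => D i k l / 2) in
  (forall h : V, lin g' h + quad H' h =
    h 0 mx * (g' mx + \sum_i (H' i mx + H' mx i) * h 0 i - H' mx mx * h 0 mx)) ->
  \sum_i \sum_j A i j * H i j + \sum_i b i * g i = 0 ->
  2 * (\sum_k conj_coef G A k mx * (H' k mx + H' mx k)
    - H' mx mx * conj_coef G A mx mx) + g' mx * flat_drift G A b D = 0.
Proof.
move=> GJ As g' H' flat eq0; have JG := inverse_sum GJ.
pose at_ := conj_coef G A; pose sg i := H' i mx + H' mx i; pose c := H' mx mx.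
(* Comparing [flat] at [h] and at [- h] separates the linear part from the quadratic one. *)
have linE h : lin g' h = h 0 mx * g' mx.
  have h1 := flat h; have h2 := flat (- h).
  rewrite linNr (_ : quad H' (- h) = quad H' h) in h2; last first.
    by rewrite -scaleN1r quadZr sqrrN expr1n mul1r.
  have e : \sum_i (H' i mx + H' mx i) * (- h) 0 i = - \sum_i (H' i mx + H' mx i) * h 0 i.
    by rewrite -sumrN; apply: eq_bigr => i _; rewrite mxE mulrN.
  rewrite e [(- h) 0 mx]mxE in h2.
  move: h1 h2; move: (lin g' h) (quad H' h) (\sum_i _) (h 0 mx) (g' mx) (H' mx mx).
  move=> l q S t gm c' h1 h2.
  have : l + q - (- l + q) = t * (gm + S - c' * t) - (- t) * (gm - S - c' * - t).
    by rewrite h1 h2.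
  have -> : l + q - (- l + q) = 2 * l by ring.
  have -> : t * (gm + S - c' * t) - (- t) * (gm - S - c' * - t) = 2 * (t * gm) by ring.
  by apply: mulfI; rewrite pnatr_eq0.
have quadE h : quad H' h = h 0 mx * (\sum_i sg i * h 0 i - c * h 0 mx).
  have := flat h; rewrite linE /sg /c => e.
  by apply: (addrI (h 0 mx * g' mx)); rewrite e; ring.
have g0 k : k != mx -> g' k = 0.
  move=> km; have := linE (ei k); rewrite -[ei k]scale1r lin_delta !mxE eqxx eq_sym (negbTE km).
  by rewrite !mul1r /= mul0r.
(* The gradient of [u] is a multiple of the gradient of the normal coordinate of the inverse
   chart. *)
have gE i : g i = g' mx * G mx i.
  transitivity (\sum_k g' k * G k i).
    rewrite /g' /compgrad; under [RHS]eq_bigr do rewrite mulr_suml.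
    rewrite exchange_big (eq_bigr (fun j => g j * (j == i)%:R)) => [|j _]; last first.
      by rewrite -JG mulr_sumr; apply: eq_bigr => k _; rewrite mulrA.
    rewrite (bigD1 i)//= eqxx mulr1 big1 ?addr0// => j ji.
    by rewrite (negbTE ji) mulr0.
  by rewrite (bigD1 mx)//= big1 ?addr0// => k /g0 ->; rewrite mul0r.
(* The symmetrised half Hessian lives in the last row and column; the last term corrects the double
   count of the corner. *)
have symE k l : H' k l + H' l k =
    (k == mx)%:R * sg l + (l == mx)%:R * sg k - 2 * c * ((k == mx)%:R * (l == mx)%:R).
  have S i : \sum_j sg j * ei i 0 j = sg i.
    rewrite (bigD1 i)//= !mxE !eqxx mulr1 big1 ?addr0// => j ji.
    by rewrite !mxE eqxx (negbTE ji) mulr0.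
  have := quadDr H' (ei k) (ei l); rewrite bil_delta2 => e.
  have {e} -> : H' k l + H' l k = quad H' (ei k + ei l) - quad H' (ei k) - quad H' (ei l).
    by rewrite e; ring.
  have SD : \sum_j sg j * (ei k + ei l) 0 j = sg k + sg l.
    by rewrite -(S k) -(S l) -big_split; apply: eq_bigr => j _; rewrite mxE mulrDr.
  rewrite !quadE SD !S [(ei k + ei l) 0 mx]mxE !mxE eqxx /= !(eq_sym mx); ring.
have trE : \sum_k \sum_l at_ k l * (2 * H' k l) =
    2 * (\sum_k at_ k mx * sg k - c * at_ mx mx).
  transitivity (\sum_k \sum_l at_ k l * (H' k l + H' l k)).
    have e : \sum_k \sum_l at_ k l * H' k l = \sum_k \sum_l at_ k l * H' l k.
      rewrite exchange_big; apply: eq_bigr => k _; apply: eq_bigr => l _.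
      by rewrite /at_ conj_coef_sym.
    transitivity (\sum_k \sum_l at_ k l * H' k l + \sum_k \sum_l at_ k l * H' l k).
      rewrite -e -big_split; apply: eq_bigr => k _ /=; rewrite -big_split.
      by apply: eq_bigr => l _ /=; ring.
    rewrite -big_split; apply: eq_bigr => k _ /=; rewrite -big_split.
    by apply: eq_bigr => l _ /=; ring.
  transitivity (\sum_k \sum_l at_ k l * ((k == mx)%:R * sg l)
    + \sum_k \sum_l at_ k l * ((l == mx)%:R * sg k)
    - 2 * c * \sum_k \sum_l at_ k l * ((k == mx)%:R * (l == mx)%:R)).
    rewrite mulr_sumr -big_split -sumrB; apply: eq_bigr => k _ /=.
    rewrite mulr_sumr -big_split -sumrB; apply: eq_bigr => l _ /=.
    by rewrite symE; ring.
  have -> : \sum_k \sum_l at_ k l * ((k == mx)%:R * sg l) = \sum_k at_ k mx * sg k.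
    rewrite (bigD1 mx)//= [X in _ + X]big1 ?addr0 => [|k km].
      by apply: eq_bigr => l _; rewrite eqxx mul1r /at_ conj_coef_sym.
    by rewrite big1// => l _; rewrite (negbTE km) mul0r mulr0.
  have -> : \sum_k \sum_l at_ k l * ((l == mx)%:R * sg k) = \sum_k at_ k mx * sg k.
    apply: eq_bigr => k _; rewrite (bigD1 mx)//= eqxx mul1r big1 ?addr0// => l lm.
    by rewrite (negbTE lm) mul0r mulr0.
  have -> : \sum_k \sum_l at_ k l * ((k == mx)%:R * (l == mx)%:R) = at_ mx mx.
    rewrite (bigD1 mx)//= (bigD1 mx)//= !eqxx !mulr1 big1 ?addr0 => [|l lm].
      rewrite big1 ?addr0// => k km; rewrite big1// => l _.
      by rewrite (negbTE km) mul0r mulr0.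
    by rewrite (negbTE lm) !mulr0.
  ring.
(* The chain rule expands the flat Hessian; its second-order part, contracted with the flat
   coefficients, gives back [A] by [conj_coefK]. *)
have HE : \sum_k \sum_l at_ k l * (2 * H' k l) =
    \sum_i g i * (\sum_k \sum_l at_ k l * D i k l) + \sum_i \sum_j A i j * H i j.
  transitivity (\sum_k \sum_l \sum_i g i * (at_ k l * D i k l) +
     \sum_k \sum_l \sum_i \sum_j H i j * (at_ k l * (J i k * J j l))).
    rewrite -big_split; apply: eq_bigr => k _ /=; rewrite -big_split.
    apply: eq_bigr => l _ /=; rewrite /H' /comphess mulrDr mulrDr; congr (_ + _).
      by rewrite !mulr_sumr; apply: eq_bigr => i _; field.
    rewrite !mulr_sumr; apply: eq_bigr => i _; rewrite !mulr_sumr.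
    by apply: eq_bigr => j _; field.
  congr (_ + _).
    rewrite [RHS](eq_bigr (fun i => \sum_k \sum_l g i * (at_ k l * D i k l))); last first.
      by move=> i _; rewrite mulr_sumr; apply: eq_bigr => k _; rewrite mulr_sumr.
    rewrite [RHS]exchange_big; apply: eq_bigr => k _ /=.
    by rewrite [RHS]exchange_big.
  rewrite exchange4; apply: eq_bigr => i _; apply: eq_bigr => j _.
  rewrite -[in RHS](conj_coefK A GJ i j) mulr_suml; apply: eq_bigr => k _.
  by rewrite mulr_suml; apply: eq_bigr => l _; rewrite mulrC.
rewrite -/(at_ mx mx) -[X in 2 * (X - _)]/(\sum_k at_ k mx * sg k) -/c -trE HE.
rewrite -[RHS]eq0 addrAC addrC; congr (_ + _).
rewrite /flat_drift mulr_sumr -big_split; apply: eq_bigr => i _ /=.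
rewrite -/at_ (gE i); ring.
Qed.

End FlatEquation.

(** * Extension near one boundary point *)

Section LocalExtension.
Context {R : realType} {n : nat} (alpha : R).
Context (alpha_gt0 : 0 < alpha) (alpha_lt1 : alpha < 1).
Local Notation V := 'rV[R]_n.+1.
Local Notation N := (n.+1%:R : R).
Local Notation jet := (@jet R n alpha).
Local Notation C2a := (@C2a R n alpha).
Local Notation C2ex := (@C2ex R n alpha).
Local Notation C2bnd := (@C2bnd R n alpha).
Local Notation last z := ((z : V) 0 ord_max).
Local Notation mx := ord_max.
Implicit Types (x y z w h v : V) (u : V -> R) (K r : R) (Omega : set V).

Lemma compact_closure Omega : bounded_set Omega -> compact (closure Omega).
Proof.
move=> [M [Mr HM]]; apply: bounded_closed_compact; last exact: closed_closure.
exists (M + 1); split; first by rewrite realD// real1.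
move=> B MB y /= yO; have H : Omega `<=` [set z : V | `|z| <= B].
  move=> z Oz; apply: HM => //; rewrite (lt_trans _ MB)// ltrDl.
  exact: ltr01.
have cB : closed [set z : V | `|z| <= B].
  apply: (@closed_comp _ _ (fun z : V => `|z|) [set t : R | t <= B]); last exact: closed_le.
  by move=> z _; exact: norm_continuous.
by have /(_ y yO) := closure_subset H; rewrite -(closure_id _).1.
Qed.

Lemma continuous_bounded_on Omega f : compact (closure Omega) ->
  {within closure Omega, continuous f} ->
  exists2 K, 0 <= K & forall x, closure Omega x -> `|(f : V -> R) x| <= K.
Proof.
move=> cO fc; have [M [Mr HM]] := compact_bounded (continuous_compact fc cO).
exists (`|M| + 1); first by rewrite addr_ge0.
move=> x Ox; apply: (HM (`|M| + 1)); last by exists x.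
by rewrite (le_lt_trans (ler_norm _))// ltrDl.
Qed.

(** Compactness of the closure yields some finite bound; the bound that is linear in the norm of [u]
    is [Ckalpha_norm_C2bnd]. *)
Lemma Ckalpha_C2bnd Omega u : open Omega -> compact (closure Omega) ->
  Ckalpha 2 alpha Omega u -> exists2 K, 0 <= K & C2bnd Omega K u.
Proof.
move=> oO cO [uk uc uext uH].
have cextE s x : (size s <= 2)%N -> Omega x -> cext Omega (partial s u) x = partial s u x.
  by move=> s2 Ox; apply: cext_in => //; have [+ _] := uk s; apply.
have bound (s : seq 'I_n.+1) : exists K, 0 <= K /\ ((size s <= 2)%N ->
    forall x, Omega x -> `|partial s u x| <= K).
  have [s2|s2] := leqP (size s) 2; last by exists 0.
  have [K K0 HK] := continuous_bounded_on cO (uext s s2); exists K; split => // _ x Ox.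
  by rewrite -cextE//; apply: HK; exact: subset_closure.
have hoel (s : seq 'I_n.+1) : exists K, 0 <= K /\ (size s = 2 -> forall x y, Omega x -> Omega y ->
    `|partial s u x - partial s u y| <= K * `|x - y| `^ alpha).
  have [s2|s2] := eqVneq (size s) 2; last by exists 0; split => // h; rewrite h in s2.
  have [M HM] := uH s s2; exists (`|M| * N); split; first by rewrite mulr_ge0.
  move=> _ x y Ox Oy; rewrite -!cextE ?s2//.
  have := HM x y (subset_closure Ox) (subset_closure Oy) => /le_trans; apply.
  apply: (@le_trans _ _ (`|M| * enorm (x - y) `^ alpha)).
    by rewrite ler_wpM2r ?powR_ge0// ler_norm.
  by rewrite -mulrA ler_wpM2l// enorm_powR_le.
have [K HK] := choice bound; have [K' HK'] := choice hoel.
have K0 s : 0 <= K s by case: (HK s).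
have K0' s : 0 <= K' s by case: (HK' s).
pose T (m : nat) := \sum_(t : m.-tuple 'I_n.+1) K t.
have T0 m : 0 <= T m by rewrite sumr_ge0.
exists (T 0%N + T 1%N + T 2 + \sum_(t : 2.-tuple 'I_n.+1) K' t).
  by rewrite !addr_ge0// sumr_ge0.
have S0 : 0 <= \sum_(t : 2.-tuple 'I_n.+1) K' t by rewrite sumr_ge0.
split=> [s x s2 Ox|s x y s2 Ox Oy].
  have [_ /(_ s2 x Ox)/le_trans] := HK s; apply.
  have sT : K s <= T (size s).
    by rewrite /T (bigD1 (in_tuple s))//= lerDl sumr_ge0.
  rewrite (le_trans sT)//.
  case: (size s) s2 => [|[|[|//]]] _; have := T0 0%N; have := T0 1%N; have := T0 2; clear sT; lra.
have [_ /(_ s2 x y Ox Oy)/le_trans] := HK' s; apply; rewrite ler_wpM2r ?powR_ge0//.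
have Hs : size s == 2 by rewrite s2.
rewrite (bigD1 (Tuple Hs))//= addrCA lerDl !addr_ge0// sumr_ge0//.
Qed.

(** Each value is a value of [u] up to sign, at a point chosen independently of [u]: linearity and
    the sup bound need no estimate once [sigma] maps into the closure. *)
Definition extend Omega (sigma : V -> V) u y := if `[< closure Omega y >] then u y else - u (sigma y).

Section AtBoundary.
Context (Omega W U : set V) (psi phi : V -> V) (x0 : V).
Context (bc : boundary_chart alpha Omega W U psi phi x0).
Context (cO : compact (closure Omega)).
Context (A : V -> 'M[R]_n.+1) (b : V -> V) (c : V -> R).
Context (A_reg : forall i j, Ckalpha 2 alpha Omega (fun x => A x i j))
  (b_reg : forall i, Ckalpha 2 alpha Omega (fun x => b x 0 i))
  (A_sym : forall x, closure Omega x -> (A x)^T = A x)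
  (lambda : R) (lambda_gt0 : 0 < lambda) (A_ell : uniformly_elliptic Omega lambda A).
Local Notation p := (phi x0).

Definition pcoef z (k l : 'I_n.+1) : R :=
  conj_coef (iJac psi phi z) (fun i j => A (psi z) i j) k l.

Definition pdrift z : R := flat_drift (iJac psi phi z) (fun i j => A (psi z) i j)
  (fun i => b (psi z) 0 i) (fun i k l => partial [:: k; l] (fun y => psi y 0 i) z).

(* With these coefficients of the reflection, Lu = 0 is the relation of boundary_jets. *)
Definition rslope z (i : 'I_n.+1) : R := -2 * (pcoef z i mx * (pcoef z mx mx)^-1).

Definition rcurv z : R := pdrift z * (pcoef z mx mx)^-1.

Section Radius.
Context (r L : R) (rU : [set z | `|z - p| <= r] `<=` U)
  (ch : chart Omega psi p r L (Jac psi))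
  (psi_small : forall z, `|z - p| <= r -> `|psi z - x0| <= 1 / 2)
  (psijet : forall z, `|z - p| <= r -> forall i, jet [set z | `|z - p| <= r] L
        (fun y => psi y 0 i) z (Jac psi z i)
        (fun k l => partial [:: k; l] (fun y => psi y 0 i) z / 2))
  (Dex : forall i k l, C2ex [set z | `|z - p| <= r] (partial [:: k; l] (fun y => psi y 0 i)))
  (Gex : forall i k, C2ex [set z | `|z - p| <= r] (fun z => iJac psi phi z k i)).
Local Notation Hs := (halfcube p (r / 2)).

Lemma halfcube_ball : Hs `<=` [set z | `|z - p| <= r].
Proof.
move=> z [zp _] /=; rewrite (le_trans zp)// ler_pdivrMr// ler_pMr ?ler1n//.
exact: chart_r0 ch.
Qed.

Definition ctrace : R := @compC R n L * @traceC R n L.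

Lemma flat_jet u K : Ckalpha 2 alpha Omega u -> C2bnd Omega K u -> forall w, Hs w ->
  jet Hs (ctrace * K) (fun z => u (psi z)) w
    (compgrad (fun i => cext Omega (partial [:: i] u) (psi w)) (Jac psi w))
    (comphess (fun i => cext Omega (partial [:: i] u) (psi w))
      (fun i j => cext Omega (partial [:: i; j] u) (psi w) / 2) (Jac psi w)
      (fun i k l => partial [:: k; l] (fun y => psi y 0 i) w / 2)).
Proof.
move=> uC uB w wh; rewrite /ctrace -mulrA.
apply: (jet_comp alpha_gt0 alpha_lt1 (chart_L1 ch) _ _ _ (trace_jet alpha_gt0 alpha_lt1 ch uC uB wh)).
- by move=> y yh; exists y.
- move=> y yh _; have := ler_normD (psi y - x0) (x0 - psi w).
  rewrite subrKA (distrC x0) => /le_trans; apply.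
  have yr := psi_small (halfcube_ball yh); have wr := psi_small (halfcube_ball wh).
  by rewrite (le_trans (lerD yr wr))// [leRHS]splitr.
- by move=> i; apply: jetW (psijet (halfcube_ball wh) i) => //; exact: halfcube_ball.
Qed.

Lemma flat_C2ex u : Ckalpha 2 alpha Omega u -> C2ex Hs (fun z => u (psi z)).
Proof.
move=> uC; have [K K0 uB] := Ckalpha_C2bnd (chart_open ch) cO uC.
by exists (ctrace * K) => w wh; eexists; eexists; exact: flat_jet.
Qed.

Lemma GexH i k : C2ex Hs (fun z => iJac psi phi z k i).
Proof. by apply: C2exS (Gex i k); exact: halfcube_ball. Qed.

Lemma pcoef_C2ex k l : C2ex Hs (fun z => pcoef z k l).
Proof.
rewrite /pcoef /conj_coef; apply: C2ex_sum => i; apply: C2ex_sum => j.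
apply: C2exM => //; last exact: GexH.
apply: C2exM => //; first exact: GexH.
exact: (flat_C2ex (A_reg i j)).
Qed.

Lemma pdrift_C2ex : C2ex Hs pdrift.
Proof.
rewrite /pdrift /flat_drift; apply: C2ex_sum => i; apply: C2exM => //; first exact: GexH.
apply: C2exB; first exact: (flat_C2ex (b_reg i)).
apply: C2ex_sum => k; apply: C2ex_sum => l; apply: C2exM => //.
  exact: pcoef_C2ex.
by apply: C2exS (Dex i k l); exact: halfcube_ball.
Qed.

Definition pdelta : R := lambda / (N * L) ^+ 2.

Lemma NL_gt0 : 0 < N * L.
Proof. by rewrite mulr_gt0// (lt_le_trans _ (chart_L1 ch)). Qed.

Lemma pdelta_gt0 : 0 < pdelta.
Proof. by rewrite divr_gt0// exprn_gt0// NL_gt0. Qed.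

(** Ellipticity is tested on the normal row of the inverse Jacobian. That row pairs to 1 with a
    column of the Jacobian bounded by [L], so its length is at least [1 / (N * L)]. *)
Lemma pcoef_low z : Hs z -> pdelta <= pcoef z mx mx.
Proof.
move=> zh; have zr := halfcube_ball zh; have Uz := rU zr.
have clz : closure Omega (psi z) by apply: (chart_cl ch) => //; case: zh.
pose xi : V := \row_i iJac psi phi z mx i.
have := A_ell xi clz.
have -> : \sum_i \sum_j A (psi z) i j * xi 0 j * xi 0 i = pcoef z mx mx.
  by apply: eq_bigr => i _; apply: eq_bigr => j _; rewrite !mxE; ring.
apply: le_trans; rewrite /pdelta ler_wpM2l ?(ltW lambda_gt0)// -exprVn.
rewrite lerXn2r ?nnegrE ?invr_ge0 ?sqrtr_ge0 ?(ltW NL_gt0)//.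
apply: (le_trans _ (norm_le_enorm xi)).
rewrite -[leLHS]mul1r ler_pdivrMr ?NL_gt0//.
have E : \sum_i iJac psi phi z mx i * Jac psi z i mx = 1 by rewrite (iJacK bc)// eqxx.
rewrite -[leLHS]E.
apply: (le_trans (ler_norm _)); rewrite mulrC -mulrA; apply: ler_norm_sum_ord => i.
rewrite normrM mulrC; apply: ler_pM; [exact: normr_ge0|exact: normr_ge0| |].
  by have := coord_le_norm xi i; rewrite mxE.
exact: (chart_J ch).
Qed.

Lemma inv_pcoef_C2ex : C2ex Hs (fun z => (pcoef z mx mx)^-1).
Proof. exact: (C2ex_inv alpha_gt0 alpha_lt1 pdelta_gt0 pcoef_low (pcoef_C2ex _ _)). Qed.

Lemma pcoef_neq0 z : Hs z -> pcoef z mx mx != 0.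
Proof. by move=> /pcoef_low h; rewrite gt_eqF// (lt_le_trans pdelta_gt0). Qed.

Lemma rslope_mx z : Hs z -> rslope z mx = -2.
Proof. by move=> zh; rewrite /rslope divff ?mulr1// pcoef_neq0. Qed.

Lemma rslope_rcurv_C2a : exists2 B, 1 <= B & C2a Hs B rcurv /\
  forall i, C2a Hs B (fun z => rslope z i).
Proof.
have /choice[K HK] : forall i, exists K, C2a Hs K (fun z => rslope z i).
  move=> i; apply: C2exZ; apply: C2exM => //; first exact: pcoef_C2ex.
  exact: inv_pcoef_C2ex.
have [K1 K11 HK1] : exists2 K, 1 <= K & C2a Hs K rcurv.
  by apply: C2exP; apply: C2exM => //; [exact: pdrift_C2ex|exact: inv_pcoef_C2ex].
exists (\big[Num.max/K1]_i K i); first by rewrite (le_trans K11)// bigmax_ge_id.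
split=> [|i]; first by apply: C2aW HK1 => //; exact: bigmax_ge_id.
by apply: C2aW (HK i) => //; exact: le_bigmax.
Qed.

Lemma flat_boundary_jets u K : DL alpha Omega A b c u -> C2bnd Omega K u ->
  boundary_jets alpha p (r / 2 / 2) rslope rcurv (fun z => u (psi z)) (ctrace * K).
Proof.
move=> [uC ubd] uB w wp w0.
have r0 := chart_r0 ch; have r20 : 0 < r / 2 by rewrite divr_gt0.
have bdz z : `|z - p| <= r / 2 -> last z = 0 -> boundary Omega (psi z).
  move=> zp z0; have zh : Hs z by split => //; rewrite z0.
  exact/(bc_bd bc (rU (halfcube_ball zh))).
have wp2 : `|w - p| <= r / 2.
  by rewrite (le_trans wp)// ler_pdivrMr// ler_pMr// ler1n.
have wh : Hs w by split => //; rewrite w0.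
have [uw Lw] := ubd _ (bdz w wp2 w0); split => //.
have Jw := flat_jet uC uB wh; eexists; eexists; split.
  apply: jetW Jw => // z [zp z0]; split => //; rewrite (le_trans zp)//.
  by rewrite ler_pdivrMr// ler_pMr// ler1n.
have u0 z : `|z - p| <= r / 2 -> last z = 0 -> u (psi z) = 0.
  by move=> zp z0; have [] := ubd _ (bdz z zp z0).
have flat := boundary_taylor alpha_gt0 alpha_lt1 r20 Jw wp w0 u0.
have clw : closure Omega (psi w) by have [] := bdz w wp2 w0.
have As i j : A (psi w) i j = A (psi w) j i.
  by rewrite -{1}(A_sym clw) mxE.
(* The zero-order term drops out because [u] vanishes at the boundary point. *)
have eq0 : \sum_i \sum_j A (psi w) i j * cext Omega (partial [:: i; j] u) (psi w) +
    \sum_i b (psi w) 0 i * cext Omega (partial [:: i] u) (psi w) = 0.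
  by move: Lw; rewrite /Lop uw mulr0 addr0.
have := @flat_equation _ _ _ _ _ _ _ _ _ (fun k l => iJacK bc k l (rU (halfcube_ball wh)))
  As flat eq0.
rewrite -/(pdrift w) -/(pcoef w mx mx).
set g' := compgrad _ _; set H' := comphess _ _ _ _ => E.
have nz := pcoef_neq0 wh.
have -> : \sum_i (H' i mx + H' mx i) * rslope w i =
    -2 * (pcoef w mx mx)^-1 * \sum_k pcoef w k mx * (H' k mx + H' mx k).
  by rewrite mulr_sumr; apply: eq_bigr => i _; rewrite /rslope; ring.
have {}E : 2 * (\sum_k pcoef w k mx * (H' k mx + H' mx k) - H' mx mx * pcoef w mx mx) +
  g' mx * pdrift w = 0 by [].
apply: (mulIf nz); rewrite mul0r -[RHS]E /rcurv; field.
exact: nz.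
Qed.

End Radius.

Lemma boundary_extension : exists delta sigma C, [/\ 0 < delta, 0 <= C,
  forall y, `|y - x0| <= delta -> ~ closure Omega y -> closure Omega (sigma y) &
  forall u K, DL alpha Omega A b c u -> C2bnd Omega K u ->
    C2a [set y | `|y - x0| <= delta] (C * K) (extend Omega sigma u)].
Proof.
have [r [L [r1 rU ch psis [psijet Dex Gex]]]] := bc_chart alpha_gt0 alpha_lt1 bc.
have r0 := chart_r0 ch; have r20 : 0 < r / 2 by rewrite divr_gt0.
(* The radius is halved twice: [trace_jet] needs room for the upward shift, [boundary_taylor] for
   tangential increments. *)
have rho0 : 0 < r / 2 / 2 by rewrite divr_gt0.
have rho1 : r / 2 / 2 <= 1 / 2 by rewrite ler_wpM2r// ler_pdivrMr// mul1r (le_trans r1)// ler1n.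
have sub : halfcube p (r / 2 / 2) `<=` halfcube p (r / 2).
  by move=> z [zp z0]; split => //; rewrite (le_trans zp)// ler_pdivrMr// ler_pMr// ler1n.
have [B B1 [fB mB]] := rslope_rcurv_C2a rU ch psis psijet Dex Gex.
have m_last z : halfcube p (r / 2 / 2) z -> rslope z mx = -2.
  by move=> /sub zh; apply: (rslope_mx rU ch).
have mB' i : C2a (halfcube p (r / 2 / 2)) B (fun z => rslope z i) by apply: C2aW (mB i).
have fB' : C2a (halfcube p (r / 2 / 2)) B rcurv by apply: C2aW fB.
have p0 := bc_p bc.
have [C3 C30 refl] := C2a_reflected alpha_gt0 alpha_lt1 p0 rho0 rho1 B1 mB' fB' m_last.
have [rr0 _ _ _] := safe_radius_bound rho0 rho1 B1.
have rhalf := reflect_half p0 rho0 rho1 B1 mB' fB' m_last.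
set rr := safe_radius (r / 2 / 2) B in refl rr0 rhalf.
have rr1 : rr <= 1 / 2.
  have [_ h _ _] := safe_radius_bound rho0 rho1 B1; rewrite (le_trans h)// (le_trans _ rho1)//.
  by rewrite ler_pdivrMr// ler_pMr// ler1n.
have oW := bc_W bc; have Wx0 := bc_x0 bc.
have [||r6 r60 H6] := @common_shrink_fin R 'I_n.+1 (fun i t => [set y | `|y - x0| <= t] `<=` W /\
   C2ex [set y | `|y - x0| <= t] (fun y => phi y 0 i) /\
   forall y, `|y - x0| <= t -> `|phi y 0 i - p 0 i| <= rr / 10).
- move=> i t t' _ tt [tW [te tr]]; split; first exact: subset_trans (ballS tt) tW.
  split; first by apply: C2exS te; exact: ballS.
  by move=> y yt; apply: tr; exact: le_trans tt.
- move=> i; have fk : Ck 3 W (fun y => phi y 0 i) by have [+ _] := bc_phi bc i; exact: CkW.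
  have [ra ra0 Ha] := Ck3_C2ex alpha_gt0 alpha_lt1 oW fk Wx0.
  have [rb rb0 rbW] := open_ball_sub oW Wx0.
  have [d d0 Hd] := frechet_lip (bc_phi_frechet bc i Wx0).
  set M := (_ + _) in Hd; have M0 : 0 < M by rewrite ltr_wpDl// mulr_ge0// sumr_ge0.
  exists (Num.min (Num.min ra (rb / 2)) (Num.min d (rr / 10 / M))).
    rewrite !lt_min ra0 d0 /=; apply/andP; split; first exact: divr_gt0.
    by apply: divr_gt0 => //; exact: divr_gt0.
  split; first move=> y /=; last split.
  + rewrite !le_min => /andP[/andP[_ yb] _]; apply: rbW; rewrite (le_lt_trans yb)//.
    by rewrite ltr_pdivrMr// ltr_pMr// ltr1n.
  + by apply: C2exS Ha => y /=; rewrite !le_min => /andP[/andP[]].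
  + move=> y; rewrite !le_min => /andP[_ /andP[yd yM]].
    have := Hd _ yd; rewrite addrCA subrr addr0 => /le_trans; apply.
    by rewrite mulrC -ler_pdivlMr.
have r6W : [set y | `|y - x0| <= r6] `<=` W by case: (H6 ord0).
have phir y : `|y - x0| <= r6 -> `|phi y - p| <= rr / 10.
  move=> yr; apply: norm_le_coord => [|i]; first by rewrite divr_ge0// ltW.
  by rewrite !mxE; have [_ [_]] := H6 i; apply.
have /choice[K6 HK6] : forall i, exists K, C2a [set y | `|y - x0| <= r6] K (fun y => phi y 0 i).
  by move=> i; have [_ []] := H6 i.
pose L6 := \big[Num.max/1]_i K6 i.
have L61 : 1 <= L6 by exact: bigmax_ge_id.
have L60 : 0 <= L6 by rewrite (le_trans _ L61).
have cC (t : R) : 0 <= t -> 0 <= @compC R n t.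
  have c0 : 0 <= @cN R n by rewrite (le_trans _ (@cN_ge1 R n)).
  by move=> t0; rewrite /compC; apply: mulr_ge0; [apply: mulr_ge0 => //|]; apply: exprn_ge0.
have L0 : 0 <= L by rewrite (le_trans _ (chart_L1 ch)).
have phicl y : `|y - x0| <= r6 -> closure Omega y <-> 0 <= last (phi y).
  move=> yr; have Wy := r6W _ yr; have Uy := bc_phiU bc Wy.
  by have := bc_cl bc Uy; rewrite (bc_phiK bc Wy).
(* The witness is the bent reflection conjugated by the chart. The three factors of the constant
   belong to composition with [phi], to the reflection, and to composition with [psi]. *)
exists r6, (fun y => psi (bent_reflection rslope rcurv (phi y))),
  (@compC R n L6 * (C3 * ctrace L)); split => //.
- apply: mulr_ge0; first exact: cC.
  apply: mulr_ge0 => //; rewrite /ctrace; apply: mulr_ge0; first exact: cC.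
  by rewrite /traceC; repeat apply: mulr_ge0 => //; apply: exprn_ge0.
- move=> y yr /(phicl y yr); rewrite leNgt => /negP; rewrite negbK => /ltW ly.
  have ypr : `|phi y - p| <= rr.
    by rewrite (le_trans (phir _ yr))// ler_pdivrMr// ler_pMr// ler1n.
  have [h1 h2] := sub _ (rhalf _ ypr ly).
  have hU := rU _ (halfcube_ball ch (conj h1 h2)).
  exact/(bc_cl bc hU).
- move=> u K uDL uB.
  have [uC _] := uDL.
  have uJ := flat_boundary_jets rU ch psis psijet uDL uB.
  have ut : C2a (halfcube p (r / 2 / 2)) (ctrace L * K) (fun z => u (psi z)).
    move=> w /sub wh; eexists; eexists; apply: jetW (flat_jet ch psis psijet uC uB wh) => //.
  have := refl _ _ ut uJ; rewrite (mulrA C3) => v.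
  rewrite -mulrA.
  have := @C2a_comp _ _ _ alpha_gt0 alpha_lt1 [set y | `|y - x0| <= r6] _ _ L6 _ phi L61 _ _ _ v.
  move=> F; apply: eq_C2a (F _ _ _).
  + move=> y; rewrite inE /= => yr; rewrite /reflected /extend.
    rewrite (bc_phiK bc (r6W _ yr)); case: asboolP => [/(phicl y yr)->//|ncl].
    by case: ifPn => // /(phicl y yr).
  + exact: phir.
  + move=> y z /phir yr /phir zr _; have := ler_normD (phi z - p) (p - phi y).
    rewrite subrKA (distrC p) => /le_trans; apply.
    have h : rr / 10 <= 1 / 2 by rewrite (le_trans _ rr1)// ler_pdivrMr// ler_pMr// ler1n.
    by rewrite [leRHS]splitr; apply: lerD; [exact: le_trans zr h|exact: le_trans yr h].
  + by move=> i; apply: C2aW (HK6 i) => //; exact: le_bigmax.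
Qed.

End AtBoundary.

End LocalExtension.

(** * Gluing the local extensions *)

Section GlobalExtension.
Context {R : realType} {n : nat} (alpha : R).
Context (alpha_gt0 : 0 < alpha) (alpha_lt1 : alpha < 1).
Local Notation V := 'rV[R]_n.+1.
Local Notation N := (n.+1%:R : R).
Local Notation cN := (@cN R n).
Local Notation C2a := (@C2a R n alpha).
Local Notation C2bnd := (@C2bnd R n alpha).
Local Notation last z := ((z : V) 0 ord_max).
Implicit Types (x y z : V) (u : V -> R) (K r : R).
Context (Omega : set V) (oO : open Omega) (bO : bounded_set Omega).

Lemma smooth_boundary_chart x0 : Ckalpha_smooth 4 alpha Omega -> boundary Omega x0 ->
  exists W U psi phi, boundary_chart alpha Omega W U psi phi x0.
Proof.
move=> sm x0bd; have [W [U [psi [[oW Wx0] [oU _] [bij psiC [phi [phiK phiC]]] Ebd Ein]]]] := sm _ x0bd.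
have [psiW _ psisurj] := bij.
have inE z : U z -> Omega (psi z) <-> 0 < last z.
  move=> Uz; split=> [Oz|z0].
    have : (Omega `&` W) (psi z) by split => //; exact: psiW.
    by rewrite -Ein => -[z' [Uz' z'0] e]; rewrite -(phiK _ Uz) -e phiK.
  by have : (Omega `&` W) (psi z) by [rewrite -Ein; exists z|]; case.
have bdE z : U z -> boundary Omega (psi z) <-> last z = 0.
  move=> Uz; split=> [Oz|z0].
    have : (boundary Omega `&` W) (psi z) by split => //; exact: psiW.
    by rewrite -Ebd => -[z' [Uz' z'0] e]; rewrite -(phiK _ Uz) -e phiK.
  by have : (boundary Omega `&` W) (psi z) by [rewrite -Ebd; exists z|]; case.
exists W, U, psi, phi; split => //.
- by move=> y /psisurj[z Uz <-]; rewrite phiK.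
- by move=> y /psisurj[z Uz <-]; rewrite phiK.
(* For an open set the closure is the union of the set and its boundary, so this case reduces to the
   two preceding equivalences. *)
- move=> z Uz; split=> [cz|].
    have [Oz|nOz] := pselect (Omega (psi z)); first by rewrite ltW//; exact/(inE _ Uz).
    have /(bdE _ Uz)-> // : boundary Omega (psi z).
    by split => // /interior_subset.
  rewrite le_eqVlt => /orP[/eqP/esym/(bdE _ Uz)[]//|/(inE _ Uz)].
  exact: subset_closure.
- have : (boundary Omega `&` W) x0 by [].
  by rewrite -Ebd => -[z [Uz z0] <-]; rewrite phiK.
Qed.

Context (A : V -> 'M[R]_n.+1) (b : V -> V) (c : V -> R).
Local Notation dom := (DL alpha Omega A b c).

(** [sigma] and [C] are fixed before [u], which yields linearity and a uniform bound. *)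
Definition local_extension x0 := exists delta sigma C, [/\ 0 < delta, 0 <= C,
  forall y, `|y - x0| <= delta -> ~ closure Omega y -> closure Omega (sigma y) &
  forall u K, dom u -> C2bnd Omega K u ->
    C2a [set y | `|y - x0| <= delta] (C * K) (extend Omega sigma u)].

Lemma interior_extension x0 : Omega x0 -> local_extension x0.
Proof.
move=> Ox0; have [r r0 rO] := open_ball_sub oO Ox0.
have dO : [set y | `|y - x0| <= r / 2] `<=` Omega.
  move=> y /= yr; apply: rO; rewrite (le_lt_trans yr)//.
  by rewrite ltr_pdivrMr// ltr_pMr// ltr1n.
exists (r / 2), id, (N ^+ 4); split => //.
- by rewrite divr_gt0.
- by move=> y /dO yO /(_ (subset_closure yO)).
- move=> u K [[uk _ _ _] _] uB y yr; eexists; eexists.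
  apply: eq_jet (ball_jet alpha_gt0 oO dO uk (C2bndS dO uB) yr) => //.
  move=> z; rewrite inE => /dO zO; rewrite /extend; case: asboolP => // h.
  by case: h; exact: subset_closure.
Qed.

(** The invariant of the gluing: [S] is the region where agreement with [u] is already achieved.
    Linearity and the sup bound hold for arbitrary functions; membership in the domain of L is only
    used for regularity. *)
Record extension_on (S : set V) (E : (V -> R) -> V -> R) := ExtensionOn {
  ext_eq : forall u v, (forall x, closure Omega x -> u x = v x) ->
    forall y, E u y = E v y;
  ext_lin : forall (k : R) u v y,
    E (fun x => k * u x + v x) y = k * E u y + E v y;
  ext_bound : forall u B, 0 <= B -> (forall x, closure Omega x -> `|u x| <= B) ->
    forall y, `|E u y| <= B;
  ext_C2a : exists2 C, 0 <= C & forall u K, dom u -> C2bnd Omega K u ->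
    C2a setT (C * K) (E u);
  ext_supp : exists M : R, forall u y, M < `|y| -> E u y = 0;
  ext_id : forall u y, S y -> closure Omega y -> E u y = u y
}.

Lemma extension_on0 : extension_on set0 (fun _ _ => 0).
Proof.
split => //.
- by move=> k u v y; rewrite mulr0 addr0.
- by move=> u B B0 _ y; rewrite normr0.
- exists 0 => // u K _ _; rewrite mul0r.
  by have := @C2a_cst R n alpha setT 0; rewrite normr0.
- by exists 0.
Qed.

Lemma extension_onW S S' E : (forall y, closure Omega y -> S' y -> S y) ->
  extension_on S E -> extension_on S' E.
Proof. by move=> SS [*]; split => // u y /SS + cy => /(_ cy); eauto. Qed.

Lemma C2a_bound_ge0 S K f x : S x -> C2a S K f -> 0 <= K.
Proof. by move=> Sx /(_ x Sx)[g [H]]; exact: jet_ge0. Qed.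

(** The radius [rho] is obtained before [S] and [E], so a finite cover can be fixed before any
    gluing starts. *)
Lemma extension_onU x0 : closure Omega x0 -> local_extension x0 ->
  exists2 rho, 0 < rho & forall S E, extension_on S E ->
    exists E', extension_on (S `|` [set y | `|y - x0| <= rho]) E'.
Proof.
move=> cx0 [delta [sigma [C [d0 C0 sigmaO extC]]]].
have [eta [eta01 [Ke etaC] [rho rho0 eta1] eta0]] := bump_ex alpha_gt0 alpha_lt1 x0 d0.
have x0d : [set y | `|y - x0| <= delta] x0 by rewrite /= subrr normr0 ltW.
have Ke0 : 0 <= Ke by exact: C2a_bound_ge0 x0d etaC.
exists (Num.min rho delta) => [|S E [Eeq Elin Ebd [CE CE0 EC] [M EM] Eid]].
  by rewrite lt_min rho0.
(* Written as a correction supported in the [delta]-ball, so that [C2a_localize] applies and the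
   local extension is only used where it is defined. *)
pose E' u y := E u y + (if `|y - x0| <= delta then
  eta y * (extend Omega sigma u y - E u y) else 0).
have c0 : 0 <= cN by rewrite (le_trans _ (@cN_ge1 R n)).
exists E'; split.
- move=> u v uv y; rewrite /E' (Eeq _ _ uv); case: ifPn => // yd.
  rewrite /extend; case: asboolP => h; first by rewrite uv.
  by rewrite uv//; exact: sigmaO.
- move=> k u v y; rewrite /E' Elin /extend; case: ifPn => // yd; last by rewrite !addr0.
  by case: asboolP => h; ring.
- move=> u B B0 uB y; rewrite /E'; case: ifPn => yd; last by rewrite addr0; exact: Ebd.
  have eB : `|extend Omega sigma u y| <= B.
    rewrite /extend; case: asboolP => h; first exact: uB.
    by rewrite normrN; apply: uB; exact: sigmaO.
  have EB := Ebd u B B0 uB y.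
  have /andP[e0 e1] := eta01 y.
  have -> : E u y + eta y * (extend Omega sigma u y - E u y) =
     (1 - eta y) * E u y + eta y * extend Omega sigma u y by ring.
  apply: (le_trans (ler_normD _ _)); rewrite !normrM.
  rewrite (ger0_norm e0) ger0_norm ?subr_ge0//.
  have -> : B = (1 - eta y) * B + eta y * B by ring.
  by apply: lerD; apply: ler_wpM2l => //; rewrite subr_ge0.
- exists (CE + (cN * (4 / delta) ^+ 3 + 1) * (8 * cN ^+ 2 * (Ke * (C + CE)))).
    apply: addr_ge0 => //; apply: mulr_ge0; last first.
      apply: mulr_ge0; first by apply: mulr_ge0 => //; exact: exprn_ge0.
      by apply: mulr_ge0 => //; exact: addr_ge0.
    apply: addr_ge0 => //; apply: mulr_ge0 => //; apply: exprn_ge0.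
    by apply: divr_ge0 => //; exact: ltW.
  move=> u K uD uB; rewrite mulrDl; apply: C2aD; first exact: EC.
  have -> : (cN * (4 / delta) ^+ 3 + 1) * (8 * cN ^+ 2 * (Ke * (C + CE))) * K =
    (cN * (4 / delta) ^+ 3 + 1) * (8 * cN ^+ 2 * (Ke * (C * K + `|-1| * (CE * K)))).
    by rewrite normrN normr1; ring.
  apply: C2a_localize => // [|x _ x2]; last by rewrite eta0// mul0r.
  apply: C2aM => //; apply: C2aD; first exact: extC.
  apply: (@eq_C2a _ _ _ _ _ (fun y => -1 * E u y)); first by move=> y _; rewrite mulN1r.
  by apply: C2aZ; apply: C2aW (EC _ _ uD uB).
- exists (Num.max M (`|x0| + delta)) => u y; rewrite gt_max => /andP[My xy].
  rewrite /E' EM// add0r ifF//; apply/negbTE; rewrite -ltNge.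
  have := ler_normD (y - x0) x0; rewrite subrK => h.
  by rewrite -(ltrD2r `|x0|) (lt_le_trans _ h)// addrC.
(* On the closure the local extension equals [u], so the correction vanishes where [E u] was already
   right, and it repairs [E u] where [eta] is 1. *)
- move=> u y Sy cy; rewrite /E' /extend; case: asboolP => // _.
  case: Sy => [Sy|]; first by rewrite Eid// subrr mulr0 if_same addr0.
  rewrite /= le_min => /andP[yr yd]; rewrite yd eta1//; ring.
Qed.

Lemma global_extension : (forall x, closure Omega x -> local_extension x) ->
  exists E, extension_on setT E.
Proof.
move=> loc.
(* Outside the closure [rho] takes the dummy value 0. *)
have /choice[rho Hrho] : forall x, exists rho : R, closure Omega x -> 0 < rho /\
    forall S E, extension_on S E -> exists E', extension_on (S `|` [set y | `|y - x| <= rho]) E'.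
  move=> x; have [cx|ncx] := pselect (closure Omega x); last by exists 0.
  by have [rho rho0 H] := extension_onU cx (loc _ cx); exists rho.
have step (s : seq V) : (forall x, x \in s -> closure Omega x) ->
    exists E, extension_on [set y | exists2 x, x \in s & `|y - x| <= rho x] E.
  elim: s => [|x s IH] xs.
    by exists (fun _ _ => 0); apply: extension_onW extension_on0 => y _ [].
  have [|E] := IH; first by move=> y ys; apply: xs; rewrite inE ys orbT.
  have [_ H] := Hrho x (xs x (mem_head _ _)) => /H[E' extE']; exists E'.
  apply: extension_onW extE' => y _ [z]; rewrite inE => /orP[/eqP->|zs] zy; first by right.
  by left; exists z.
have := compact_closure bO; rewrite compact_cover.
move=> /(_ V (closure Omega) (fun x => (ball x (rho x))°)).
case=> [x _|x cx|s sO cov]; first exact: open_interior.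
  exists x => //; apply: nbhsx_ballx; by have [] := Hrho _ cx.
have [|E extE] := step (finmap.enum_fset s); first by move=> x /sO; rewrite inE.
exists E; apply: extension_onW extE => y cy _; have [x /= xs] := cov _ cy.
move=> /interior_subset; rewrite -ball_normE /= => /ltW xy.
by exists x => //; rewrite distrC.
Qed.

End GlobalExtension.

(** * Comparison with the classical spaces and norms *)

Section Norms.
Context {R : realType} {n : nat} (alpha : R).
Context (alpha_gt0 : 0 < alpha) (alpha_lt1 : alpha < 1).
Local Notation V := 'rV[R]_n.+1.
Local Notation N := (n.+1%:R : R).
Local Notation cN := (@cN R n).
Local Notation C2a := (@C2a R n alpha).
Local Notation C2bnd := (@C2bnd R n alpha).
Local Notation jet := (@jet R n alpha).
Implicit Types (x y z h : V) (f u : V -> R) (K r : R).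

Lemma C2a_jets S K f : C2a S K f -> exists g H, forall x, S x -> jet S K f x (g x) (H x).
Proof.
move=> fK; have /choice[gH HgH] : forall x, exists gH : ('I_n.+1 -> R) * ('I_n.+1 -> 'I_n.+1 -> R),
    S x -> jet S K f x gH.1 gH.2.
  move=> x; have [Sx|nSx] := pselect (S x); last by exists (fun=> 0, fun _ _ => 0).
  by have [g [H J]] := fK x Sx; exists (g, H).
by exists (fun x => (gH x).1), (fun x => (gH x).2).
Qed.

Lemma le_powR_alpha (t : R) : 0 <= t <= 1 -> t <= t `^ alpha.
Proof.
move=> /andP[]; rewrite le_eqVlt => /orP[/eqP<-|t0 t1]; first by rewrite powR_ge0.
by rewrite ger1_powR ?t0// ltW.
Qed.

Lemma C2a_C2bnd K f : C2a setT K f -> C2bnd setT (216 * K) f.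
Proof.
move=> /C2a_jets[g [H J]]; have {}J x : jet setT K f x (g x) (H x) by exact: J.
have K0 : 0 <= K by exact: jet_ge0 (J 0).
have K216 : K <= 216 * K by rewrite ler_peMl// ler1n.
have HK x i j : `|H x i j + H x j i| <= 2 * K.
  apply: (le_trans (ler_normD _ _)); rewrite mulr_natl mulr2n.
  by apply: lerD; have [_ _ + _] := J x; apply.
split=> [[|i [|j [|//]]] x _ _|[|i [|j [|//]]]// x y _ _ _].
- by have [h _ _ _] := J x; exact: le_trans h K216.
- rewrite (partial1_jet alpha_gt0 alpha_lt1 J).
  by have [_ h _ _] := J x; exact: le_trans (h i) K216.
- rewrite (partial2_jet alpha_gt0 alpha_lt1 J) (le_trans (HK _ _ _))//.
  by rewrite ler_wpM2r// ler_nat.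
- rewrite (partial2_jet alpha_gt0 alpha_lt1 J).
  have [yx|yx] := leP `|x - y| (1 / 4).
    exact: (hess_hoelder alpha_gt0 alpha_lt1 J).
  (* For points further apart than 1/4 the Hoelder bound is trivial: two Hessian entries contribute
     at most [4 * K], below [216 * K * (1 / 4)]. *)
  have p : 1 / 4 <= `|x - y| `^ alpha.
    have [x1|x1] := leP `|x - y| 1.
      by rewrite (le_trans (ltW yx))// le_powR_alpha// normr_ge0.
    apply: (@le_trans _ _ (1 `^ alpha)); first by rewrite powR1 ler_pdivrMr// mul1r ler1n.
    by apply: (ge0_ler_powR (ltW alpha_gt0)); rewrite ?nnegrE// ltW.
  apply: (le_trans (ler_normB _ _)); apply: (le_trans (lerD (HK x i j) (HK y i j))).
  apply: (@le_trans _ _ (216 * K * (1 / 4))); first lra.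
  by rewrite ler_wpM2l// mulr_ge0.
Qed.

Lemma C2a_Ck2 K f : C2a setT K f -> Ck 2 setT f.
Proof.
move=> /C2a_jets[g [H J]]; have {}J x : jet setT K f x (g x) (H x) by exact: J.
have K0 : 0 <= K by exact: jet_ge0 (J 0).
have c14 : (0 : R) < 1 / 4 by rewrite divr_gt0.
have c0 : 0 <= cN by rewrite (le_trans _ (@cN_ge1 R n)).
have small x y : `|y - x| <= 1 / 4 -> 0 <= `|y - x| <= 1.
  by rewrite normr_ge0 => /le_trans; apply; rewrite ler_pdivrMr// mul1r ler1n.
have fc x : {for x, continuous f}.
  apply: (hoelder_cvg (C := 2 * cN * K) alpha_gt0 c14) => y /small/[dup]/andP[_ y1] y01.
  apply: (le_trans (jet_lip alpha_gt0 (J x) I y1)).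
  by apply: ler_wpM2l; [do 2! apply: mulr_ge0 => //|exact: le_powR_alpha].
have gc j x : {for x, continuous (fun z => g z j)}.
  apply: (hoelder_cvg (C := 54 * K + N * (2 * K)) alpha_gt0 c14) => y yx.
  have y01 := small _ _ yx; have /andP[_ y1] := y01.
  have e := grad_expansion alpha_gt0 alpha_lt1 J j yx.
  have l : `|\sum_i (H x j i + H x i j) * (y - x) 0 i| <= N * (2 * K) * `|y - x|.
    rewrite -mulrA; apply: ler_norm_sum_ord => i; apply: normrM_le; last exact: coord_le_norm.
    apply: (le_trans (ler_normD _ _)); rewrite mulr_natl mulr2n.
    by apply: lerD; have [_ _ + _] := J x; apply.
  have := ler_normD (g y j - g x j - \sum_i (H x j i + H x i j) * (y - x) 0 i)
    (\sum_i (H x j i + H x i j) * (y - x) 0 i); rewrite subrK => /le_trans; apply.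
  apply: (le_trans (lerD e l)); rewrite [leRHS]mulrDl; apply: lerD.
    apply: ler_wpM2l; first exact: mulr_ge0.
    by rewrite ler_piMl// powR_ge0.
  by apply: ler_wpM2l; [do 2! apply: mulr_ge0 => //|exact: le_powR_alpha].
have hc i j x : {for x, continuous (fun z => H z i j + H z j i)}.
  apply: (hoelder_cvg (C := 216 * K) alpha_gt0 c14) => y yx.
  exact: (hess_hoelder alpha_gt0 alpha_lt1 J).
move=> s; split; case: s => [|j [|k [|//]]] // _.
- by move=> x _; rewrite (partial1_jet alpha_gt0 alpha_lt1 J); exact: gc.
- by move=> x _; rewrite (partial2_jet alpha_gt0 alpha_lt1 J); exact: hc.
- move=> i x _.
  by have [] := @jet_derive _ _ _ alpha_gt0 alpha_lt1 _ _ _ _ _ _ i filterT (J x).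
- move=> i x _; rewrite (partial1_jet alpha_gt0 alpha_lt1 J).
  by have [] := is_derive_grad alpha_gt0 alpha_lt1 J i j x.
Qed.

Lemma C2a_Ckalpha K f : C2a setT K f -> Ckalpha 2 alpha setT f.
Proof.
move=> fK; have fk := C2a_Ck2 fK; have [fB fH] := C2a_C2bnd fK.
have K0 : 0 <= 216 * K by rewrite (le_trans _ (fB [::] 0 isT I)).
have cextT s : (size s <= 2)%N -> cext setT (partial s f) = partial s f.
  by move=> s2; apply/funext => x; apply: cext_in => //; have [+ _] := fk s; apply.
have cT s : (size s <= 2)%N -> {within closure setT, continuous (partial s f)}.
  by move=> s2; apply: continuous_subspaceT => x; have [+ _] := fk s; apply.
split => // [|s s2|s s2].
- exact: (cT [::]).
- by rewrite cextT//; exact: cT.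
- exists (216 * K) => x y _ _; rewrite cextT ?s2//; apply: (le_trans (fH s x y s2 I I)).
  apply: ler_wpM2l => //; apply: (ge0_ler_powR (ltW alpha_gt0)); rewrite ?nnegrE//.
    exact: sqrtr_ge0.
  exact: norm_le_enorm.
Qed.

(** 4 = 3 + 1: the suprema for the orders 0, 1, 2 and the Hoelder quotient. The Euclidean distance
    in that quotient dominates the sup norm, which only helps. *)
Lemma Ckalpha_norm_le O f K : 0 <= K -> C2bnd O K f ->
  (Ckalpha_norm 2 alpha O f <= (4 * K)%:E)%E.
Proof.
move=> K0 [fB fH]; rewrite /Ckalpha_norm.
have -> : (4 * K)%:E = (\sum_(j < 3) K%:E + K%:E)%E.
  by rewrite !big_ord_recr big_ord0 /= -!EFinD; congr _%:E; ring.
apply: leeD; first apply: lee_sum => j _.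
  apply: ge_ereal_sup => _ [s [x [sj Ox ->]]]; rewrite lee_fin; apply: fB => //.
  by rewrite sj -ltnS ltn_ord.
apply: ge_ereal_sup => _ [s [x [y [s2 Ox Oy xy ->]]]]; rewrite lee_fin.
have e0 : 0 < enorm (x - y).
  by rewrite (lt_le_trans _ (norm_le_enorm _))// normr_gt0 subr_eq0.
rewrite ler_pdivrMr ?powR_gt0//; apply: (le_trans (fH s x y s2 Ox Oy)).
apply: ler_wpM2l => //; apply: (ge0_ler_powR (ltW alpha_gt0)); rewrite ?nnegrE ?(ltW e0)//.
exact: norm_le_enorm.
Qed.

Context (Omega : set V) (oO : open Omega) (O0 : Omega !=set0).
Local Notation sup0 f j := (ereal_sup [set z | exists s x,
  [/\ size s = j, Omega x & z = (`|partial s f x|)%:E]]).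
Local Notation sup1 f k := (ereal_sup [set z | exists s x y,
  [/\ size s = k, Omega x, Omega y, x != y &
    z = (`|partial s f x - partial s f y| / enorm (x - y) `^ alpha)%:E]]).

(** The supremum of an empty set is -oo; nonnegativity of the Hoelder seminorm needs a pair of
    distinct points. *)
Lemma open_two_points : exists x y, [/\ Omega x, Omega y & x != y].
Proof.
have [x Ox] := O0; have [r r0 rO] := open_ball_sub oO Ox.
exists x, (x + (r / 2) *: delta_mx 0 0); split => //.
  apply: rO; rewrite addrAC subrr add0r norm_scale_delta ger0_norm.
    by rewrite ltr_pdivrMr// ltr_pMr// ltr1n.
  by rewrite divr_ge0// ltW.
rewrite -subr_eq0 opprD addrA subrr add0r oppr_eq0 -normr_eq0 norm_scale_delta.
by rewrite gt_eqF// normr_gt0 gt_eqF// divr_gt0.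
Qed.

Lemma Ckalpha_sup0_ge0 f j : (0 <= sup0 f j)%E.
Proof.
have [x Ox] := O0; apply: le_ereal_sup_tmp.
exists (`|partial (nseq j ord0) f x|)%:E; last by rewrite lee_fin.
by exists (nseq j ord0), x; rewrite size_nseq.
Qed.

Lemma Ckalpha_sup1_ge0 f k : (0 <= sup1 f k)%E.
Proof.
have [x [y [Ox Oy xy]]] := open_two_points; apply: le_ereal_sup_tmp.
pose s : seq 'I_n.+1 := nseq k ord0.
exists (`|partial s f x - partial s f y| / enorm (x - y) `^ alpha)%:E.
  by exists s, x, y; rewrite size_nseq.
by rewrite lee_fin divr_ge0// powR_ge0.
Qed.

Lemma Ckalpha_norm_ge0 k f : (0 <= Ckalpha_norm k alpha Omega f)%E.
Proof.
apply: adde_ge0; last exact: Ckalpha_sup1_ge0.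
by apply: sume_ge0 => j _; exact: Ckalpha_sup0_ge0.
Qed.

Lemma Ckalpha_norm_C2bnd f K : Ckalpha_norm 2 alpha Omega f = K%:E -> C2bnd Omega (N * K) f.
Proof.
move=> fK; have K0 : 0 <= K by rewrite -lee_fin -fK Ckalpha_norm_ge0.
have N1 : 1 <= N by rewrite ler1n.
have KN : K <= N * K by rewrite ler_peMl.
split=> [s x s2 Ox|s x y s2 Ox Oy].
  rewrite (le_trans _ KN)// -lee_fin -fK.
  have js : (size s < 3)%N by rewrite ltnS.
  apply: (@le_trans _ _ (sup0 f (size s))).
    by apply: ereal_sup_ubound; exists s, x.
  apply: (@le_trans _ _ (\sum_(j < 3) sup0 f j)%E); last first.
    by rewrite leeDl// Ckalpha_sup1_ge0.
  rewrite (bigD1 (Ordinal js))//= leeDl//.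
  by apply: sume_ge0 => j _; exact: Ckalpha_sup0_ge0.
have [->|xy] := eqVneq x y; first by rewrite subrr normr0 !mulr_ge0// powR_ge0.
have e0 : 0 < enorm (x - y).
  by rewrite (lt_le_trans _ (norm_le_enorm _))// normr_gt0 subr_eq0.
have : `|partial s f x - partial s f y| / enorm (x - y) `^ alpha <= K.
  rewrite -lee_fin -fK.
  apply: (@le_trans _ _ (sup1 f 2)).
    by apply: ereal_sup_ubound; exists s, x, y.
  by rewrite leeDr//; apply: sume_ge0 => j _; exact: Ckalpha_sup0_ge0.
rewrite ler_pdivrMr ?powR_gt0// => /le_trans; apply.
rewrite -mulrA [leRHS]mulrCA ler_wpM2l//.
exact: enorm_powR_le.
Qed.

End Norms.

(** * Passage of bounds to the closure, and assembly of the operator *)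

Lemma norm_le_closure (T : topologicalType) (R : realType) (Omega : set T) (u : T -> R) B :
  {within closure Omega, continuous u} -> (forall x, Omega x -> `|u x| <= B) ->
  forall x, closure Omega x -> `|u x| <= B.
Proof.
move=> uc uB x cx; rewrite leNgt; apply/negP => Bx.
have /cvg_norm uxc := ((subspace_continuousP _ u).1 uc) x cx.
have /uxc : nbhs `|u x| [set t : R | B < t] by apply: open_nbhs_nbhs; split => //; exact: open_gt.
move=> /cx[y [Oy /= /(_ (subset_closure Oy))]].
by rewrite ltNge uB.
Qed.

Theorem theorem3p8 (R : realType) (n : nat) (alpha : R)
  (alpha_gt0 : 0 < alpha) (alpha_lt1 : alpha < 1)
  (Omega : set 'rV[R]_n.+1)
  (Omega_domain : domain Omega)
  (Omega_bounded : bounded_set Omega)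
  (Omega_smooth : Ckalpha_smooth 4 alpha Omega)
  (A : 'rV[R]_n.+1 -> 'M[R]_n.+1) (b : 'rV[R]_n.+1 -> 'rV[R]_n.+1)
  (c : 'rV[R]_n.+1 -> R)
  (A_reg : forall i j, Ckalpha 2 alpha Omega (fun x => A x i j))
  (b_reg : forall i, Ckalpha 2 alpha Omega (fun x => b x 0 i))
  (c_reg : Ckalpha 2 alpha Omega c)
  (C : R) (C_gt0 : 0 < C)
  (A_bnd : forall x, closure Omega x -> forall i j, `|A x i j| <= C)
  (b_bnd : forall x, closure Omega x -> forall i, `|b x 0 i| <= C)
  (c_bnd : forall x, closure Omega x -> `|c x| <= C)
  (A_sym : forall x, closure Omega x -> (A x)^T = A x)
  (lambda : R) (lambda_gt0 : 0 < lambda)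
  (A_ell : uniformly_elliptic Omega lambda A) :
  exists E : ('rV[R]_n.+1 -> R) -> ('rV[R]_n.+1 -> R),
    (* E is a map on functions defined on the closure of Omega *)
    (forall u v, DL alpha Omega A b c u -> DL alpha Omega A b c v ->
       (forall x, closure Omega x -> u x = v x) -> forall y, E u y = E v y) /\
    (forall u, DL alpha Omega A b c u -> Ckalpha_c 2 alpha (E u)) /\
    (forall (k : R) u v, DL alpha Omega A b c u -> DL alpha Omega A b c v ->
       forall y, E (fun x => k * u x + v x) y = k * E u y + E v y) /\
    (exists M : R, forall u, DL alpha Omega A b c u ->
       (Ckalpha_norm 2 alpha setT (E u)
          <= M%:E * Ckalpha_norm 2 alpha Omega u)%E) /\
    (forall u, DL alpha Omega A b c u ->
       (forall x, Omega x -> E u x = u x) /\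
       ereal_sup [set (`|E u y|)%:E | y in [set: 'rV[R]_n.+1]]
         = ereal_sup [set (`|u y|)%:E | y in Omega]).

Proof.
have [ne0 oO _] := Omega_domain; have cO := compact_closure Omega_bounded.
have loc x : closure Omega x -> local_extension alpha Omega A b c x.
  move=> cx; have [Ox|nOx] := pselect (Omega x); first exact: interior_extension.
  have xbd : boundary Omega x by split => // /interior_subset.
  have [W [U [psi [phi bc]]]] := smooth_boundary_chart oO Omega_smooth xbd.
  exact: (boundary_extension alpha_gt0 alpha_lt1 bc cO c A_reg b_reg A_sym lambda_gt0 A_ell).
have [E [Eeq Elin Ebd [CE CE0 EC] [M EM] Eid]] :=
  global_extension alpha_gt0 alpha_lt1 Omega_bounded loc.
have EK u : DL alpha Omega A b c u -> exists K, C2a alpha setT K (E u).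
  move=> uD; have [uC _] := uD; have [K _ uB] := Ckalpha_C2bnd alpha_gt0 alpha_lt1 oO cO uC.
  by exists (CE * K); exact: EC.
exists E; split; first by move=> u v _ _ uv y; exact: Eeq.
split.
  move=> u uD; split; first by have [K] := EK u uD; exact: C2a_Ckalpha.
  apply: compact_closure; exists M; split; first exact: num_real.
  move=> B MB y /= Ey; rewrite leNgt; apply: contra Ey => By.
  by apply/eqP; apply: EM; exact: lt_trans By.
split; first by move=> k u v _ _ y; exact: Elin.
split.
  (* The added 1 keeps the constant positive even if [CE] is 0, so that its product with an infinite
     norm is infinite. *)
  exists (4 * (216 * (CE * n.+1%:R)) + 1) => u uD.
  have M0 : 0 < 4 * (216 * (CE * n.+1%:R)) + 1 by rewrite ltr_wpDl// !mulr_ge0.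
  have := Ckalpha_norm_ge0 alpha oO ne0 2 u.
  case nu : (Ckalpha_norm 2 alpha Omega u) => [K||] //= K0; last first.
    by rewrite gt0_muley ?leey// lte_fin.
  rewrite lee_fin in K0.
  have uB := Ckalpha_norm_C2bnd alpha_gt0 alpha_lt1 oO ne0 nu.
  have EB := C2a_C2bnd alpha_gt0 alpha_lt1 (EC _ _ uD uB).
  apply: (le_trans (Ckalpha_norm_le alpha_gt0 _ EB)); first by rewrite !mulr_ge0.
  rewrite -EFinM lee_fin.
  have -> : (4 * (216 * (CE * n.+1%:R)) + 1) * K = 4 * (216 * (CE * (n.+1%:R * K))) + K by ring.
  by rewrite lerDl.
move=> u uD; have EO x : closure Omega x -> E u x = u x by exact: Eid.
split => [x Ox|]; first by apply: EO; exact: subset_closure.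
have [uC _] := uD; have [_ uc _ _] := uC.
have [K K0 [uK _]] := Ckalpha_C2bnd alpha_gt0 alpha_lt1 oO cO uC.
apply/eqP; rewrite eq_le; apply/andP; split; last first.
  apply: ereal_sup_le => _ [x Ox <-]; exists x => //.
  by rewrite EO//; exact: subset_closure.
(* [ext_bound] asks for a real bound on the closure: the supremum over the domain is finite, and
   continuity of [u] carries it to the closure. *)
set s := ereal_sup [set (`|u y|)%:E | y in Omega].
have us x : Omega x -> ((`|u x|)%:E <= s)%E by move=> Ox; apply: ereal_sup_ubound; exists x.
have sK : (s <= K%:E)%E.
  by apply: ge_ereal_sup => _ [x Ox <-]; rewrite lee_fin; exact: (uK [::]).
have s0 : (0 <= s)%E by have [x Ox] := ne0; apply: le_trans (us x Ox); rewrite lee_fin.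
have sfin : s \is a fin_num by rewrite ge0_fin_numE// (le_lt_trans sK)// ltry.
apply: ge_ereal_sup => _ [y _ <-]; rewrite -(fineK sfin) lee_fin.
apply: Ebd; first exact: fine_ge0.
apply: norm_le_closure => // x Ox; rewrite -lee_fin fineK//; exact: us.
Qed.
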